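(* Let $p,q\in(0,\infty]$ with $p\neq q$ and let $\Omega:S^p_0\to S^q$ be a bicentralizer. Then there exist $c\in\mathbb C$ and $M\geq 0$ such that $\|\Omega(f)-cf\|_q\leq M\|f\|_p$ for all $f\in S^p_0$. In particular, if $q>p$, then $\Omega$ is bounded.
   Context: $\mathscr H$ is a separable complex Hilbert space and $B=B(\mathscr H)$. For $0<p<\infty$, $S^p$ is the Schatten class with $\|f\|_p=(\sum_n s_n(f)^p)^{1/p}$, where $s_n(f)$ are the singular numbers of $f$; $S^\infty=K$ is the space of compact operators with the operator norm. $S^p_0$ is the space of finite-rank operators with the quasinorm $\|\cdot\|_p$. A bicentralizer $\Omega:S^p_0\to S^q$ is a homogeneous map ($\Omega(tf)=t\Omega(f)$ for $t\in\mathbb C$) that is both a left and a right centralizer, i.e. there is a constant $C$ such that $\|\Omega(af)-a\Omega(f)\|_q\leq C\|a\|_B\|f\|_p$ and $\|\Omega(fa)-\Omega(f)a\|_q\leq C\|f\|_p\|a\|_B$ for all $a\in B$, $f\in S^p_0$. $\Omega$ is bounded if there is $M$ with $\|\Omega(f)\|_q\leq M\|f\|_p$ for all $f\in S^p_0$. *)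

(* Defs.v *)
From HB Require Import structures.
From mathcomp Require Import all_boot all_order all_algebra.
From mathcomp Require Import all_classical all_reals all_analysis.
From mathcomp Require Import complex.

Set Implicit Arguments.
Unset Strict Implicit.
Unset Printing Implicit Defensive.

Import Order.TTheory GRing.Theory Num.Theory.
Import numFieldNormedType.Exports.

Local Open Scope classical_set_scope.
Local Open Scope complex_scope.
Local Open Scope ring_scope.

Definition separable (T : topologicalType) : Prop :=
  exists2 A : set T, countable A & dense A.

Section Operators.
Context {R : realType} {H : completeNormedModType R[i]}.
Implicit Types (f : H -> H) (p : \bar R).

Definition bounded_operator : set (H -> H) :=
  [set f | linear f /\ continuous f].

Definition finite_rank : set (H -> H) :=
  [set f | bounded_operator f /\ exists n (v : 'I_n -> H),
     forall x, exists c : 'I_n -> R[i], f x = \sum_(i < n) c i *: v i].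

Definition compact_operator : set (H -> H) :=
  [set f | bounded_operator f /\ precompact (f @` [set x | `|x| <= 1])].

(* The norm of H takes its values in R[i]; complex.Re brings it back to R. *)
Definition opnorm f : \bar R :=
  ereal_sup [set (complex.Re `|f x|)%:E | x in [set x | `|x| <= 1]].

Variable ip : {dot H for Num.conj}.

Definition orthonormal_on (D : set nat) (x : nat -> H) : Prop :=
  forall m n, D m -> D n -> ip (x m) (x n) = (m == n)%:R.

(* Schmidt expansion f = \sum_n s_n <., x_n> y_n.  The families x and y are
   only required to be orthonormal where s is nonzero, so that finite-rank
   operators (in particular when dim H is finite) are covered, their sequence s
   being padded with zeros. *)
Definition schmidt_expansion f (s : nat -> R) (x y : nat -> H) : Prop :=
  [/\ orthonormal_on [set n | s n != 0] x,
      orthonormal_on [set n | s n != 0] y &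
      forall h, series (fun n => ((s n)%:C * ip h (x n)) *: y n) @ \oo --> f h].

Definition is_singular_numbers f (s : nat -> R) : Prop :=
  [/\ forall n, 0 <= s n,
      nonincreasing_seq s,
      s @ \oo --> (0 : R) &
      exists x y, schmidt_expansion f s x y].

(* Meaningful for compact f, for which there is exactly one such sequence. *)
Definition singular_numbers f : nat -> R :=
  xget (fun=> 0) [set s | is_singular_numbers f s].

Definition schatten_norm p f : \bar R :=
  if p is r%:E then
    ((\sum_(0 <= n <oo) (singular_numbers f n `^ r)%:E) `^ r^-1)%E
  else opnorm f.

Definition schatten p : set (H -> H) :=
  [set f | compact_operator f /\ (schatten_norm p f < +oo)%E].

Definition bicentralizer p q (Omega : (H -> H) -> (H -> H)) : Prop :=
  [/\ forall f, finite_rank f -> schatten q (Omega f),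
      forall (t : R[i]) f, finite_rank f -> Omega (t *: f) = t *: Omega f &
      exists C : R, forall a f, bounded_operator a -> finite_rank f ->
        (schatten_norm q (Omega (a \o f) - (a \o Omega f))%R
           <= C%:E * opnorm a * schatten_norm p f)%E /\
        (schatten_norm q (Omega (f \o a) - (Omega f \o a))%R
           <= C%:E * schatten_norm p f * opnorm a)%E].

Definition bounded_on_finite_rank p q (Phi : (H -> H) -> (H -> H)) : Prop :=
  exists M : R, forall f, finite_rank f ->
    (schatten_norm q (Phi f) <= M%:E * schatten_norm p f)%E.

End Operators.

(* Main.v *)
(* Singular numbers of compact operators are handled as Gelfand numbers: s_n(f)
   is the least B such that |f x| <= B |x| on a subspace of codimension at most
   n.

   p < q. Write f = sum s_n <., x_n> y_n and split the indices n >= k by their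
   residues mod k. Omega f is, up to an error C_k |f|_p, the sum of k mutually
   orthogonal pieces P_i (Omega f_i) Q_i with |f_i|_p <= k^(-1/p) |f|_p, whence
   a bound M_N for rank N satisfies M_(N+1) <= K k^(1/q - 1/p) M_N + C_k, and
   K k^(1/q - 1/p) <= 1/2 for k large.

   q < p. Conjugating by partial isometries, f may be taken diagonal in a fixed
   orthonormal sequence. Omega of k orthogonal copies of f is k orthogonal copies
   of Omega f up to C_k |f|_p, so the norm of Omega f - c f is at most
   K k^(-1/q) times that for the k copies, plus C_k |f|_p. Iterating J times
   gives a geometric series and leaves the remainder
   (K k^(1/p - 1/q))^J times the supremum norm of f, as soon as
   |Omega E - c E|_q <= M n^(1/p) for E the projection onto n vectors. The latter
   holds because Omega E almost commutes with every subprojection P of E: pick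
   greedily orthonormal e_r, f_r such that Omega E maps e_r to
   a_r e_r + b_r f_r with b_r nearly maximal. The commutator with the projection
   onto the f_r has the b_r as singular numbers, and off the first 4r vectors
   every vector is an eigenvector up to b_r, hence Omega E is nearly scalar. *)
Require Import Defs.
From mathcomp Require Import all_boot all_order all_algebra.
From mathcomp Require Import all_classical all_reals all_analysis.
From mathcomp Require Import complex ring lra zify.

Set Implicit Arguments.
Unset Strict Implicit.
Unset Printing Implicit Defensive.

Import Order.TTheory GRing.Theory Num.Theory.
Import numFieldNormedType.Exports.

Local Open Scope classical_set_scope.
Local Open Scope complex_scope.
Local Open Scope ring_scope.

(** * Sequences *)

Section Sequences.
Context {R : realType}.
Implicit Types (p : \bar R) (s t : nat -> R) (A B : R).

(** [Omega] is not additive, so a decomposition of [f] cannot be passed through it. Splittings are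
    made on the outside: if [R0] is a sum of operators [P_i] and [R0 \o f = f], the centralizer
    estimate compares [Omega f] with the sum of the [P_i \o Omega f], which is a genuine sum. The
    exponents may be below 1, so each use of the triangle inequality costs a factor [K], and [k]
    summands cost a power of order [k]. Only error terms are summed this way, at a price hidden in
    [C_k]. The main terms are mutually orthogonal; for them the factor [k^(1/q)] is available
    without any [K], and [k] is chosen to beat the few [K] that remain.

    For q < p the scalar found on N vectors depends on N. These scalars are bounded, because one
    rank-one projection determines them up to a bounded error, and a cluster point serves for all N.
    Diagonal operators of every rank need an infinite orthonormal sequence; when [id] has finite
    rank, [Omega f] is compared with [f \o Omega id] instead. *)

Definition inv_exp p : R := if p is r%:E then r^-1 else 0.

(** The bound is read off the partial sums, with neither an infinite sum nor a root; for an infinite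
    exponent it is a supremum bound. [B] is any upper bound, so estimates can be weakened freely. *)
Definition lp_le p s B : Prop :=
  if p is r%:E then forall n, \sum_(j < n) s j `^ r <= B `^ r
  else forall j, s j <= B.

Lemma inv_exp_ge0 p : (0 < p)%E -> 0 <= inv_exp p.
Proof. by case: p => [r| |] //=; rewrite lte_fin => /ltW r0; rewrite invr_ge0. Qed.

Lemma powR_le r A B : 0 < r -> 0 <= A -> A <= B -> A `^ r <= B `^ r.
Proof.
by move=> r0 A0 AB; rewrite ge0_ler_powR ?nnegrE ?(ltW r0) ?(le_trans A0 AB).
Qed.

Lemma powR_invK r A : 0 < r -> 0 <= A -> (A `^ r^-1) `^ r = A.
Proof. by move=> r0 A0; rewrite -powRrM mulVf ?gt_eqF// powRr1. Qed.

Lemma lp_le_mono p s t A B : (0 < p)%E -> 0 <= A -> (forall j, 0 <= s j <= t j) ->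
  A <= B -> lp_le p t A -> lp_le p s B.
Proof.
case: p => [r| |] //= p0 A0 st AB H => [n|j].
  have r0 : 0 < r by rewrite -lte_fin.
  apply: le_trans (powR_le r0 A0 AB); apply: le_trans (H n); apply: ler_sum => j _.
  by have /andP[s0 ?] := st j; exact: powR_le.
by have /andP[_ /le_trans] := st j; apply; apply: le_trans AB.
Qed.

Lemma lp_leW p s A B : (0 < p)%E -> 0 <= A -> (forall j, 0 <= s j) ->
  A <= B -> lp_le p s A -> lp_le p s B.
Proof. by move=> p0 A0 s0; apply: lp_le_mono => // j; rewrite s0 lexx. Qed.

Lemma lp_leZ p s c B : 0 <= c -> 0 <= B -> (forall j, 0 <= s j) ->
  lp_le p s B -> lp_le p (fun j => c * s j) (c * B).
Proof.
case: p => [r| |] //= c0 B0 s0 H => [n|j|j]; last 2 first.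
- by rewrite ler_wpM2l.
- by rewrite ler_wpM2l.
rewrite powRM//; under eq_bigr do rewrite powRM//.
by rewrite -mulr_sumr ler_wpM2l// powR_ge0.
Qed.

(** From [s + t <= 2 max(s, t)] one gets [(s + t)^r <= 2^r (s^r + t^r)] for every [r > 0], and
    [A^r + B^r <= 2 (A + B)^r] supplies [2^(1/p)]. The constant is crude, but [r < 1] and [r >= 1]
    are treated alike. *)
Lemma lp_leD p s t A B : (0 < p)%E -> 0 <= A -> 0 <= B ->
  (forall j, 0 <= s j) -> (forall j, 0 <= t j) ->
  lp_le p s A -> lp_le p t B ->
  lp_le p (fun j => s j + t j) (2 * 2 `^ inv_exp p * (A + B)).
Proof.
case: p => [r| |] //= p0 A0 B0 s0 t0 HA HB => [n|j]; last first.
  have := HA j; have := HB j; rewrite powRr0; lra.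
have r0 : 0 < r by rewrite -lte_fin.
rewrite !powRM ?powR_ge0 ?mulr_ge0 ?addr_ge0// powR_invK//.
have pw j : (s j + t j) `^ r <= 2 `^ r * (s j `^ r + t j `^ r).
  wlog st : s t s0 t0 {A A0 HA B B0 HB} / s j <= t j.
    by case: (leP (s j) (t j)) => [?|/ltW ?] H; [|rewrite addrC (addrC (s j `^ r))]; apply: H.
  apply: le_trans (_ : (2 * t j) `^ r <= _).
    by apply: powR_le; rewrite ?addr_ge0//; lra.
  by rewrite powRM// ler_wpM2l ?powR_ge0// lerDr powR_ge0.
apply: le_trans (_ : \sum_(j < n) 2 `^ r * (s j `^ r + t j `^ r) <= _).
  by apply: ler_sum => j _; exact: pw.
rewrite -mulr_sumr -mulrA ler_wpM2l ?powR_ge0// big_split/=.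
apply: le_trans (_ : A `^ r + B `^ r <= _); first exact: lerD.
by rewrite mulr2n mulrDl mul1r lerD//; apply: powR_le => //; lra.
Qed.

Lemma sum_ord_mul (V : nmodType) (k n : nat) (F : nat -> V) :
  \sum_(j < k * n) F j = \sum_(i < n) \sum_(l < k) F (k * i + l)%N.
Proof.
elim: n => [|n IH]; first by rewrite muln0 !big_ord0.
rewrite big_ord_recr/= -IH mulnS addnC.
rewrite -(big_mkord xpredT F) (big_cat_nat (leq0n _) (leq_addr k _))/= big_mkord; congr (_ + _).
by rewrite -{1}(addn0 (k * n)%N) addnC big_addn addKn big_mkord; apply: eq_bigr => i _; rewrite addnC.
Qed.

Lemma sum_dilate (k n : nat) (F : nat -> R) : (0 < k)%N ->
  \sum_(j < k * n) F (j %/ k)%N = k%:R * \sum_(i < n) F i.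
Proof.
move=> k0; rewrite (sum_ord_mul k n (fun j => F (j %/ k)%N)) mulr_sumr; apply: eq_bigr => i _.
rewrite (eq_bigr (fun=> F i)); first by rewrite sumr_const card_ord mulr_natl.
by move=> l _; rewrite mulnC divnMDl// divn_small// addn0.
Qed.

Lemma sum_widen (F : nat -> R) (n m : nat) : (forall j, 0 <= F j) -> (n <= m)%N ->
  \sum_(j < n) F j <= \sum_(j < m) F j.
Proof.
move=> F0 nm; rewrite -!(big_mkord xpredT F) (big_cat_nat (leq0n n) nm)/= lerDl.
exact: sumr_ge0.
Qed.

(** The dilated sequence repeats each term [k] times, so its sum of powers is multiplied by [k]. *)
Lemma lp_le_dilate p s k B : (0 < p)%E -> (0 < k)%N -> 0 <= B ->
  (forall j, 0 <= s j) -> lp_le p s B ->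
  lp_le p (fun j => s (j %/ k)%N) (k%:R `^ inv_exp p * B).
Proof.
case: p => [r| |] //= p0 k0 B0 s0 H => [n|j]; last by rewrite powRr0 mul1r.
rewrite powRM ?powR_ge0// powR_invK//.
apply: le_trans (_ : \sum_(j < k * n) s (j %/ k)%N `^ r <= _).
  apply: (sum_widen (F := fun j => s (j %/ k)%N `^ r)) => [j|]; first exact: powR_ge0.
  exact: leq_pmull.
by rewrite (sum_dilate _ (fun j => s j `^ r))//; apply: ler_wpM2l; [exact: ler0n | exact: H].
Qed.

Lemma lp_le_undilate p s k B : (0 < p)%E -> (0 < k)%N -> 0 <= B ->
  (forall j, 0 <= s j) ->
  lp_le p (fun j => s (j %/ k)%N) (k%:R `^ inv_exp p * B) -> lp_le p s B.
Proof.
case: p => [r| |] //= p0 k0 B0 s0 H => [n|j]; last first.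
  by have := H (j * k)%N; rewrite mulnK// powRr0 mul1r.
have := H (k * n)%N; rewrite powRM ?powR_ge0// powR_invK//.
by rewrite (sum_dilate _ (fun j => s j `^ r))// ler_pM2l// ltr0n.
Qed.

Lemma lp_le0 p s B : (0 < p)%E -> 0 <= B -> (forall j, 0 <= s j) -> lp_le p s B -> s 0%N <= B.
Proof.
case: p => [r| |] //= p0 B0 s0 H; have r0 : 0 < r by rewrite -lte_fin.
have := H 1%N; rewrite big_ord1 => H1.
rewrite leNgt; apply/negP => /(gt0_ltr_powR r0); rewrite !nnegrE => /(_ B0 (s0 _)).
by rewrite ltNge H1.
Qed.

Lemma lp_le_finite p s n A : (0 < p)%E -> 0 <= A -> (forall j, (j < n)%N -> 0 <= s j <= A) ->
  (forall j, (n <= j)%N -> s j = 0) -> lp_le p s (n%:R `^ inv_exp p * A).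
Proof.
case: p => [r| |] //= p0 A0 sA s0 => [m|j]; last first.
  by rewrite powRr0 mul1r; have [/sA/andP[]//|/s0->] := ltnP j n.
have r0 : 0 < r by rewrite -lte_fin.
rewrite powRM ?powR_ge0// powR_invK//.
apply: le_trans (_ : \sum_(j < n) s j `^ r <= _).
  have [mn|/ltnW nm] := leqP m n.
    by rewrite -!(big_mkord xpredT (fun j => s j `^ r)) (big_cat_nat (leq0n m) mn)/= lerDl
      sumr_ge0// => *; exact: powR_ge0.
  rewrite -!(big_mkord xpredT (fun j => s j `^ r)) (big_cat_nat (leq0n n) nm)/= gerDl.
  rewrite big_nat_cond big1// => j; rewrite andbT => /andP[/s0->] _.
  by rewrite powR0// gt_eqF.
rewrite mulr_natl -[n in _ *+ n]card_ord -sumr_const; apply: ler_sum => j _.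
have /andP[a0 aA] := sA j (ltn_ord j).
exact: powR_le.
Qed.

(* Greedy merging: always consume the largest remaining head among the [a i]. *)
Lemma lp_le_merge p (k : nat) (a : 'I_k -> nat -> R) (c : nat -> R) B :
  (0 < p)%E -> 0 <= B -> (forall j, 0 <= c j) -> (0 < k)%N ->
  (forall i j, 0 <= a i j) ->
  (forall (n : 'I_k -> nat) A, (forall i, a i (n i) <= A) -> c (\sum_i n i)%N <= A) ->
  (forall i, lp_le p (a i) B) -> lp_le p c (k%:R `^ inv_exp p * B).
Proof.
move=> p0 B0 c0 k0 a0 ca; have pick (n : 'I_k -> nat) : exists i, c (\sum_i n i)%N <= a i (n i).
  pose i0 := Ordinal k0.
  have [/= i _ ai] := @arg_maxP _ _ _ i0 xpredT (fun i => a i (n i)) isT.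
  by exists i; apply: ca => l; apply: ai.
case: p p0 => [r| |] //= p0 aB => [m|j]; last first.
  rewrite powRr0 mul1r.
  have := pick (fun i => if i == Ordinal k0 then j else 0%N).
  rewrite -big_mkcond big_pred1_eq => -[i /le_trans]; apply; exact: aB.
rewrite powRM ?powR_ge0// powR_invK//.
(* [n i] counts the terms of [a i] consumed during the first [m] choices. *)
have [n [nm nle]] : exists n : 'I_k -> nat, (\sum_i n i = m)%N /\
    \sum_(j < m) c j `^ r <= \sum_i \sum_(j < n i) a i j `^ r.
  elim: m => [|m [n [nm IH]]].
    exists (fun=> 0%N); split; first by rewrite big1.
    by rewrite big_ord0 sumr_ge0// => i _; rewrite big_ord0.
  have [i ci] := pick n; exists (fun l => (n l + (l == i))%N); split.
    rewrite big_split/= nm (bigD1 i)//= eqxx big1 ?addn0 ?addn1// => l /negPf->//.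
  rewrite big_ord_recr/= (bigD1 i)//= eqxx addn1 big_ord_recr/=.
  rewrite addrAC; apply: lerD; last by apply: powR_le => //; rewrite -nm.
  apply: le_trans IH _; rewrite (bigD1 i)//= lerD2l.
  by apply: ler_sum => l /negPf->; rewrite addn0.
apply: (le_trans nle); rewrite mulr_natl -[k in _ *+ k]card_ord -sumr_const.
by apply: ler_sum => i _; apply: aB.
Qed.

End Sequences.

(** * Hilbert space *)

Section Modulus.
Context {R : realType}.
Implicit Types z w : R[i].

Definition cabs z : R := complex.Re `|z|.

Lemma cabsE z : `|z| = (cabs z)%:C.
Proof. by rewrite /cabs RRe_real ?normr_real. Qed.

Lemma cabs_ge0 z : 0 <= cabs z.
Proof. by rewrite -lecR -cabsE; exact: normr_ge0. Qed.

Lemma cabsM z w : cabs (z * w) = cabs z * cabs w.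
Proof. by apply: complexI; rewrite rmorphM/= -!cabsE normrM. Qed.

Lemma cabsD z w : cabs (z + w) <= cabs z + cabs w.
Proof. by rewrite -lecR rmorphD/= -!cabsE ler_normD. Qed.

Lemma cabsR (a : R) : cabs a%:C = `|a|.
Proof. by apply: complexI; rewrite -cabsE normc_def/= expr0n/= addr0 sqrtr_sqr. Qed.

Lemma cabs0_eq0 z : cabs z = 0 -> z = 0.
Proof. by move=> z0; apply: normr0_eq0; rewrite cabsE z0. Qed.

Lemma cabs0 : cabs 0 = 0. Proof. by rewrite -[0]/((0:R)%:C) cabsR normr0. Qed.
Lemma cabs1 : cabs 1 = 1. Proof. by rewrite -[1]/((1:R)%:C) cabsR normr1. Qed.

Lemma cabsN z : cabs (- z) = cabs z.
Proof. by rewrite /cabs normrN. Qed.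

Lemma conjC_real (a : R) : ((a%:C : R[i])^*)%R = a%:C.
Proof. by apply: CrealP; rewrite complex_real. Qed.

Lemma mul_conjC z : z * (z^*)%R = (cabs z ^+ 2)%:C.
Proof. by rewrite rmorphXn/= -cabsE normCK. Qed.

End Modulus.

Section Hilbert.
Context {R : realType} {H : completeNormedModType R[i]}.

Definition nrm (x : H) : R := complex.Re `|x|.

Lemma nrmE (x : H) : `|x| = (nrm x)%:C.
Proof. by rewrite /nrm RRe_real ?normr_real. Qed.

Lemma nrm_ge0 (x : H) : 0 <= nrm x.
Proof. by rewrite -lecR -nrmE; exact: normr_ge0. Qed.

Lemma nrmZ (c : R[i]) (x : H) : nrm (c *: x) = cabs c * nrm x.
Proof. by apply: complexI; rewrite rmorphM/= -!nrmE normrZ cabsE. Qed.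

Lemma nrmD (x y : H) : nrm (x + y) <= nrm x + nrm y.
Proof. by rewrite -lecR rmorphD/= -!nrmE ler_normD. Qed.

Lemma nrmN (x : H) : nrm (- x) = nrm x.
Proof. by rewrite /nrm normrN. Qed.

Lemma nrmB (x y : H) : nrm (x - y) <= nrm x + nrm y.
Proof. by rewrite -(nrmN y) nrmD. Qed.

Lemma nrm0 : nrm 0 = 0. Proof. by rewrite /nrm normr0. Qed.

Lemma nrm0_eq0 (x : H) : nrm x = 0 -> x = 0.
Proof. by move=> z0; apply: normr0_eq0; rewrite nrmE z0. Qed.

Context (ip : {dot H for Num.conj}) (ip_norm : forall x : H, `|x| ^+ 2 = ip x x).

Lemma ipDl (x y z : H) : ip (x + y) z = ip x z + ip y z.
Proof. exact: linearDl. Qed.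
Lemma ipZl c (x z : H) : ip (c *: x) z = c * ip x z.
Proof. exact: linearZl_LR. Qed.
Lemma ipBl (x y z : H) : ip (x - y) z = ip x z - ip y z.
Proof. exact: linearBl. Qed.
Lemma ip0l (z : H) : ip 0 z = 0.
Proof. exact: linear0l. Qed.
Lemma ip_suml (I : Type) (r : seq I) (P : pred I) (F : I -> H) z :
  ip (\sum_(i <- r | P i) F i) z = \sum_(i <- r | P i) ip (F i) z.
Proof. exact: linear_sumlz. Qed.
Lemma ipC (x y : H) : ip x y = ((ip y x)^*)%R.
Proof. by rewrite (hermC ip x y) expr0 mul1r. Qed.
Lemma ipDr (x y z : H) : ip z (x + y) = ip z x + ip z y.
Proof. exact: linearDr. Qed.
Lemma ipZr c (x z : H) : ip z (c *: x) = (c^*)%R * ip z x.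
Proof. exact: linearZr_LR. Qed.
Lemma ip0r (z : H) : ip z 0 = 0.
Proof. exact: linear0r. Qed.
Lemma ip_sumr (I : Type) (r : seq I) (P : pred I) (F : I -> H) z :
  ip z (\sum_(i <- r | P i) F i) = \sum_(i <- r | P i) ip z (F i).
Proof. exact: linear_sumr. Qed.
Lemma ip_eq0C (x y : H) : ip x y = 0 -> ip y x = 0.
Proof. by rewrite (ipC y) => ->; rewrite conjC0. Qed.

Lemma ip_scalar z : scalar (ip^~ z).
Proof. by move=> a x y; rewrite ipDl ipZl. Qed.

Lemma ip_sqr (x : H) : ip x x = (nrm x ^+ 2)%:C.
Proof. by rewrite rmorphXn/= -nrmE ip_norm. Qed.

Lemma nrm_sqrE (x : H) : nrm x ^+ 2 = complex.Re (ip x x).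
Proof. by rewrite ip_sqr. Qed.

Lemma Re_conj (z : R[i]) : complex.Re (z^*)%R = complex.Re z.
Proof. by case: z. Qed.

Lemma nrm_sqrD (x y : H) :
  nrm (x + y) ^+ 2 = nrm x ^+ 2 + nrm y ^+ 2 + 2 * complex.Re (ip x y).
Proof.
rewrite !nrm_sqrE ipDl !ipDr (ipC y x) !raddfD/= Re_conj; ring.
Qed.

Lemma nrm_sqrB (x y : H) :
  nrm (x - y) ^+ 2 = nrm x ^+ 2 + nrm y ^+ 2 - 2 * complex.Re (ip x y).
Proof. by rewrite nrm_sqrD nrmN (_ : ip x (- y) = - ip x y) ?raddfN ?mulrN//; exact: linearNr. Qed.

Lemma pythagoras (x y : H) : ip x y = 0 -> nrm (x + y) ^+ 2 = nrm x ^+ 2 + nrm y ^+ 2.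
Proof. by rewrite nrm_sqrD => ->; rewrite mulr0 addr0. Qed.

Lemma parallelogram (x y : H) :
  nrm (x - y) ^+ 2 = 2 * nrm x ^+ 2 + 2 * nrm y ^+ 2 - nrm (x + y) ^+ 2.
Proof. rewrite nrm_sqrB nrm_sqrD; ring. Qed.

Lemma nrm1_ip (x : H) : ip x x = 1 -> nrm x = 1.
Proof.
rewrite ip_sqr -[1]/((1:R)%:C) => /complexI/eqP; rewrite sqrf_eq1 => /orP[/eqP//|/eqP x1].
by have := nrm_ge0 x; rewrite x1; lra.
Qed.

Lemma ip1_nrm (x : H) : nrm x = 1 -> ip x x = 1.
Proof. by rewrite ip_sqr => ->; rewrite expr1n. Qed.

Lemma ler_sqr_nneg (a b : R) : 0 <= b -> a ^+ 2 <= b ^+ 2 -> a <= b.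
Proof. by move=> b0 ab; rewrite leNgt; apply/negP => ba; nra. Qed.

Lemma cauchy_schwarz (x y : H) : cabs (ip x y) <= nrm x * nrm y.
Proof.
have [y0|y0] := eqVneq (nrm y) 0.
  by rewrite (nrm0_eq0 y0) ip0r cabs0 nrm0 mulr0.
have ygt0 : 0 < nrm y by rewrite lt_neqAle eq_sym y0 nrm_ge0.
pose c := ip x y * ((nrm y ^- 2)%:C).
have zy : ip (x - c *: y) y = 0.
  rewrite ipBl ipZl ip_sqr /c -mulrA -rmorphM/= mulVf ?expf_neq0//.
  by rewrite rmorph1 mulr1 subrr.
have := pythagoras (x := x - c *: y) (y := c *: y).
rewrite ipZr zy mulr0 subrK => /(_ erefl) xz.
have cE : nrm (c *: y) = cabs (ip x y) / nrm y.
  rewrite nrmZ /c cabsM cabsR ger0_norm ?invr_ge0 ?sqr_ge0//.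
  by rewrite -mulrA expr2 invfM -mulrA mulVf// mulr1.
rewrite -ler_pdivrMr// -cE; apply: ler_sqr_nneg; first exact: nrm_ge0.
by rewrite xz lerDr sqr_ge0.
Qed.

End Hilbert.

Section BoundedOperators.
Context {R : realType} {H : completeNormedModType R[i]}.
Implicit Types (f g : H -> H).

Lemma linD (V W : lmodType R[i]) (f : V -> W) : linear f -> forall x y, f (x + y) = f x + f y.
Proof. by move=> lf x y; rewrite -[x]scale1r lf !scale1r. Qed.
Lemma lin0 (V W : lmodType R[i]) (f : V -> W) : linear f -> f 0 = 0.
Proof. by move=> lf; apply: (addIr (f 0)); rewrite -linD// !add0r. Qed.
Lemma linZ (V W : lmodType R[i]) (f : V -> W) : linear f -> forall c x, f (c *: x) = c *: f x.
Proof. by move=> lf c x; rewrite -[c *: x]addr0 lf lin0// addr0. Qed.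
Lemma linN (V W : lmodType R[i]) (f : V -> W) : linear f -> forall x, f (- x) = - f x.
Proof. by move=> lf x; rewrite -scaleN1r linZ// scaleN1r. Qed.
Lemma linB (V W : lmodType R[i]) (f : V -> W) : linear f -> forall x y, f (x - y) = f x - f y.
Proof. by move=> lf x y; rewrite linD// linN. Qed.
Lemma lin_sum (V W : lmodType R[i]) (f : V -> W) (I : Type) (r : seq I) (P : pred I) (F : I -> V) :
  linear f -> f (\sum_(i <- r | P i) F i) = \sum_(i <- r | P i) f (F i).
Proof. by move=> lf; elim/big_rec2 : _ => [|i y1 y2 _ <-]; rewrite ?lin0 ?linD. Qed.

Definition bounded_by f (B : R) : Prop :=
  [/\ linear f, 0 <= B & forall h, nrm (f h) <= B * nrm h].

Lemma bnd_lin f B : bounded_by f B -> linear f. Proof. by case. Qed.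
Lemma bnd_ge0 f B : bounded_by f B -> 0 <= B. Proof. by case. Qed.

Lemma bndW f A B : A <= B -> bounded_by f A -> bounded_by f B.
Proof.
move=> AB [lf A0 fA]; split=> // [|h]; first exact: le_trans AB.
by apply: le_trans (fA h) _; rewrite ler_wpM2r ?nrm_ge0.
Qed.

Lemma bnd_id : bounded_by id 1.
Proof. by split=> // h; rewrite mul1r. Qed.

Lemma bnd0 : bounded_by (0 : H -> H) 0.
Proof. by split=> [a x y|//|h]; rewrite /= ?scaler0 ?addr0 ?nrm0 ?mul0r. Qed.

Lemma bnd_comp f g A B : bounded_by f A -> bounded_by g B -> bounded_by (f \o g) (A * B).
Proof.
move=> [lf A0 fA] [lg B0 gB]; split=> [a x y||h]; [by rewrite /= lg lf|exact: mulr_ge0|].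
by apply: le_trans (fA _) _; rewrite -mulrA ler_wpM2l.
Qed.

Lemma bndD f g A B : bounded_by f A -> bounded_by g B -> bounded_by (f + g) (A + B).
Proof.
move=> [lf A0 fA] [lg B0 gB]; split=> [a x y||h]; [|exact: addr_ge0|].
  by rewrite !fctE lg lf scalerDr addrACA.
by rewrite !fctE mulrDl; apply: le_trans (nrmD _ _) _; exact: lerD.
Qed.

Lemma bndZ c f B : bounded_by f B -> bounded_by (c *: f) (cabs c * B).
Proof.
move=> [lf B0 fB]; split=> [a x y||h]; [|by rewrite mulr_ge0// cabs_ge0|].
  by rewrite !fctE lf scalerDr !scalerA mulrC.
by rewrite !fctE nrmZ -mulrA ler_wpM2l// cabs_ge0.
Qed.

Lemma bnd_sum (I : Type) (r : seq I) (P : pred I) (F : I -> H -> H) (B : I -> R) :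
  (forall i, P i -> bounded_by (F i) (B i)) ->
  bounded_by (\sum_(i <- r | P i) F i) (\sum_(i <- r | P i) B i).
Proof.
move=> FB; elim/big_ind2 : _ => //; first exact: bnd0.
by move=> f A g C; exact: bndD.
Qed.

End BoundedOperators.

(** * Orthogonal systems and finite Schmidt sums *)

Section OrthogonalSystems.
Context {R : realType} {H : completeNormedModType R[i]}.
Context (ip : {dot H for Num.conj}) (ip_norm : forall x : H, `|x| ^+ 2 = ip x x).
Implicit Types (s t : nat -> R) (x y z : nat -> H) (h : H).

(* Vectors are allowed to vanish, which lets finite families be padded. *)
Definition orthosys (I : Type) (x : I -> H) : Prop :=
  (forall m n, m <> n -> ip (x m) (x n) = 0) /\
  (forall n, x n = 0 \/ ip (x n) (x n) = 1).

Lemma orthosys_reindex (I J : Type) (x : I -> H) (u : J -> I) :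
  injective u -> orthosys x -> orthosys (x \o u).
Proof. by move=> iu [x1 x2]; split=> [m n mn|n]; [apply: x1 => /iu|exact: x2]. Qed.

Lemma orthosys_nrm (I : Type) (x : I -> H) : orthosys x -> forall n, nrm (x n) <= 1.
Proof.
by move=> [_ x2] n; case: (x2 n) => [->|/(nrm1_ip ip_norm)->//]; rewrite nrm0.
Qed.

Lemma pythagoras_sum (I : eqType) (r : seq I) (F : I -> H) : uniq r ->
  (forall i j, i <> j -> ip (F i) (F j) = 0) ->
  nrm (\sum_(i <- r) F i) ^+ 2 = \sum_(i <- r) nrm (F i) ^+ 2.
Proof.
move=> + F0; elim: r => [_|a r IH /= /andP[ar ur]].
  by rewrite !big_nil nrm0 expr0n.
rewrite !big_cons (pythagoras ip_norm) ?IH//.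
rewrite ip_sumr big1_seq// => i /andP[_ ir]; apply: F0 => ai.
by rewrite ai ir in ar.
Qed.

Lemma pythagoras_ord (I : finType) (F : I -> H) :
  (forall i j, i <> j -> ip (F i) (F j) = 0) ->
  nrm (\sum_i F i) ^+ 2 = \sum_i nrm (F i) ^+ 2.
Proof. by move=> F0; apply: pythagoras_sum => //; exact: index_enum_uniq. Qed.

Definition schmidt_sum N s x y h : H := \sum_(n < N) ((s n)%:C * ip h (x n)) *: y n.

Lemma schmidt_sum_lin N s x y : linear (schmidt_sum N s x y).
Proof.
move=> a u v; rewrite /schmidt_sum scaler_sumr -big_split/=; apply: eq_bigr => n _.
by rewrite ipDl ipZl scalerA -scalerDl; congr (_ *: _); ring.
Qed.

Lemma ip_schmidt_sum N s x y h m : orthosys y -> ip (y m) (y m) = 1 -> (m < N)%N ->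
  ip (schmidt_sum N s x y h) (y m) = (s m)%:C * ip h (x m).
Proof.
move=> [y1 y2] ym mN; rewrite ip_suml (bigD1 (Ordinal mN))//= ipZl ym mulr1.
rewrite big1 ?addr0// => i im; rewrite ipZl y1 ?mulr0// => imE.
by move/eqP: im; apply; apply: val_inj.
Qed.

Lemma bessel_schmidt N x h : orthosys x ->
  \sum_(n < N) cabs (ip h (x n)) ^+ 2 <= nrm h ^+ 2.
Proof.
move=> ox; have [x1 x2] := ox; pose P := schmidt_sum N (fun=> 1) x x h.
have PE : P = \sum_(n < N) ip h (x n) *: x n.
  by apply: eq_bigr => n _; rewrite mul1r.
have hP (n : 'I_N) : ip (h - P) (x n) = 0.
  case: (x2 n) => [->|xn]; first by rewrite ip0r.
  by rewrite ipBl ip_schmidt_sum// mul1r subrr.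
have hPP : ip (h - P) P = 0.
  by rewrite {2}PE ip_sumr big1// => n _; rewrite ipZr hP mulr0.
have := pythagoras ip_norm hPP; rewrite subrK => ->.
rewrite PE pythagoras_ord; last first.
  by move=> i j ij; rewrite ipZl ipZr x1 ?mulr0// => /val_inj.
apply: ler_wpDl; first exact: sqr_ge0.
apply: ler_sum => n _; rewrite nrmZ exprMn.
case: (x2 n) => [->|/(nrm1_ip ip_norm)->]; last by rewrite expr1n mulr1.
by rewrite ip0r cabs0 expr0n mul0r.
Qed.

(** The weight has to be bounded only where the summand can be nonzero. For [h] orthogonal to the
    first [n] vectors only the tail weights count, which yields upper bounds for the n-th singular
    number. *)
Lemma nrm_schmidt_sum N s x y h (B : R) : orthosys x -> orthosys y -> 0 <= B ->
  (forall n, (n < N)%N -> x n = 0 \/ ip h (x n) = 0 \/ `|s n| <= B) ->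
  nrm (schmidt_sum N s x y h) <= B * nrm h.
Proof.
move=> ox oy B0 sB; apply: ler_sqr_nneg; first by rewrite mulr_ge0// nrm_ge0.
rewrite /schmidt_sum pythagoras_ord; last first.
  by move=> i j ij; rewrite ipZl ipZr (proj1 oy) ?mulr0// => /val_inj.
rewrite exprMn; apply: le_trans (ler_wpM2l (sqr_ge0 B) (bessel_schmidt N h ox)).
rewrite mulr_sumr; apply: ler_sum => n _; rewrite nrmZ cabsM cabsR !exprMn.
have yn : nrm (y n) ^+ 2 <= 1 by rewrite expr_le1 ?nrm_ge0 ?orthosys_nrm.
have [->|[->|sn]] := sB n (ltn_ord n).
- by rewrite ip0r cabs0 expr0n !(mulr0, mul0r).
- by rewrite cabs0 expr0n !(mulr0, mul0r).
apply: le_trans (_ : `|s n| ^+ 2 * cabs (ip h (x n)) ^+ 2 <= _).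
  by rewrite ler_piMr// mulr_ge0 ?sqr_ge0.
by rewrite ler_wpM2r ?sqr_ge0// lerXn2r ?nnegrE.
Qed.

Lemma schmidt_sum_bnd N s x y B : orthosys x -> orthosys y -> 0 <= B ->
  (forall n, (n < N)%N -> `|s n| <= B) -> bounded_by (schmidt_sum N s x y) B.
Proof.
move=> ox oy B0 sB; split=> // [|h]; first exact: schmidt_sum_lin.
by apply: nrm_schmidt_sum => // n nN; right; right; exact: sB.
Qed.

End OrthogonalSystems.

(** * Compact operators *)

Section Topology.
Context {R : realType} {H : completeNormedModType R[i]}.
Implicit Types (f g : H -> H).

Lemma gt0_complex (e : R[i]) : 0 < e -> e = (complex.Re e)%:C /\ 0 < complex.Re e.
Proof. by case: e => a b; rewrite ltcE/= => /andP[/eqP-> ?]. Qed.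

Lemma cvg_nrmP (T : Type) (F : set_system T) (FF : Filter F) (u : T -> H) (l : H) :
  (u @ F --> l) <-> (forall e : R, 0 < e -> \forall n \near F, nrm (l - u n) < e).
Proof.
split=> [/cvgrPdist_lt ul e e0|ul].
  have e0C : 0 < e%:C by rewrite ltcR.
  by apply: filterS (ul _ e0C) => n; rewrite nrmE ltcR.
apply/cvgrPdist_lt => e /gt0_complex[-> e0].
by apply: filterS (ul _ e0) => n; rewrite nrmE ltcR.
Qed.

Lemma nbhs_nrmP (x : H) (A : set H) :
  nbhs x A <-> exists2 e : R, 0 < e & forall y, nrm (x - y) < e -> A y.
Proof.
split=> [/nbhs_ballP[e /= /gt0_complex[-> e0] xA]|[e e0 xA]].
  exists (complex.Re e) => // y xy; apply: xA; rewrite -ball_normE/=.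
  by rewrite nrmE ltcR.
apply/nbhs_ballP; exists e%:C; first by rewrite /= ltcR.
by move=> y; rewrite -ball_normE/= nrmE ltcR => /xA.
Qed.

Lemma nrm_sub_dist (x y : H) : `|nrm x - nrm y| <= nrm (x - y).
Proof.
rewrite ler_norml; apply/andP; split.
  have := nrmD (y - x) x; rewrite subrK -opprB nrmN; lra.
have := nrmD (x - y) y; rewrite subrK; lra.
Qed.

Lemma nrm_continuous : continuous (@nrm R H).
Proof.
move=> x; apply/cvgrPdist_lt => e e0.
have /(cvg_nrmP (nbhs_filter x)) := @cvg_id _ (nbhs x); move=> /(_ _ e0).
by apply: filterS => y; apply: le_lt_trans; exact: nrm_sub_dist.
Qed.

Lemma cauchy_nrm_cvg (u : nat -> H) :
  (forall e : R, 0 < e -> exists N, forall m n, (N <= m)%N -> (N <= n)%N -> nrm (u m - u n) < e) ->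
  exists l : H, u @ \oo --> l.
Proof.
move=> uc; suff /cauchy_cvgP : cauchy (u @ \oo) by move=> cu; exists (lim (u @ \oo)).
apply: cauchy_exP => e /gt0_complex[-> e0]; have [N uN] := uc _ e0.
exists (u N); exists N => // n /= Nn; rewrite -ball_normE/= nrmE ltcR.
by apply: uN.
Qed.

Lemma bounded_operatorP f : bounded_operator f <-> exists B : R, bounded_by f B.
Proof.
split=> [[lf cf]|[B [lf B0 fB]]].
  have := cf 0; rewrite /continuous_at lin0// => /cvg_nrmP/(_ 1 ltr01).
  move=> /nbhs_nrmP[e e0 fe].
  exists (2 / e); split=> // [|h]; first by rewrite divr_ge0// ltW.
  have [->|h0] := eqVneq h 0; first by rewrite lin0// !nrm0 mulr0.
  have hgt0 : 0 < nrm h.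
    by rewrite lt_neqAle nrm_ge0 andbT eq_sym; apply: contra_neq h0 => /nrm0_eq0.
  have := fe ((e / 2 / nrm h)%:C *: h); rewrite !sub0r !nrmN linZ// !nrmZ cabsR.
  have t0 : 0 <= e / 2 / nrm h by rewrite ltW// !divr_gt0.
  rewrite (ger0_norm t0) divfK ?gt_eqF//.
  have -> : (e / 2 < e) = true by lra.
  move=> /(_ isT) /ltW; rewrite mulrAC ler_pdivrMr// mul1r -ler_pdivlMl ?divr_gt0//.
  by rewrite invf_div.
split=> // x; apply/cvg_nrmP => e e0; apply/nbhs_nrmP.
have B1 : 0 < B + 1 by lra.
exists (e / (B + 1)) => [|y]; first exact: divr_gt0.
rewrite ltr_pdivlMr// -linB// => xy; apply: le_lt_trans xy.
by rewrite mulrC; apply: le_trans (fB _) _; rewrite ler_wpM2r ?nrm_ge0//; lra.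
Qed.

Lemma compact_operator_bnd f : compact_operator f -> exists B : R, bounded_by f B.
Proof. by move=> [/bounded_operatorP]. Qed.

(** A compact superset of the image of the ball replaces its closure: sums, multiples and continuous
    images of such sets are again compact, which gives the ideal properties below. *)
Lemma compact_operatorP f :
  compact_operator f <-> (exists B : R, bounded_by f B) /\
    exists2 K : set H, compact K & forall h, nrm h <= 1 -> K (f h).
Proof.
rewrite -bounded_operatorP /compact_operator/=; split=> -[fB].
  rewrite precompactE => fK; split=> //; eexists; first exact: fK.
  by move=> h h1; apply: subset_closure; exists h => //=; rewrite nrmE lecR.
move=> [K cK fK]; split=> //; apply: precompact_subset (compact_precompact _ cK).
  by move=> y [h] /=; rewrite nrmE lecR => h1 <-; exact: fK.
exact: norm_hausdorff.
Qed.

Lemma compactD (A B : set H) : compact A -> compact B ->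
  compact [set x.1 + x.2 | x in A `*` B].
Proof.
move=> cA cB; apply: (continuous_compact _ (compact_setX cA cB)).
by apply: continuous_subspaceT; exact: add_continuous.
Qed.

Lemma compactZ (c : R[i]) (A : set H) : compact A -> compact [set c *: x | x in A].
Proof.
move=> cA; apply: (continuous_compact _ cA).
by apply: continuous_subspaceT; exact: scaler_continuous.
Qed.

Lemma compact_operatorD f g : compact_operator f -> compact_operator g ->
  compact_operator (f + g).
Proof.
move=> /compact_operatorP[[A fA] [K cK fK]] /compact_operatorP[[B gB] [L cL gL]].
apply/compact_operatorP; split; first by exists (A + B); exact: bndD.
exists [set x.1 + x.2 | x in K `*` L]; first exact: compactD.
by move=> h h1; exists (f h, g h) => //=; split; [exact: fK|exact: gL].
Qed.

Lemma compact_operatorZ c f : compact_operator f -> compact_operator (c *: f).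
Proof.
move=> /compact_operatorP[[A fA] [K cK fK]]; apply/compact_operatorP; split.
  by exists (cabs c * A); exact: bndZ.
exists [set c *: x | x in K]; first exact: compactZ.
by move=> h h1; exists (f h) => //; exact: fK.
Qed.

Lemma compact_operatorB f g : compact_operator f -> compact_operator g ->
  compact_operator (f - g).
Proof.
move=> cf cg; rewrite -[- g]scaleN1r; apply: compact_operatorD => //.
exact: compact_operatorZ.
Qed.

Lemma compact_operator0 : compact_operator (0 : H -> H).
Proof.
apply/compact_operatorP; split; first by exists 0; exact: bnd0.
by exists [set 0] => //; exact: compact_set1.
Qed.

Lemma compact_operator_sum (I : Type) (r : seq I) (P : pred I) (F : I -> H -> H) :
  (forall i, P i -> compact_operator (F i)) -> compact_operator (\sum_(i <- r | P i) F i).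
Proof.
move=> cF; apply: big_ind => //; first exact: compact_operator0.
exact: compact_operatorD.
Qed.

Lemma compact_operator_compl f a A : bounded_by a A -> compact_operator f ->
  compact_operator (a \o f).
Proof.
move=> aA /compact_operatorP[[B fB] [K cK fK]]; apply/compact_operatorP; split.
  by exists (A * B); exact: bnd_comp.
exists [set a x | x in K] => [|h h1]; last by exists (f h) => //; exact: fK.
apply: (continuous_compact _ cK); apply: continuous_subspaceT.
by have [_ ] : bounded_operator a by apply/bounded_operatorP; exists A.
Qed.

Lemma compact_operator_compr f a A : bounded_by a A -> compact_operator f ->
  compact_operator (f \o a).
Proof.
move=> aA /compact_operatorP[[B fB] [K cK fK]]; apply/compact_operatorP; split.
  by exists (B * A); exact: bnd_comp.
exists [set (A + 1)%:C *: x | x in K]; first exact: compactZ.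
have [la A0 aB] := aA; have A1 : 0 < A + 1 by lra.
move=> h h1; exists (f ((A + 1)^-1%:C *: a h)) => /=; last first.
  rewrite (linZ (bnd_lin fB)) scalerA -rmorphM/= mulfV ?gt_eqF//.
  by rewrite rmorph1 scale1r.
have A1i : 0 <= (A + 1)^-1 by rewrite invr_ge0 ltW.
apply: fK; rewrite nrmZ cabsR (ger0_norm A1i) ler_pdivrMl// mulr1.
apply: le_trans (aB h) _; apply: le_trans (_ : A * 1 <= _); last by lra.
by rewrite ler_wpM2l.
Qed.

Lemma compact_line (v : H) (B : R) : compact [set (t%:C : R[i]) *: v | t in `[- B, B]].
Proof.
apply: continuous_compact; last exact: segment_compact.
apply: continuous_subspaceT => t; apply/cvg_nrmP => e e0.
have v1 : 0 < nrm v + 1 by have := nrm_ge0 v; lra.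
have : \forall s \near t, `|t - s| < e / (nrm v + 1).
  have /cvgrPdist_lt := @cvg_id _ (nbhs t); apply; exact: divr_gt0.
apply: filterS => s; rewrite ltr_pdivlMr// => ts.
rewrite -scalerBl -rmorphB/= nrmZ cabsR; apply: le_lt_trans ts.
by rewrite ler_wpM2l//; lra.
Qed.

(** The disc lies in a square, and the square is the sum of two real segments, along [v] and along
    ['i%C *: v]. *)
Lemma compact_disc (v : H) (B : R) :
  exists2 K : set H, compact K & forall c : R[i], cabs c <= B -> K (c *: v).
Proof.
have ci := @compact_line ('i%C *: v) B.
eexists; first exact: (compactD (@compact_line v B) ci).
have Re_le (z : R[i]) : `|complex.Re z| <= cabs z.
  by rewrite -lecR -cabsE; exact: normc_ge_Re.
move=> c cB; exists ((complex.Re c)%:C *: v, (complex.Im c)%:C *: ('i%C *: v)) => /=; last first.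
  by rewrite scalerA -scalerDl [in RHS](complexE c) [(_)%:C * 'i%C]mulrC.
split=> /=; eexists => //.
  by rewrite /= in_itv/= -ler_norml (le_trans (Re_le c)).
rewrite /= in_itv/= -ler_norml; apply: le_trans cB.
have := Re_le (c * 'i%C); rewrite ReiNIm normrN cabsM.
have -> : cabs ('i%C : R[i]) = 1 by apply: complexI; rewrite -cabsE normc_def/= expr0n expr1n add0r sqrtr1.
by rewrite mulr1.
Qed.

End Topology.

(** * Existence of Schmidt expansions of compact operators *)

Section SchmidtExistence.
Context {R : realType} {H : completeNormedModType R[i]}.
Context (ip : {dot H for Num.conj}) (ip_norm : forall x : H, `|x| ^+ 2 = ip x x).
Implicit Types (f g : H -> H).

Lemma exists_invS_lt (e : R) : 0 < e -> exists N, forall n, (N <= n)%N -> (n.+1%:R : R)^-1 < e.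
Proof.
move=> e0; exists (Num.truncn e^-1) => n Nn.
rewrite invf_plt ?posrE//; apply: lt_le_trans (truncnS_gt _) _.
by rewrite ler_nat.
Qed.

(** Compactness provides a point [z] of maximal norm in the closure of the image of the unit ball.
    Vectors [u n] of the ball with [g (u n)] close to [z] have [nrm (u m + u n)] close to 2, so the
    parallelogram law makes them Cauchy, and their limit is mapped to [z]. *)
Lemma norm_attained g : compact_operator g ->
  exists2 x, nrm x <= 1 & forall h, nrm (g h) <= nrm (g x) * nrm h.
Proof.
move=> cg; have [[A gA] _] := (compact_operatorP g).1 cg.
have lg := bnd_lin gA; case: cg => _; rewrite precompactE => cK.
have gK h : nrm h <= 1 -> closure (g @` [set x | `|x| <= 1]) (g h).
  by move=> h1; apply: subset_closure; exists h => //=; rewrite nrmE lecR.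
have [|z /[!inE] zK zmax] := compact_EVT_max _ cK (continuous_subspaceT (@nrm_continuous R H)).
  by exists (g 0); apply: gK; rewrite nrm0.
have gz h : nrm (g h) <= nrm z * nrm h.
  have [->|h0] := eqVneq h 0; first by rewrite lin0// !nrm0 mulr0.
  have hgt0 : 0 < nrm h.
    by rewrite lt_neqAle nrm_ge0 andbT eq_sym; apply: contra_neq h0 => /nrm0_eq0.
  have hi0 : 0 <= (nrm h)^-1 by rewrite invr_ge0 ltW.
  have := zmax (g ((nrm h)^-1%:C *: h)); rewrite inE => /(_ (gK _ _)).
  rewrite linZ// !nrmZ cabsR (ger0_norm hi0) mulVf ?gt_eqF// => /(_ (lexx _)).
  by rewrite ler_pdivrMl// mulrC.
have [z0|z0] := eqVneq (nrm z) 0.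
  exists 0; first by rewrite nrm0.
  by move=> h; rewrite lin0// nrm0 mul0r; have := gz h; rewrite z0 mul0r.
have zgt0 : 0 < nrm z by rewrite lt_neqAle eq_sym z0 nrm_ge0.
have zapp n : exists h, nrm h <= 1 /\ nrm (z - g h) < (n.+1%:R : R)^-1.
  have [|_ [[h /= h1 <-]] gh] := zK [set y | nrm (z - y) < (n.+1%:R : R)^-1].
    by apply/nbhs_nrmP; exists (n.+1%:R : R)^-1 => //; rewrite invr_gt0.
  by exists h; split=> //; move: h1; rewrite nrmE lecR.
pose u n := projT1 (cid (zapp n)).
have u1 n : nrm (u n) <= 1 by have [] := projT2 (cid (zapp n)).
have uz n : nrm (z - g (u n)) < (n.+1%:R : R)^-1 by have [] := projT2 (cid (zapp n)).
have [x ux] : exists l : H, u @ \oo --> l.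
  (* Errors below [e^2 |z| / 16] give [nrm (u m + u n) >= 2 - e^2 / 8], hence
     [nrm (u m - u n) ^+ 2 <= e^2 / 2]. *)
  apply: cauchy_nrm_cvg => e e0; have [|N NP] := @exists_invS_lt (e ^+ 2 * nrm z / 16).
    by rewrite divr_gt0// mulr_gt0// exprn_gt0.
  exists N => m n Nm Nn; rewrite ltNge; apply/negP => emn.
  have mS := lt_trans (uz m) (NP _ Nm); have nS := lt_trans (uz n) (NP _ Nn).
  have S : 2 * nrm z - 2 * (e ^+ 2 * nrm z / 16) <= nrm z * nrm (u m + u n).
    apply: le_trans (gz _); rewrite linD//.
    have -> : 2 * nrm z = nrm ((z - g (u m)) + (z - g (u n)) + (g (u m) + g (u n))).
      rewrite addrACA !subrK -[in RHS](scale1r z) -scalerDl nrmZ.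
      by rewrite -[1 + 1 in RHS](rmorph_nat (real_complex R) 2) cabsR ger0_norm ?ler0n.
    have := nrmD (z - g (u m) + (z - g (u n))) (g (u m) + g (u n)).
    have := nrmD (z - g (u m)) (z - g (u n)); lra.
  have := parallelogram ip_norm (u m) (u n).
  have : 2 - e ^+ 2 / 8 <= nrm (u m + u n).
    by rewrite -(ler_pM2l zgt0); apply: le_trans S; nra.
  have := u1 m; have := u1 n; have := nrm_ge0 (u m); have := nrm_ge0 (u n).
  have : e ^+ 2 <= nrm (u m - u n) ^+ 2 by rewrite lerXn2r ?nnegrE ?nrm_ge0 ?(ltW e0).
  have := exprn_gt0 2 e0.
  move: (nrm (u m)) (nrm (u n)) (nrm (u m + u n)) (nrm _) (e ^+ 2) => a b c d E.
  move=> E0 Ed b0 a0 b1 a1 c1 dE.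
  have : a ^+ 2 <= 1 by rewrite expr_le1. have : b ^+ 2 <= 1 by rewrite expr_le1.
  have : 0 <= (c - 2) ^+ 2 by exact: sqr_ge0.
  rewrite (_ : (c - 2) ^+ 2 = c ^+ 2 - 4 * c + 4); last by ring.
  lra.
exists x.
  apply/ler_addgt0Pr => e e0; have /cvg_nrmP/(_ e e0)[N _ /(_ N (leqnn N))/= xu] := ux.
  have := nrmD (x - u N) (u N); rewrite subrK; have := u1 N; lra.
suff -> : g x = z by [].
apply/eqP; rewrite -subr_eq0; apply/eqP/nrm0_eq0/le_anti; rewrite nrm_ge0 andbT.
suff E (e : R) : 0 < e -> nrm (g x - z) <= e.
  by apply/ler_addgt0Pr => e e0; rewrite add0r; exact: E.
move=> e0.
have e20 : 0 < e / 2 by rewrite divr_gt0.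
have [N1 N1P] := exists_invS_lt e20.
have A1 : 0 < A + 1 by have := bnd_ge0 gA; lra.
have eA : 0 < e / 2 / (A + 1) by rewrite divr_gt0.
have /cvg_nrmP/(_ _ eA)[N2 _ N2P] := ux.
pose N := maxn N1 N2.
have zu : nrm (z - g (u N)) < e / 2 := lt_trans (uz N) (N1P N (leq_maxl _ _)).
have xu : nrm (x - u N) * (A + 1) < e / 2 by rewrite -ltr_pdivlMr//; exact: N2P (leq_maxr _ _).
have gxu : nrm (g x - g (u N)) <= A * nrm (x - u N) by rewrite -linB//; case: gA.
have := nrmD (g x - g (u N)) (g (u N) - z); rewrite subrKA.
rewrite -(nrmN (g (u N) - z)) opprB.
by have := nrm_ge0 (x - u N); lra.
Qed.

(** First variation at the maximizer: moving [x] by [e w h] raises [|g x|^2] by [2 e |w|^2] to first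
    order, while [|x|^2] grows only to second order because [h] is orthogonal to [x]. *)
Lemma norm_attained_orth g x h : linear g -> nrm x = 1 ->
  (forall h, nrm (g h) <= nrm (g x) * nrm h) -> ip h x = 0 -> ip (g h) (g x) = 0.
Proof.
move=> lg x1 gx hx; apply: ip_eq0C; set w := ip (g x) (g h).
apply/cabs0_eq0/eqP/negP => /negP w0.
have W0 : 0 < cabs w ^+ 2 by rewrite exprn_gt0// lt_neqAle eq_sym w0 cabs_ge0.
set W := cabs w ^+ 2 in W0; pose s := nrm (g x) ^+ 2 * nrm h ^+ 2.
have s0 : 0 <= s by rewrite mulr_ge0 ?sqr_ge0.
(* This step size gives [e * s < 1], so the second-order term [e^2 W s] stays below the gain
   [2 e W]. *)
pose e := (s + 1)^-1; have e0 : 0 < e by rewrite invr_gt0; lra.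
have := gx (x + (e%:C * w) *: h) => /(@lerXn2r _ 2 _ _); rewrite !nnegrE.
rewrite mulr_ge0 ?nrm_ge0// => /(_ isT isT); rewrite exprMn linD// linZ//.
rewrite (nrm_sqrD ip_norm) (pythagoras ip_norm); last by rewrite ipZr (ip_eq0C hx) mulr0.
rewrite x1 expr1n ipZr !nrmZ cabsM cabsR gtr0_norm// !exprMn -/W -/w.
have -> : complex.Re ((e%:C * w)^* * w) = e * W.
  rewrite rmorphM/= conjC_real -mulrA [_ * w]mulrC mul_conjC -rmorphM/=.
  by [].
have es : e * s < 1 by rewrite /e mulrC ltr_pdivrMr; lra.
have eW : 0 < e * W by exact: mulr_gt0.
have : e ^+ 2 * W * nrm (g h) ^+ 2 >= 0 by apply: mulr_ge0; [apply: mulr_ge0; [exact: sqr_ge0|exact: ltW]|exact: sqr_ge0].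
have -> : nrm (g x) ^+ 2 * (1 + e ^+ 2 * W * nrm h ^+ 2) =
  nrm (g x) ^+ 2 + (e * W) * (e * s) by rewrite /s; ring.
by nra.
Qed.

Lemma rank_one_compact (a : R) (u v : H) :
  compact_operator (fun h => (a%:C * ip h u) *: v).
Proof.
have [K cK vK] := compact_disc v (`|a| * nrm u).
have au h : cabs (a%:C * ip h u) <= `|a| * nrm u * nrm h.
  by rewrite cabsM cabsR -mulrA ler_wpM2l// mulrC; exact: cauchy_schwarz.
apply/compact_operatorP; split; last first.
  exists K => // h h1; apply: vK; apply: le_trans (au h) _.
  by rewrite ler_piMr// mulr_ge0 ?nrm_ge0.
exists (`|a| * nrm u * nrm v); split=> [c p q||h]; last first.
- by rewrite nrmZ mulrAC ler_wpM2r ?nrm_ge0.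
- by rewrite !mulr_ge0 ?nrm_ge0.
- by rewrite ipDl ipZl scalerA -scalerDl; congr (_ *: _); ring.
Qed.

(** The norm of [g], a unit vector where it is attained and the normalized image, both vectors being
    zero when [g] vanishes. The last clause is what makes repeated deflation produce orthogonal
    families. *)
Definition singular_triple g (t : R * H * H) : Prop :=
  [/\ 0 <= t.1.1 /\ (forall h, nrm (g h) <= t.1.1 * nrm h),
      t.1.1 = 0 -> t.1.2 = 0 /\ t.2 = 0,
      0 < t.1.1 -> [/\ nrm t.1.2 = 1, nrm t.2 = 1 & g t.1.2 = t.1.1%:C *: t.2] &
      forall h, ip h t.1.2 = 0 -> ip (g h) t.2 = 0].

Lemma singular_triple_exists g : compact_operator g -> exists t, singular_triple g t.
Proof.
move=> cg; have [A gA] := compact_operator_bnd cg; have lg := bnd_lin gA.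
have [x x1 gx] := norm_attained cg; have [s0|s0] := eqVneq (nrm (g x)) 0.
  exists (0, 0, 0); split=> //= [|c0|h _]; [|by rewrite ltxx in c0|by rewrite ip0r].
  by split=> // h; have := gx h; rewrite s0.
have sgt0 : 0 < nrm (g x) by rewrite lt_neqAle eq_sym s0 nrm_ge0.
have xE : nrm x = 1.
  by apply/le_anti; rewrite x1/= -(ler_pM2l sgt0) mulr1.
exists (nrm (g x), x, (nrm (g x))^-1%:C *: g x); split=> //=.
- by split=> //; exact: nrm_ge0.
- by move=> sx0; rewrite sx0 eqxx in s0.
- move=> _; split=> //; rewrite ?scalerA -?rmorphM/= ?mulfV// ?rmorph1 ?scale1r//.
  by rewrite nrmZ cabsR ger0_norm ?invr_ge0 ?nrm_ge0// mulVf.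
- by move=> h hx; rewrite ipZr (norm_attained_orth lg xE gx hx) mulr0.
Qed.

(** Deflation: subtract from the current residual its rank-one part at a maximizing vector, and
    repeat. The residual norms [s n] tend to 0, since otherwise the orthogonal vectors [f (x n)],
    all of norm at least [e], would have no cluster point. *)
Theorem singular_numbers_exist f : compact_operator f ->
  is_singular_numbers ip f (singular_numbers ip f).
Proof.
(* [xget] falls back on its default only if no admissible sequence exists; that case is refuted by
   constructing one. *)
move=> cf; rewrite /singular_numbers; case: xgetP => // /(_ _) NS.
pose step g := xget (0, 0, 0) (singular_triple g).
pose next g := let t := step g in fun h => g h - (t.1.1%:C * ip h t.1.2) *: t.2.
pose res n := iter n next f.
pose s n := (step (res n)).1.1; pose x n := (step (res n)).1.2; pose y n := (step (res n)).2.
exfalso; apply: (NS s).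
have cres n : compact_operator (res n).
  elim: n => //= n IH; apply: (compact_operatorB IH); exact: rank_one_compact.
have lres n : linear (res n) by have [B /bnd_lin] := compact_operator_bnd (cres n).
have stepP n : singular_triple (res n) (s n, x n, y n).
  rewrite /s /x /y; have := singular_triple_exists (cres n) => /(xgetPex (0, 0, 0)).
  by rewrite -/(step _); case: (step _) => -[].
have s0 n : 0 <= s n by have [[]] := stepP n.
have resb n h : nrm (res n h) <= s n * nrm h by have [[]] := stepP n.
have resS n h : res n.+1 h = res n h - ((s n)%:C * ip h (x n)) *: y n by [].
have sP n : s n = 0 /\ x n = 0 /\ y n = 0 \/
    [/\ 0 < s n, ip (x n) (x n) = 1, ip (y n) (y n) = 1 & res n (x n) = (s n)%:C *: y n].
  have [_ /= a b _] := stepP n; have [sn|sn] := eqVneq (s n) 0; first by left; have [] := a sn.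
  have sgt0 : 0 < s n by rewrite lt_neqAle eq_sym sn s0.
  by right; have [? ? ?] := b sgt0; split=> //; exact: ip1_nrm.
(* Deflating amounts to removing the component along [x n] from the argument. Hence later residuals
   vanish on [x n] and take values orthogonal to [y n]. *)
have resE n h : res n.+1 h = res n (h - ip h (x n) *: x n).
  rewrite resS (linB (lres n)) (linZ (lres n)); congr (_ - _).
  have [[-> [-> ->]]|[_ _ _ ->]] := sP n; first by rewrite ip0r (lin0 (lres n)) !(scaler0, mulr0, scale0r).
  by rewrite scalerA mulrC.
have xperp n h : ip (h - ip h (x n) *: x n) (x n) = 0.
  rewrite ipBl ipZl; have [[_ [-> _]]|[_ -> _ _]] := sP n; first by rewrite !ip0r mulr0 subrr.
  by rewrite mulr1 subrr.
have yperp m n h : (m < n)%N -> ip (res n h) (y m) = 0.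
  elim: n h => // n IH h; rewrite resE ltnS leq_eqVlt => /predU1P[->|]; last exact: IH.
  have [_ _ _ /= P] := stepP n; exact/P/xperp.
(* A maximizing vector of a residual operator has no component along the
   directions already removed. *)
have xorth m n : (m < n)%N -> res n (x m) = 0 -> ip (x n) (x m) = 0.
  move=> mn rm; have [[_ [-> _]]|[sn xn yn rn]] := sP n; first by rewrite ip0l.
  have [[_ [-> _]]|[_ xm _ _]] := sP m; first by rewrite ip0r.
  have := resb n (x n - ip (x n) (x m) *: x m); rewrite (linB (lres n)) (linZ (lres n)) rm scaler0 subr0 rn.
  rewrite nrmZ (nrm1_ip ip_norm yn) cabsR (ger0_norm (s0 n)) ler_pM2l//.
  set v := x n - _ => v1; apply: cabs0_eq0.
  have vm : ip v (ip (x n) (x m) *: x m) = 0 by rewrite ipZr ipBl ipZl xm mulr1 subrr mulr0.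
  have := pythagoras ip_norm vm; rewrite subrK nrmZ (nrm1_ip ip_norm xm) (nrm1_ip ip_norm xn).
  by move=> E; have := cabs_ge0 (ip (x n) (x m)); nra.
have resx m n : (m < n)%N -> res n (x m) = 0.
  elim: n => // n IH; rewrite ltnS leq_eqVlt => /predU1P[->|mn].
    rewrite resE; have [[_ [-> _]]|[_ -> _ _]] := sP n; first by rewrite scaler0 subr0 (lin0 (lres n)).
    by rewrite scale1r subrr (lin0 (lres n)).
  by rewrite resS (IH mn) (ip_eq0C (xorth _ _ mn (IH mn))) mulr0 scale0r subr0.
have ox m n : m <> n -> ip (x m) (x n) = 0.
  move=> /eqP; rewrite neq_ltn => /orP[mn|mn]; last exact/xorth/resx.
  exact/ip_eq0C/xorth/resx.
have oy m n : m <> n -> ip (y m) (y n) = 0.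
  have yn i j : (i < j)%N -> ip (y j) (y i) = 0.
    move=> ij; have [[_ [_ ->]]|[sj _ _ rj]] := sP j; first by rewrite ip0l.
    have := yperp i j (x j) ij; rewrite rj ipZl => /eqP; rewrite mulf_eq0 => /orP[|/eqP//].
    by move=> /eqP sj0; move: sj; rewrite -ltcR sj0 ltxx.
  move=> /eqP; rewrite neq_ltn => /orP[mn|mn]; last exact: yn.
  exact/ip_eq0C/yn.
have snorm n : nrm (res n (x n)) = s n.
  have [[-> [-> _]]|[_ _ yn ->]] := sP n; first by rewrite (lin0 (lres n)) nrm0.
  by rewrite nrmZ cabsR (ger0_norm (s0 n)) (nrm1_ip ip_norm yn) mulr1.
have x1 n : nrm (x n) <= 1.
  have [[_ [-> _]]|[_ xn _ _]] := sP n; first by rewrite nrm0.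
  by rewrite (nrm1_ip ip_norm xn).
have snon : nonincreasing_seq s.
  apply/nonincreasing_seqP => n; rewrite -(snorm n.+1) resS.
  rewrite (ip_eq0C (ox _ _ _)) ?mulr0 ?scale0r ?subr0; last by move=> /eqP; rewrite -[X in X == _]addn0 -addn1 eqn_add2l.
  by apply: le_trans (resb _ _) _; rewrite ler_piMr.
have fE n h : f h = res n h + \sum_(0 <= i < n) ((s i)%:C * ip h (x i)) *: y i.
  elim: n => [|n ->]; first by rewrite big_nil addr0.
  by rewrite big_nat_recr// resS [in RHS]addrCA subrK addrC.
have fx n : f (x n) = (s n)%:C *: y n.
  rewrite (fE n) big_nat big1 ?addr0 => [|i /= iN].
    by have [[-> [-> ->]]|[]//] := sP n; rewrite lin0// scaler0.
  by rewrite ox ?mulr0 ?scale0r// => nE; rewrite nE ltnn in iN.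
have scvg : s @ \oo --> (0 : R).
  apply/cvgrPdist_lt => e e0; suff [N sN] : exists N, s N < e.
    exists N => // n /= Nn; rewrite sub0r normrN ger0_norm//.
    by apply: le_lt_trans sN; exact: snon.
  apply: contrapT => /forallNP sN; have {}sN n : e <= s n by rewrite leNgt; apply/negP.
  have [_ [K cK fK]] := (compact_operatorP f).1 cf.
  have [|z [_ zcl]] := cK ((f \o x) @ \oo) _.
    by exists 0%N => // n _ /=; exact: fK.
  have e2 : 0 < e / 2 by rewrite divr_gt0.
  have ball0 : nbhs z [set v | nrm (z - v) < e / 2] by apply/nbhs_nrmP; exists (e / 2).
  have [|_ [[n _ <-] zn]] := zcl ((f \o x) @` setT) _ _ ball0; first by exists 0%N => // n _; exists n.
  have [|_ [[m /= nm <-] zm]] := zcl ((f \o x) @` [set m | (n < m)%N]) _ _ ball0.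
    by exists n.+1 => // m nm; exists m.
  have : nrm (f (x n) - f (x m)) < e.
    have := nrmD (f (x n) - z) (z - f (x m)); rewrite subrKA.
    rewrite -(nrmN (f (x n) - z)) opprB; rewrite /= in zn zm; lra.
  have yu i : ip (y i) (y i) = 1.
    by have [[si _]|[]//] := sP i; have := sN i; rewrite si leNgt e0.
  have orth : ip (f (x n)) (- f (x m)) = 0.
    rewrite -scaleN1r ipZr !fx ipZl ipZr oy ?mulr0// => nE.
    by rewrite nE ltnn in nm.
  have := pythagoras ip_norm orth; rewrite nrmN !fx !nrmZ !cabsR !ger0_norm//.
  rewrite !(nrm1_ip ip_norm (yu _)) !mulr1 -!fx.
  have := nrm_ge0 (f (x n) - f (x m)); have := sN n; have := sN m.
  by move: (nrm _) => d; nra.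
split=> //; exists x, y; split=> [m n /= _ /eqP sn|m n /= _ /eqP sn|h].
- have [[//]|[_ xn _ _]] := sP n.
  by have [->|/eqP mn] := eqVneq m n; [rewrite xn|rewrite ox].
- have [[//]|[_ _ yn _]] := sP n.
  by have [->|/eqP mn] := eqVneq m n; [rewrite yn|rewrite oy].
apply/cvg_nrmP => e e0; have h1 : 0 < nrm h + 1 by have := nrm_ge0 h; lra.
have eh : 0 < e / (nrm h + 1) by rewrite divr_gt0.
have /cvgrPdist_lt/(_ _ eh) := scvg; apply: filterS => n.
rewrite sub0r normrN ger0_norm// ltr_pdivlMr// => sn.
rewrite /series/= (fE n h) addrK; apply: le_lt_trans (resb n h) _.
by apply: le_lt_trans sn; rewrite ler_wpM2l//; lra.
Qed.

End SchmidtExistence.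

Section FiniteRank.
Context {R : realType} {H : completeNormedModType R[i]}.
Implicit Types (f g : H -> H).

Lemma finite_rank_bnd f : finite_rank f -> exists B : R, bounded_by f B.
Proof. by move=> [/bounded_operatorP]. Qed.

Lemma finite_rank_compl f a A : bounded_by a A -> finite_rank f -> finite_rank (a \o f).
Proof.
move=> aA [/bounded_operatorP[B fB] [n [v fv]]]; split.
  by apply/bounded_operatorP; exists (A * B); exact: bnd_comp.
exists n, (a \o v) => x; have [c fE] := fv x; exists c.
rewrite /= fE (lin_sum _ _ _ (bnd_lin aA)); apply: eq_bigr => i _.
by rewrite (linZ (bnd_lin aA)).
Qed.

Lemma finite_rank_compr f a A : bounded_by a A -> finite_rank f -> finite_rank (f \o a).
Proof.
move=> aA [/bounded_operatorP[B fB] [n [v fv]]]; split.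
  by apply/bounded_operatorP; exists (B * A); exact: bnd_comp.
by exists n, v => x; exact: fv.
Qed.

Lemma finite_rank0 : finite_rank (0 : H -> H).
Proof.
split; first by apply/bounded_operatorP; exists 0; exact: bnd0.
by exists 0%N, (fun=> 0) => x; exists (fun=> 0); rewrite big_ord0.
Qed.

Context (ip : {dot H for Num.conj}) (ip_norm : forall x : H, `|x| ^+ 2 = ip x x).

Lemma finite_rank_schmidt_sum N s x y (B : R) : orthosys ip x -> orthosys ip y -> 0 <= B ->
  (forall n, (n < N)%N -> `|s n| <= B) -> finite_rank (schmidt_sum ip N s x y).
Proof.
move=> ox oy B0 sB; split.
  by apply/bounded_operatorP; exists B; exact: schmidt_sum_bnd.
by exists N, (fun n => y n) => h; exists (fun n => (s n)%:C * ip h (x n)).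
Qed.

Lemma gram_schmidt n (v : nat -> H) : exists w : nat -> H, orthosys ip w /\
  (forall l, (n <= l)%N -> w l = 0) /\
  (forall i, (i < n)%N -> v i = \sum_(l < n) ip (v i) (w l) *: w l).
Proof.
elim: n => [|n [w [ow [w0 wv]]]].
  by exists (fun=> 0); split=> //; split=> [m n _|n]; [rewrite ip0l|left].
pose r := v n - \sum_(l < n) ip (v n) (w l) *: w l.
(* If [v n] depends on the earlier vectors then [r = 0] and the new vector is 0, as [orthosys]
   permits. *)
pose w' l := if l == n then (nrm r)^-1%:C *: r else w l.
have rw l : ip r (w l) = 0.
  have [w1 w2] := ow; rewrite ipBl ip_suml; have [ln|nl] := ltnP l n; last first.
    by rewrite w0// ip0r big1 ?subr0// => i _; rewrite ip0r.
  rewrite (bigD1 (Ordinal ln))//= ipZl big1 => [|i il]; last first.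
    rewrite ipZl w1 ?mulr0// => ilE; move/eqP: il; apply; exact: val_inj.
  rewrite addr0; have [->|->] := w2 l; first by rewrite !ip0r mulr0 subr0.
  by rewrite mulr1 subrr.
have w'n l : (l < n)%N -> w' l = w l by rewrite /w' ltn_neqAle => /andP[/negPf->].
have vn : v n = \sum_(l < n) ip (v n) (w l) *: w l + ip (v n) (w' n) *: w' n.
  rewrite /w' eqxx ipZr conjC_real scalerA.
  have -> : v n = r + \sum_(l < n) ip (v n) (w l) *: w l by rewrite subrK.
  rewrite [in RHS]ipDl ip_suml [in RHS]addrC; congr (_ + _); last first.
    by apply: eq_bigr => i _; rewrite subrK.
  rewrite big1 ?addr0 => [|i _]; last by rewrite ipZl (ip_eq0C (rw i)) mulr0.
  rewrite (ip_sqr ip_norm) -!rmorphM/=; have [r0|r0] := eqVneq (nrm r) 0.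
    by rewrite (nrm0_eq0 r0) scaler0.
  have -> : (nrm r)^-1 * nrm r ^+ 2 * (nrm r)^-1 = 1 by field.
  by rewrite rmorph1 scale1r.
exists w'; split; [split=> [i j ij|i]|split=> [l nl|i]].
- rewrite /w'; have [iE|_] := eqVneq i n; have [jE|_] := eqVneq j n.
  + by move: ij; rewrite iE jE.
  + by rewrite ipZl rw mulr0.
  + by rewrite ipZr (ip_eq0C (rw _)) mulr0.
  + exact: (proj1 ow).
- rewrite /w'; have [_|_] := eqVneq i n; last exact: (proj2 ow).
  have [r0|r0] := eqVneq (nrm r) 0; first by left; rewrite (nrm0_eq0 r0) scaler0.
  right; apply: (ip1_nrm ip_norm); rewrite nrmZ cabsR ger0_norm ?invr_ge0 ?nrm_ge0//.
  by rewrite mulVf.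
- by rewrite /w' gtn_eqF// w0// ltnW.
rewrite ltnS leq_eqVlt big_ord_recr/= => /predU1P[->|iN].
  rewrite [LHS]vn; congr (_ + _); apply: eq_bigr => l _; rewrite w'n//.
rewrite [LHS](wv _ iN) (eq_bigr (fun l : 'I_n => ip (v i) (w' l) *: w' l)); last first.
  by move=> l _; rewrite w'n.
suff -> : ip (v i) (w' n) = 0 by rewrite scale0r addr0.
rewrite (wv _ iN) ip_suml big1// => l _; rewrite ipZl /w' eqxx ipZr.
by rewrite (ip_eq0C (rw l)) !mulr0.
Qed.

Lemma finite_rank_onb f : finite_rank f -> exists n (w : nat -> H), orthosys ip w /\
  forall h, f h = \sum_(l < n) ip (f h) (w l) *: w l.
Proof.
move=> [_ [n [v fv]]].
have [w [ow [_ wv]]] := gram_schmidt n (fun i => if insub i is Some k then v k else 0).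
exists n, w; split=> // h; have [c ->] := fv h.
have vw (i : 'I_n) : v i = \sum_(l < n) ip (v i) (w l) *: w l.
  by have := wv i (ltn_ord i); rewrite valK.
rewrite [LHS](eq_bigr (fun i => \sum_(l < n) (c i * ip (v i) (w l)) *: w l)); last first.
  move=> i _; rewrite {1}vw scaler_sumr; apply: eq_bigr => l _; exact: scalerA.
rewrite [LHS]exchange_big/=; apply: eq_bigr => l _.
by rewrite -scaler_suml ip_suml; congr (_ *: _); apply: eq_bigr => i _; rewrite ipZl.
Qed.

Lemma finite_rank_compact f : finite_rank f -> compact_operator f.
Proof.
move=> Ff; have [n [w [ow fw]]] := finite_rank_onb Ff.
have [B fB] := finite_rank_bnd Ff.
have -> : f = (\sum_(l < n) (fun h => (1%:C * ip h (w l)) *: w l)) \o f.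
  apply/funext => h; rewrite /= fct_sumE [LHS]fw.
  by apply: eq_bigr => l _; rewrite mul1r.
apply: (compact_operator_compr fB); apply: compact_operator_sum => l _.
exact: rank_one_compact.
Qed.

End FiniteRank.

(** * Algebraic codimension and Gelfand bounds *)

Section Codimension.
Context {R : realType} {H : completeNormedModType R[i]}.
Implicit Types (f g : H -> H) (V W : set H).

(* The functionals need not be continuous: this suffices for Gelfand numbers on
   a Hilbert space and makes the notion stable under any linear preimage. *)
Definition codim_le n V : Prop := exists phi : nat -> H -> R[i],
  (forall i, scalar (phi i)) /\ forall x, (forall i, (i < n)%N -> phi i x = 0) -> V x.

Lemma codim_leT n V : (forall x, V x) -> codim_le n V.
Proof. by move=> VT; exists (fun _ _ => 0); split=> // i a x y; rewrite mulr0 addr0. Qed.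

Lemma codim_leW n m V W : (n <= m)%N -> V `<=` W -> codim_le n V -> codim_le m W.
Proof.
move=> nm VW [phi [phil phiV]]; exists phi; split=> // x x0.
by apply/VW/phiV => i iN; apply: x0; exact: leq_trans nm.
Qed.

Lemma codim_leI n m V W : codim_le n V -> codim_le m W -> codim_le (n + m) (V `&` W).
Proof.
move=> [phi [phil phiV]] [psi [psil psiW]].
exists (fun i => if (i < n)%N then phi i else psi (i - n)%N); split=> [i|x x0].
  by case: ifP.
split; first by apply: phiV => i iN; have := x0 i (ltn_addr _ iN); rewrite iN.
by apply: psiW => i im; have := x0 (n + i)%N; rewrite ltn_add2l => /(_ im); rewrite ltnNge leq_addr/= addKn.
Qed.

Lemma codim_le_bigI k (n : 'I_k -> nat) (V : 'I_k -> set H) :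
  (forall i, codim_le (n i) (V i)) ->
  codim_le (\sum_i n i)%N [set x | forall i, V i x].
Proof.
elim: k n V => [|k IH] n V nV; first by apply: codim_leT => x [].
rewrite big_ord_recr/=.
apply: codim_leW (codim_leI (IH _ _ (fun i => nV (widen_ord (leqnSn k) i))) (nV ord_max)) => //.
move=> x [/= Vx Vm] i; have [ik|ki] := ltnP i k.
  by have := Vx (Ordinal ik); rewrite (_ : widen_ord _ _ = i)//; exact: val_inj.
by rewrite (_ : i = ord_max)//; apply/val_inj/eqP; rewrite eqn_leq ki -ltnS ltn_ord.
Qed.

Lemma codim_le_preimage n V (f : H -> H) : linear f -> codim_le n V ->
  codim_le n [set x | V (f x)].
Proof.
move=> lf [phi [phil phiV]]; exists (fun i => phi i \o f); split=> [i a x y|x x0].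
  by rewrite /= lf phil.
exact: phiV.
Qed.

Lemma codim_le_ker (k : nat) (phi : nat -> H -> R[i]) : (forall i, scalar (phi i)) ->
  codim_le k [set x | forall i, (i < k)%N -> phi i x = 0].
Proof. by move=> phil; exists phi. Qed.

(** There are more vectors than functionals, so the matrix of values has a nonzero row in its left
    kernel. *)
Lemma codim_le_combination n V (I : finType) (v : I -> H) : codim_le n V -> (n < #|I|)%N ->
  exists2 c : I -> R[i], exists i, c i != 0 & V (\sum_i c i *: v i).
Proof.
move=> [phi [phil phiV]] nI.
pose M := \matrix_(i < #|I|, j < n) phi j (v (enum_val i)).
have /rowV0Pn[u /sub_kermxP uM u0] : kermx M != 0.
  by rewrite -mxrank_eq0 mxrank_ker subn_eq0 -ltnNge (leq_ltn_trans (rank_leq_col M)).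
exists (fun i => u 0 (enum_rank i)).
  have /existsP[j uj] : [exists j, u 0 j != 0].
    apply: contraNT u0; rewrite negb_exists => /forallP z; apply/eqP/rowP => j.
    by rewrite mxE; apply/eqP; have := z j; rewrite negbK.
  by exists (enum_val j); rewrite enum_valK.
apply: phiV => j jn.
rewrite (lin_sum (W := R[i]^o) _ _ _ (phil j)).
move/rowP: uM => /(_ (Ordinal jn)); rewrite !mxE => uM; rewrite -[RHS]uM.
rewrite (reindex (@enum_val I xpredT)) /=; last first.
  by exists enum_rank => i _; rewrite ?enum_valK ?enum_rankK.
apply: eq_bigr => i _; rewrite enum_valK !mxE/=.
exact: (linZ (W := R[i]^o) (phil j)).
Qed.

Definition gelfand_le n f (B : R) : Prop :=
  exists2 V, codim_le n V & forall x, V x -> nrm (f x) <= B * nrm x.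

End Codimension.

(** * Singular numbers *)

Section SingularNumbers.
Context {R : realType} {H : completeNormedModType R[i]}.
Context (ip : {dot H for Num.conj}) (ip_norm : forall x : H, `|x| ^+ 2 = ip x x).
Implicit Types (f g : H -> H).
Local Notation sn := (singular_numbers ip).

Lemma sn_ge0 f n : compact_operator f -> 0 <= sn f n.
Proof. by move=> /(singular_numbers_exist ip_norm)[]. Qed.

Lemma sn_noninc f m n : compact_operator f -> (m <= n)%N -> sn f n <= sn f m.
Proof. by move=> /(singular_numbers_exist ip_norm)[_ sd _ _] mn; exact: sd. Qed.

Lemma nrm_lt_eq0 (x : H) : (forall e : R, 0 < e -> nrm x < e) -> x = 0.
Proof.
move=> xe; apply/nrm0_eq0/eqP/negP => /negP x0.
by have := xe (nrm x); rewrite ltxx lt_neqAle eq_sym x0 nrm_ge0 => /(_ isT).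
Qed.

(** Replacing the vectors at vanishing singular numbers by 0 turns the families into orthogonal
    systems over all of [nat]. The action of [f] on them is recovered from the limit that defines
    the expansion. *)
Lemma schmidt_vectors f : compact_operator f -> exists x y,
  [/\ orthosys ip x, orthosys ip y,
      forall n, sn f n != 0 -> ip (x n) (x n) = 1 /\ ip (y n) (y n) = 1,
      forall n, f (x n) = (sn f n)%:C *: y n /\ (forall h, ip (f h) (y n) = (sn f n)%:C * ip h (x n)) &
      forall h, (fun m => schmidt_sum ip m (sn f) x y h) @ \oo --> f h].
Proof.
move=> cf; have [s0 _ _ [x [y [ox oy fxy]]]] := singular_numbers_exist ip_norm cf.
set s := sn f in s0 ox oy fxy *.
pose tr (z : nat -> H) n := if s n == 0 then 0 else z n.
have otr z : orthonormal_on ip [set n | s n != 0] z -> orthosys ip (tr z).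
  move=> oz; split=> [m n mn|n]; rewrite /tr.
    have [_|sm] := eqVneq (s m) 0; first by rewrite ip0l.
    have [_|sm'] := eqVneq (s n) 0; first by rewrite ip0r.
    by rewrite oz//; move/eqP: mn => /negPf->.
  have [_|sm] := eqVneq (s n) 0; first by left.
  by right; rewrite oz// eqxx.
have trS m h : schmidt_sum ip m s (tr x) (tr y) h =
    series (fun n => ((s n)%:C * ip h (x n)) *: y n) m.
  rewrite /schmidt_sum /series/= big_mkord; apply: eq_bigr => n _.
  by rewrite /tr; have [->|//] := eqVneq (s n) 0; rewrite !mul0r !scale0r.
have cvgS h : (fun m => schmidt_sum ip m s (tr x) (tr y) h) @ \oo --> f h.
  by under eq_fun do rewrite trS; exact: fxy.
exists (tr x), (tr y); split=> //; [exact: otr|exact: otr| |].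
  by move=> n sn0; rewrite /tr (negPf sn0) ox// oy// eqxx.
move=> n; split; last first.
  move=> h; have [s0n|sn0] := eqVneq (s n) 0.
    by rewrite s0n mul0r /tr s0n eqxx ip0r.
  have y1 : ip (tr y n) (tr y n) = 1 by rewrite /tr (negPf sn0) oy// eqxx.
  apply/eqP; rewrite -subr_eq0; apply/eqP/cabs0_eq0/le_anti; rewrite cabs_ge0 andbT.
  rewrite leNgt; apply/negP => e0.
  have /cvg_nrmP/(_ _ e0)[N _ /(_ (maxn N n.+1) (leq_maxl _ _))/=] := cvgS h.
  rewrite -(ip_schmidt_sum s (tr x) h (otr _ oy) y1 (leq_maxr N n.+1)) -ipBl.
  have := cauchy_schwarz ip_norm (f h - schmidt_sum ip (maxn N n.+1) s (tr x) (tr y) h) (tr y n).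
  by rewrite (nrm1_ip ip_norm y1) mulr1 => /le_lt_trans H1 /H1; rewrite ltxx.
apply/eqP; rewrite -subr_eq0; apply/eqP/nrm_lt_eq0 => e e0.
have /cvg_nrmP/(_ _ e0)[N _ /(_ (maxn N n.+1) (leq_maxl _ _))/=] := cvgS (tr x n).
rewrite (_ : schmidt_sum _ _ _ _ _ _ = (s n)%:C *: tr y n)//.
rewrite /schmidt_sum (bigD1 (Ordinal (leq_maxr N n.+1)))//= big1 ?addr0.
  have [->|sn0] := eqVneq (s n) 0; first by rewrite mul0r !scale0r.
  by rewrite /tr (negPf sn0) ox// eqxx mulr1.
move=> i iN; rewrite (proj1 (otr _ ox)) ?mulr0 ?scale0r// => iE.
by move/eqP: iN; apply; apply: val_inj.
Qed.

Lemma sn_gelfand f n : compact_operator f -> gelfand_le n f (sn f n).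
Proof.
move=> cf; have [x [y [ox oy _ _ fxy]]] := schmidt_vectors cf.
eexists; first exact: (codim_le_ker n (fun i => ip_scalar ip (x i))).
move=> h /= h0; apply/ler_addgt0Pr => e e0.
have /cvg_nrmP/(_ _ e0)[N _ /(_ N (leqnn N))/=] := fxy h.
have : nrm (schmidt_sum ip N (sn f) x y h) <= sn f n * nrm h.
  apply: nrm_schmidt_sum => //; first exact: sn_ge0.
  move=> i _; have [iN|ni] := ltnP i n; first by right; left; exact: h0.
  by right; right; rewrite ger0_norm ?sn_ge0 ?sn_noninc.
move: (schmidt_sum _ _ _ _ _ _) => v; have := nrmD (f h - v) v; rewrite subrK; lra.
Qed.

(** A subspace of codimension [n] meets the span of more than [n] orthonormal vectors [x i] in a
    nonzero vector. On that span [f] stretches norms by at least [A], as it sends the [x i] to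
    orthogonal vectors of length at least [A]. *)
Lemma gelfand_lower (I : finType) (x y : I -> H) (b : I -> R) f n (A B : R) : linear f ->
  (forall i j, ip (x i) (x j) = (i == j)%:R) ->
  (forall i j, i != j -> ip (y i) (y j) = 0) -> (forall i, ip (y i) (y i) = 1) ->
  (forall i, f (x i) = (b i)%:C *: y i) ->
  0 <= A -> (forall i, A <= b i) -> (n < #|I|)%N -> gelfand_le n f B -> A <= B.
Proof.
move=> lf ox oy y1 fx A0 Ab nI [V cV fV].
have [c [i0 ci0] Vc] := codim_le_combination x cV nI.
have nc (d : I -> R[i]) (z : I -> H) : (forall i j, i != j -> ip (z i) (z j) = 0) ->
    (forall i, ip (z i) (z i) = 1) ->
    nrm (\sum_i d i *: z i) ^+ 2 = \sum_i cabs (d i) ^+ 2.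
  move=> oz z1; rewrite (pythagoras_ord ip_norm) => [|i j /eqP ij].
    by apply: eq_bigr => i _; rewrite nrmZ (nrm1_ip ip_norm (z1 i)) mulr1.
  by rewrite ipZl ipZr oz// !mulr0.
have x1 : nrm (\sum_i c i *: x i) ^+ 2 = \sum_i cabs (c i) ^+ 2.
  by apply: nc => [i j /negPf ij|i]; rewrite ox ?ij ?eqxx.
have S0 : 0 < nrm (\sum_i c i *: x i) ^+ 2.
  rewrite x1 (bigD1 i0)//=; apply: ltr_pwDl; last by apply: sumr_ge0 => i _; exact: sqr_ge0.
  rewrite exprn_gt0// lt_neqAle cabs_ge0 andbT eq_sym.
  by apply: contra_neq ci0 => /cabs0_eq0.
have fE : nrm (f (\sum_i c i *: x i)) ^+ 2 = \sum_i cabs (c i * (b i)%:C) ^+ 2.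
  rewrite (lin_sum _ _ _ lf) -(nc _ y)//; congr (nrm _ ^+ 2); apply: eq_bigr => i _.
  by rewrite (linZ lf) fx scalerA.
have low : A ^+ 2 * nrm (\sum_i c i *: x i) ^+ 2 <= nrm (f (\sum_i c i *: x i)) ^+ 2.
  rewrite fE x1 mulr_sumr; apply: ler_sum => i _.
  rewrite cabsM cabsR exprMn mulrC ler_wpM2l ?sqr_ge0//.
  have bi0 : 0 <= b i := le_trans A0 (Ab i).
  by rewrite (ger0_norm bi0) lerXn2r ?nnegrE.
set v := nrm (\sum_i c i *: x i) in x1 S0 low.
have v0 : 0 <= v by exact: nrm_ge0.
have up := fV _ Vc; rename S0 into vgt.
have {}vgt : 0 < v by rewrite lt_neqAle v0 andbT eq_sym; apply: contraTneq vgt => ->; rewrite expr0n ltxx.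
rewrite -(ler_pM2r vgt); apply: le_trans up; apply: ler_sqr_nneg; first exact: nrm_ge0.
by rewrite exprMn.
Qed.

(** Test on the first [n + 1] Schmidt vectors. Together with [sn_gelfand] this identifies singular
    numbers with Gelfand numbers, so the upper estimates below only have to exhibit a subspace. *)
Lemma sn_le f n (B : R) : compact_operator f -> 0 <= B -> gelfand_le n f B -> sn f n <= B.
Proof.
move=> cf B0 gB; have [x [y [ox oy xy1 fx _]]] := schmidt_vectors cf.
have [->//|sn0] := eqVneq (sn f n) 0.
have si (i : 'I_n.+1) : sn f i != 0.
  have : 0 < sn f n by rewrite lt_neqAle eq_sym sn0 sn_ge0.
  by move=> /lt_le_trans/(_ (sn_noninc cf (ltn_ord i : (i <= n)%N))); case: ltgtP.
have [B' /bnd_lin lf] := compact_operator_bnd cf.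
apply: (@gelfand_lower _ (fun i : 'I_n.+1 => x i) (fun i : 'I_n.+1 => y i)
  (fun i : 'I_n.+1 => sn f i)) gB => //; [ | | | |exact: sn_ge0| |by rewrite card_ord].
- move=> i j; have [->|ij] := eqVneq i j; first by have [] := xy1 _ (si j).
  by rewrite (proj1 ox)// => /val_inj/eqP; apply/negP.
- by move=> i j ij; rewrite (proj1 oy)// => /val_inj/eqP; apply/negP.
- by move=> i; have [] := xy1 _ (si i).
- by move=> i; have [] := fx i.
- by move=> i; apply: sn_noninc => //; rewrite -ltnS.
Qed.

Lemma nrm_le_sn0 f h : compact_operator f -> nrm (f h) <= sn f 0 * nrm h.
Proof. by move=> cf; have [V [phi [_ V0]] fV] := sn_gelfand 0 cf; apply/fV/V0. Qed.

Lemma sn0_le f (B : R) : compact_operator f -> bounded_by f B -> sn f 0 <= B.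
Proof.
move=> cf [_ B0 fB]; apply: sn_le => //.
by exists setT => //; exact: codim_leT.
Qed.

Lemma snD f g n m : compact_operator f -> compact_operator g ->
  sn (f + g) (n + m) <= sn f n + sn g m.
Proof.
move=> cf cg; have [V cV fV] := sn_gelfand n cf; have [W cW gW] := sn_gelfand m cg.
apply: sn_le; [exact: compact_operatorD|by rewrite addr_ge0 ?sn_ge0|].
exists (V `&` W); first exact: codim_leI.
by move=> x [/fV fx /gW gx]; rewrite mulrDl; apply: le_trans (nrmD _ _) _; exact: lerD.
Qed.

Lemma sn_comp f a b (A B : R) n : compact_operator f -> bounded_by a A -> bounded_by b B ->
  sn (a \o f \o b) n <= A * B * sn f n.
Proof.
move=> cf aA bB; have [V cV fV] := sn_gelfand n cf.
have [la A0 aB] := aA; have [lb B0 bB'] := bB.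
apply: sn_le; last first.
- exists [set x | V (b x)]; first exact: codim_le_preimage.
  move=> x /fV fx; apply: le_trans (aB _) _; rewrite -!mulrA ler_wpM2l//.
  by apply: le_trans fx _; rewrite mulrCA ler_wpM2l ?sn_ge0.
- by rewrite !mulr_ge0 ?sn_ge0.
- by apply: (compact_operator_compr bB); exact: (compact_operator_compl aA).
Qed.

Lemma snZ c f n : compact_operator f -> sn (c *: f) n <= cabs c * sn f n.
Proof.
move=> cf; have [V cV fV] := sn_gelfand n cf.
apply: sn_le; [exact: compact_operatorZ|by rewrite mulr_ge0 ?cabs_ge0 ?sn_ge0|].
exists V => // x /fV fx; rewrite nrmZ -mulrA ler_wpM2l//; exact: cabs_ge0.
Qed.

(** Intersect the preimages under the [Q i] of subspaces that are good for the [T i]. The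
    codimensions add, while orthogonality of the ranges and the Bessel-type inequality for the [Q i]
    keep the bound at [B] instead of summing it. *)
Lemma sn_block k (T Q : 'I_k -> H -> H) (n : 'I_k -> nat) (B : R) :
  (forall i, compact_operator (T i)) -> (forall i, linear (Q i)) ->
  (forall i h, T i h = T i (Q i h)) ->
  (forall i j h h', i != j -> ip (T i h) (T j h') = 0) ->
  (forall h, \sum_i nrm (Q i h) ^+ 2 <= nrm h ^+ 2) ->
  0 <= B -> (forall i, sn (T i) (n i) <= B) -> sn (\sum_i T i) (\sum_i n i)%N <= B.
Proof.
move=> cT lQ TQ oT QB B0 TB.
apply: sn_le => //; first exact: compact_operator_sum.
pose V i := projT1 (cid2 (sn_gelfand (n i) (cT i))).
exists [set x | forall i, V i (Q i x)].
  apply: codim_le_bigI (fun i => [set x | V i (Q i x)]) _ => i.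
  by apply: codim_le_preimage => //; rewrite /V; case: cid2.
move=> x /= Vx; apply: ler_sqr_nneg; first by rewrite mulr_ge0 ?nrm_ge0.
rewrite fct_sumE (pythagoras_ord ip_norm) => [|i j /eqP ij]; last exact: oT.
rewrite exprMn; apply: le_trans (ler_wpM2l (sqr_ge0 B) (QB x)).
rewrite mulr_sumr; apply: ler_sum => i _; rewrite TQ -exprMn.
rewrite lerXn2r ?nnegrE ?mulr_ge0 ?nrm_ge0//.
have : nrm (T i (Q i x)) <= sn (T i) (n i) * nrm (Q i x).
  by have := Vx i; rewrite /V; case: cid2 => /= W _; apply.
by move=> /le_trans; apply; rewrite ler_wpM2r ?nrm_ge0.
Qed.

Lemma compact_schmidt_sum N s x y (B : R) : orthosys ip x -> orthosys ip y -> 0 <= B ->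
  (forall n, (n < N)%N -> `|s n| <= B) -> compact_operator (schmidt_sum ip N s x y).
Proof.
move=> ox oy B0 sB; apply: (finite_rank_compact ip_norm).
exact: finite_rank_schmidt_sum sB.
Qed.

Lemma sn_schmidt_sum N s x y n : orthosys ip x -> orthosys ip y ->
  (forall i, 0 <= s i) -> (forall i j, (i <= j)%N -> s j <= s i) ->
  (forall i, (N <= i)%N -> s i = 0) ->
  sn (schmidt_sum ip N s x y) n <= s n.
Proof.
move=> ox oy s0 sd sN; apply: sn_le => //.
  by apply: (compact_schmidt_sum ox oy (s0 0%N)) => i _; rewrite ger0_norm// sd.
eexists; first exact: (codim_le_ker n (fun i => ip_scalar ip (x i))).
move=> h /= h0; apply: nrm_schmidt_sum => // i _; right.
have [iN|ni] := ltnP i n; first by left; exact: h0.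
by right; rewrite ger0_norm// sd.
Qed.

Lemma sn_finite_rank f : finite_rank f -> exists N, forall n, (N <= n)%N -> sn f n = 0.
Proof.
move=> Ff; have cf := finite_rank_compact ip_norm Ff.
have [N [w [_ fw]]] := finite_rank_onb ip_norm Ff; have [B /bnd_lin lf] := finite_rank_bnd Ff.
have lin i : scalar (fun h => ip (f h) (w i)).
  by move=> a x y; rewrite lf ipDl ipZl.
exists N => n Nn; apply/le_anti; rewrite sn_ge0// andbT; apply: sn_le => //.
eexists; first exact: (codim_le_ker n lin).
move=> h /= h0; rewrite fw big1 ?nrm0 ?mul0r// => i _.
by rewrite h0 ?scale0r// (leq_trans _ Nn).
Qed.

End SingularNumbers.

(** * Schatten quasinorms *)

Section SchattenBounds.
Context {R : realType} {H : completeNormedModType R[i]}.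
Context (ip : {dot H for Num.conj}) (ip_norm : forall x : H, `|x| ^+ 2 = ip x x).
Implicit Types (a b f g : H -> H) (p q : \bar R).
Local Notation sn := (singular_numbers ip).

(** A real bound, packaged with the compactness that makes [singular_numbers] meaningful; it
    replaces the extended-real norm in all estimates. *)
Definition schatten_le p f (B : R) : Prop :=
  [/\ compact_operator f, 0 <= B & lp_le p (sn f) B].

(** One factor [2^(1/p)] comes from [s_2n (f + g) <= s_n f + s_n g], which uses each singular number
    twice; the other, with the 2, comes from [lp_leD]. *)
Definition quasi_const p : R := 2 * 2 `^ inv_exp p * 2 `^ inv_exp p.

Lemma quasi_const_ge1 p : (0 < p)%E -> 1 <= quasi_const p.
Proof.
move=> p0; have : 1 <= (2 : R) `^ inv_exp p.
  have : (2 : R) `^ 0 <= 2 `^ inv_exp p by rewrite ler_powR ?inv_exp_ge0// ler1n.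
  by rewrite powRr0.
rewrite /quasi_const; nra.
Qed.

Lemma schatten_le_compact p f B : schatten_le p f B -> compact_operator f. Proof. by case. Qed.
Lemma schatten_le_ge0 p f B : schatten_le p f B -> 0 <= B. Proof. by case. Qed.

Lemma schatten_leW p f A B : (0 < p)%E -> A <= B -> schatten_le p f A -> schatten_le p f B.
Proof.
move=> p0 AB [cf A0 fA]; split=> //; first exact: le_trans AB.
by apply: lp_leW fA => // j; exact: sn_ge0.
Qed.

Lemma schatten_leD p f g A B : (0 < p)%E -> schatten_le p f A -> schatten_le p g B ->
  schatten_le p (f + g) (quasi_const p * (A + B)).
Proof.
move=> p0 [cf A0 fA] [cg B0 gB]; split; first exact: compact_operatorD.
  by rewrite mulr_ge0 ?addr_ge0// (le_trans _ (quasi_const_ge1 p0)).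
have s0 := fun h (ch : compact_operator h) n => sn_ge0 ip_norm n ch.
have -> : quasi_const p * (A + B) = 2 * 2 `^ inv_exp p * (2%:R `^ inv_exp p * A + 2%:R `^ inv_exp p * B).
  by rewrite /quasi_const -mulrA mulrDr.
have t0 : 0 <= 2 * 2 `^ inv_exp p * (2%:R `^ inv_exp p * A + 2%:R `^ inv_exp p * B).
  by rewrite !(mulr_ge0, addr_ge0) ?powR_ge0.
apply: lp_le_mono (lp_leD p0 _ _ _ _ (lp_le_dilate (k := 2) p0 isT A0 (s0 _ cf) fA)
  (lp_le_dilate (k := 2) p0 isT B0 (s0 _ cg) gB)) => //.
- move=> n; rewrite s0 /=; last exact: compact_operatorD.
  apply: le_trans (snD ip_norm (n %/ 2) (n %/ 2) cf cg).
  apply: sn_noninc => //; first exact: compact_operatorD.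
  by rewrite addnn -muln2 leq_trunc_div.
- by rewrite mulr_ge0 ?powR_ge0.
- by rewrite mulr_ge0 ?powR_ge0.
- by move=> j; exact: s0.
- by move=> j; exact: s0.
Qed.

Lemma schatten_le_comp p f a b A B D : (0 < p)%E -> schatten_le p f D ->
  bounded_by a A -> bounded_by b B -> schatten_le p (a \o f \o b) (A * B * D).
Proof.
move=> p0 [cf D0 fD] aA bB; have A0 := bnd_ge0 aA; have B0 := bnd_ge0 bB.
have cafb : compact_operator (a \o f \o b).
  by apply: (compact_operator_compr bB); exact: (compact_operator_compl aA).
split=> //; first by rewrite !mulr_ge0.
apply: lp_le_mono (lp_leZ _ D0 _ fD) => //.
- by rewrite !mulr_ge0.
- by move=> n; rewrite sn_ge0//= sn_comp.
- by rewrite mulr_ge0.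
- by move=> n; exact: sn_ge0.
Qed.

Lemma schatten_le_compl p f a A D : (0 < p)%E -> schatten_le p f D ->
  bounded_by a A -> schatten_le p (a \o f) (A * D).
Proof. by move=> p0 fD aA; have := schatten_le_comp p0 fD aA bnd_id; rewrite mulr1. Qed.

Lemma schatten_le_compr p f a A D : (0 < p)%E -> schatten_le p f D ->
  bounded_by a A -> schatten_le p (f \o a) (A * D).
Proof. by move=> p0 fD aA; have := schatten_le_comp p0 fD bnd_id aA; rewrite mul1r. Qed.

Lemma schatten_leZ p c f B : (0 < p)%E -> schatten_le p f B ->
  schatten_le p (c *: f) (cabs c * B).
Proof.
move=> p0 [cf B0 fB]; split; [exact: compact_operatorZ|by rewrite mulr_ge0 ?cabs_ge0|].
apply: lp_le_mono (lp_leZ (cabs_ge0 c) B0 _ fB) => //.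
- by rewrite mulr_ge0 ?cabs_ge0.
- by move=> n; rewrite sn_ge0 ?snZ//; exact: compact_operatorZ.
- by move=> n; exact: sn_ge0.
Qed.

Lemma schatten_leN p f B : (0 < p)%E -> schatten_le p f B -> schatten_le p (- f) B.
Proof. by move=> p0 /(schatten_leZ (-1) p0); rewrite scaleN1r cabsN cabs1 mul1r. Qed.

Lemma schatten_leB p f g A B : (0 < p)%E -> schatten_le p f A -> schatten_le p g B ->
  schatten_le p (f - g) (quasi_const p * (A + B)).
Proof. by move=> p0 fA /(schatten_leN p0); exact: schatten_leD. Qed.

Lemma schatten_le0 p B : (0 < p)%E -> 0 <= B -> schatten_le p (0 : H -> H) B.
Proof.
move=> p0 B0; have c0 := @compact_operator0 R H; split=> //.
have s0 n : sn (0 : H -> H) n = 0.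
  apply/le_anti; rewrite sn_ge0// andbT (le_trans (sn_noninc ip_norm c0 (leq0n n)))//.
  by apply: sn0_le => //; exact: bnd0.
apply: (lp_le_mono (t := fun=> 0) (A := 0)) => // [j|]; first by rewrite s0 lexx.
have := @lp_le_finite R p (fun=> 0) 0 0 p0 (lexx _); rewrite mulr0; exact.
Qed.

(** The constant is geometric in [k]. This is harmless for error terms, where [k] is fixed, but
    would ruin the main terms. *)
Lemma schatten_le_sum p k (T : 'I_k -> H -> H) B : (0 < p)%E -> 0 <= B ->
  (forall i, schatten_le p (T i) B) ->
  schatten_le p (\sum_i T i) ((2 * quasi_const p) ^+ k * B).
Proof.
move=> p0; elim: k T => [|k IH] T B0 TB; first by rewrite big_ord0 expr0 mul1r; exact: schatten_le0.
have K1 := quasi_const_ge1 p0.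
have L1 : 1 <= (2 * quasi_const p) ^+ k by rewrite exprn_ege1//; lra.
rewrite big_ord_recr/=.
apply: schatten_leW (schatten_leD p0 (IH _ B0 (fun i => TB _)) (TB ord_max)) => //.
rewrite exprSr; move: (quasi_const p) ((2 * quasi_const p) ^+ k) K1 L1 => K L K1 L1.
have KB : 0 <= K * B by rewrite mulr_ge0//; lra.
nra.
Qed.

(** The singular numbers of the sum of orthogonal pieces are dominated by merging those of the
    pieces, so no quasinorm constant enters. The gain in the case p < q rests on this. *)
Lemma schatten_le_block p k (T Q : 'I_k -> H -> H) B : (0 < p)%E -> (0 < k)%N -> 0 <= B ->
  (forall i, schatten_le p (T i) B) -> (forall i, linear (Q i)) ->
  (forall i h, T i h = T i (Q i h)) ->
  (forall i j h h', i != j -> ip (T i h) (T j h') = 0) ->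
  (forall h, \sum_i nrm (Q i h) ^+ 2 <= nrm h ^+ 2) ->
  schatten_le p (\sum_i T i) (k%:R `^ inv_exp p * B).
Proof.
move=> p0 k0 B0 TB lQ TQ oT QB; have cT i := schatten_le_compact (TB i).
have cS : compact_operator (\sum_i T i) by exact: compact_operator_sum.
split=> //; first by rewrite mulr_ge0 ?powR_ge0.
apply: (lp_le_merge (a := fun i => sn (T i))) => //.
- by move=> j; exact: sn_ge0.
- by move=> i j; exact: sn_ge0.
- move=> n A TA; apply: sn_block => //; apply: le_trans (TA (Ordinal k0)).
  exact: sn_ge0.
- by move=> i; case: (TB i).
Qed.

Lemma schatten_le_schmidt_sum p N s x y B : (0 < p)%E -> orthosys ip x -> orthosys ip y ->
  (forall i, 0 <= s i) -> (forall i j, (i <= j)%N -> s j <= s i) ->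
  (forall i, (N <= i)%N -> s i = 0) -> 0 <= B -> lp_le p s B ->
  schatten_le p (schmidt_sum ip N s x y) B.
Proof.
move=> p0 ox oy s0 sd sN B0 sB.
have cf : compact_operator (schmidt_sum ip N s x y).
  by apply: (compact_schmidt_sum ip_norm ox oy (s0 0%N)) => i _; rewrite ger0_norm// sd.
split=> //; apply: lp_le_mono sB => // n; rewrite sn_ge0//=.
exact: sn_schmidt_sum.
Qed.

Lemma schatten_le_bnd p f B : (0 < p)%E -> schatten_le p f B -> bounded_by f B.
Proof.
move=> p0 [cf B0 fB]; have [A /bnd_lin lf] := compact_operator_bnd cf.
split=> // h; apply: le_trans (nrm_le_sn0 ip_norm h cf) _.
rewrite ler_wpM2r ?nrm_ge0//; apply: lp_le0 fB => // j; exact: sn_ge0.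
Qed.

Lemma opnorm_le a A : bounded_by a A -> (opnorm a <= A%:E)%E.
Proof.
move=> [_ A0 aA]; apply: ge_ereal_sup => _ [h /= h1 <-]; rewrite lee_fin.
apply: le_trans (aA h) _; rewrite ler_piMr//.
by move: h1; rewrite nrmE lecR.
Qed.

Lemma opnorm_ge0 a : linear a -> (0 <= opnorm a)%E.
Proof.
move=> la; apply: ereal_sup_ubound; exists 0; first by rewrite /= normr0.
by rewrite lin0// normr0.
Qed.

(** Bridge from the extended-real definition to bounds on singular numbers; for [+oo] it amounts to
    the operator norm being [sn f 0]. *)
Lemma schatten_norm_leP p f B : (0 < p)%E -> compact_operator f -> 0 <= B ->
  (schatten_norm ip p f <= B%:E)%E <-> lp_le p (sn f) B.
Proof.
have s0 n : compact_operator f -> 0 <= sn f n by exact: sn_ge0.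
case: p => [r| |]// p0 cf B0.
  have r0 : 0 < r by rewrite -lte_fin.
  have ri0 : 0 < r^-1 by rewrite invr_gt0.
  rewrite /schatten_norm/=; set S := (\sum_(_ <= _ <oo) _)%E.
  have S0 : (0 <= S)%E by apply: nneseries_ge0 => n _ _; rewrite lee_fin powR_ge0.
  have SP : (S <= (B `^ r)%:E)%E <-> (forall n, \sum_(j < n) sn f j `^ r <= B `^ r).
    split=> [SB n|SB].
      rewrite -lee_fin; apply: le_trans SB; rewrite -sumEFin -(big_mkord xpredT (fun j => (sn f j `^ r)%:E)).
      by apply: nneseries_lim_ge => j _; rewrite lee_fin powR_ge0.
    apply: lime_le; first by apply: is_cvg_nneseries => n _ _; rewrite lee_fin powR_ge0.
    by apply: nearW => n; rewrite big_mkord sumEFin lee_fin.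
  rewrite -SP; case: S S0 {SP} => [t| |]// t0.
    rewrite lee_fin in t0; rewrite poweR_EFin !lee_fin; split=> tB.
      by rewrite -[leLHS](powR_invK r0)//; apply: powR_le => //; exact: powR_ge0.
    rewrite -[leRHS](powRr1 B0) -(mulfV (lt0r_neq0 r0)) powRrM; exact: powR_le.
  by rewrite poweRyr ?gt_eqF//.
rewrite /=; split=> [fB j|fB].
  apply: le_trans (sn_noninc ip_norm cf (leq0n j)) _; apply: sn0_le => //.
  have [A /bnd_lin lf] := compact_operator_bnd cf.
  split=> // h; have [->|h0] := eqVneq h 0; first by rewrite lin0// !nrm0 mulr0.
  have hgt0 : 0 < nrm h.
    by rewrite lt_neqAle nrm_ge0 andbT eq_sym; apply: contra_neq h0 => /nrm0_eq0.
  have hi0 : 0 <= (nrm h)^-1 by rewrite invr_ge0 ltW.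
  have : ((nrm (f ((nrm h)^-1%:C *: h)))%:E <= opnorm f)%E.
    apply: ereal_sup_ubound; exists ((nrm h)^-1%:C *: h) => //=.
    by rewrite nrmE lecR nrmZ cabsR (ger0_norm hi0) mulVf ?gt_eqF.
  move=> /le_trans/(_ fB); rewrite lee_fin linZ// nrmZ cabsR (ger0_norm hi0).
  by rewrite ler_pdivrMl// mulrC.
apply: opnorm_le; have [A /bnd_lin lf] := compact_operator_bnd cf.
split=> // h; apply: le_trans (nrm_le_sn0 ip_norm h cf) _.
by rewrite ler_wpM2r ?nrm_ge0.
Qed.

Lemma schatten_norm_ge0 p f : linear f -> (0 <= schatten_norm ip p f)%E.
Proof.
by move=> lf; case: p => [r| |]; rewrite /schatten_norm ?opnorm_ge0 ?poweR_ge0.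
Qed.

Lemma schatten_le_schatten_norm p f B : (0 < p)%E -> schatten_le p f B ->
  (schatten_norm ip p f <= B%:E)%E.
Proof. by move=> p0 [cf B0 fB]; apply/schatten_norm_leP. Qed.

Lemma schatten_norm_schatten_le p f B : (0 < p)%E -> compact_operator f -> 0 <= B ->
  (schatten_norm ip p f <= B%:E)%E -> schatten_le p f B.
Proof. by move=> p0 cf B0 fB; split=> //; apply/schatten_norm_leP. Qed.

Lemma schatten_schatten_le p f : (0 < p)%E -> schatten ip p f ->
  exists2 B, schatten_norm ip p f = B%:E & schatten_le p f B.
Proof.
move=> p0 [cf fp]; have [A /bnd_lin lf] := compact_operator_bnd cf.
have f0 := schatten_norm_ge0 p lf.
have fE : schatten_norm ip p f = (fine (schatten_norm ip p f))%:E.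
  by rewrite fineK// ge0_fin_numE.
exists (fine (schatten_norm ip p f)) => //.
by apply: schatten_norm_schatten_le; rewrite ?fine_ge0// -fE.
Qed.

Lemma finite_rank_schatten p f : (0 < p)%E -> finite_rank f -> schatten ip p f.
Proof.
move=> p0 Ff; have cf := finite_rank_compact ip_norm Ff; split=> //.
have [N sN] := sn_finite_rank ip_norm Ff.
apply: le_lt_trans (ltry (N%:R `^ inv_exp p * sn f 0)).
apply/schatten_norm_leP => //; first by rewrite mulr_ge0 ?powR_ge0 ?sn_ge0.
apply: lp_le_finite => //; first exact: sn_ge0.
by move=> j _; rewrite sn_ge0//= sn_noninc.
Qed.

End SchattenBounds.

(** * Bicentralizers *)

Section SchmidtSums.
Context {R : realType} {H : completeNormedModType R[i]}.
Context (ip : {dot H for Num.conj}) (ip_norm : forall x : H, `|x| ^+ 2 = ip x x).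
Implicit Types (a b f g : H -> H) (p q : \bar R) (s t : nat -> R) (x y z : nat -> H).

Lemma sum_widen_eq (V : nmodType) (F : nat -> V) (N M : nat) : (N <= M)%N ->
  (forall n, (N <= n)%N -> F n = 0) -> \sum_(n < M) F n = \sum_(n < N) F n.
Proof.
move=> NM F0; rewrite -!(big_mkord xpredT F) (big_cat_nat (leq0n N) NM)/=.
by rewrite [X in _ + X]big_nat_cond [X in _ + X]big1 ?addr0// => n /andP[/andP[/F0]].
Qed.

Lemma schmidt_sum_widen N M s x y h : (N <= M)%N -> (forall n, (N <= n)%N -> s n = 0) ->
  schmidt_sum ip M s x y h = schmidt_sum ip N s x y h.
Proof.
move=> NM s0; apply: (sum_widen_eq (F := fun n => ((s n)%:C * ip h (x n)) *: y n)) => // n /s0->.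
by rewrite mul0r scale0r.
Qed.

Lemma finite_rank_schmidt f : finite_rank f -> exists N x y,
  [/\ orthosys ip x, orthosys ip y,
      forall n, singular_numbers ip f n != 0 -> ip (x n) (x n) = 1 /\ ip (y n) (y n) = 1,
      forall n, (N <= n)%N -> singular_numbers ip f n = 0 &
      f = schmidt_sum ip N (singular_numbers ip f) x y].
Proof.
move=> Ff; have [N sN] := sn_finite_rank ip_norm Ff.
have [x [y [ox oy xy _ fxy]]] := schmidt_vectors ip_norm (finite_rank_compact ip_norm Ff).
exists N, x, y; split=> //; apply/funext => h.
apply/eqP; rewrite -subr_eq0; apply/eqP/nrm_lt_eq0 => e e0.
have /cvg_nrmP/(_ _ e0)[M _ /(_ (maxn M N) (leq_maxl _ _))/=] := fxy h.
by rewrite (schmidt_sum_widen _ _ _ (leq_maxr M N)).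
Qed.

Lemma ip_schmidt_sumE N s x y h m : orthosys ip y -> ip (y m) (y m) = 1 ->
  ((N <= m)%N -> s m = 0) ->
  ip (schmidt_sum ip N s x y h) (y m) = (s m)%:C * ip h (x m).
Proof.
move=> oy ym sm; have [mN|Nm] := ltnP m N; first exact: ip_schmidt_sum.
rewrite (sm Nm) mul0r ip_suml big1// => n _; rewrite ipZl (proj1 oy) ?mulr0// => nm.
by have := ltn_ord n; rewrite nm ltnNge Nm.
Qed.

(** The isometries, projections and diagonal operators below are all Schmidt sums, and their
    products are computed here; [u] selects a subfamily of indices. Where [y (u n)] is 0 the inner
    coefficient is lost, hence the alternatives [t n = 0] and [z n = 0]. *)
Lemma schmidt_sum_comp N s t x y z (u : nat -> nat) M r : orthosys ip y ->
  (forall n, (n < N)%N -> [\/ ip (y (u n)) (y (u n)) = 1, t n = 0 | z n = 0]) ->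
  (forall n, (n < N)%N -> (M <= u n)%N -> s (u n) = 0) ->
  (forall n, (n < N)%N -> t n * s (u n) = r n) ->
  schmidt_sum ip N t (y \o u) z \o schmidt_sum ip M s x y = schmidt_sum ip N r (x \o u) z.
Proof.
move=> oy y1 s0 ts; apply/funext => h; rewrite /= /schmidt_sum.
apply: eq_bigr => n _; rewrite -/(schmidt_sum ip M s x y h).
have [y1n|t0|->] := y1 n (ltn_ord n).
- by rewrite ip_schmidt_sumE//= ?mulrA -?rmorphM/= ?ts// => *; exact: s0.
- by rewrite -(ts _ (ltn_ord n)) t0 !(mul0r, rmorph0).
- by rewrite !scaler0.
Qed.

Definition one_seq : nat -> R := fun=> 1.

Lemma projection_bnd N x : orthosys ip x -> bounded_by (schmidt_sum ip N one_seq x x) 1.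
Proof. by move=> ox; apply: schmidt_sum_bnd => // n _; rewrite normr1. Qed.

End SchmidtSums.

(** * Two-sided estimates and uniform control of rank-one operators *)

Section Centralizers.
Context {R : realType} {H : completeNormedModType R[i]}.
Context (ip : {dot H for Num.conj}) (ip_norm : forall x : H, `|x| ^+ 2 = ip x x).
Context (p q : \bar R) (p0 : (0 < p)%E) (q0 : (0 < q)%E).
Context (Omega : (H -> H) -> (H -> H)).
Implicit Types (a b f g : H -> H) (s t : nat -> R) (x y z : nat -> H).
Local Notation K := (quasi_const q).

Definition centralizes (C : R) : Prop := forall a f A B,
  bounded_by a A -> finite_rank f -> schatten_le ip p f B ->
  schatten_le ip q (Omega (a \o f) - (a \o Omega f)) (C * A * B) /\
  schatten_le ip q (Omega (f \o a) - (Omega f \o a)) (C * A * B).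

Context (Om : bicentralizer ip p q Omega).

Lemma Omega_schatten f : finite_rank f -> exists B, schatten_le ip q (Omega f) B.
Proof. by case: Om => Oq _ _ /Oq /(schatten_schatten_le ip_norm q0)[B _]; exists B. Qed.

Lemma Omega_compact f : finite_rank f -> compact_operator (Omega f).
Proof. by move=> /Omega_schatten[B /schatten_le_compact]. Qed.

Lemma OmegaZ c f : finite_rank f -> Omega (c *: f) = c *: Omega f.
Proof. by case: Om => _ OZ _; exact: OZ. Qed.

Lemma Omega0 : Omega 0 = 0.
Proof. by have := OmegaZ 0 (@finite_rank0 R H); rewrite !scale0r. Qed.

Lemma bicentralizer_centralizes : exists2 C, 0 <= C & centralizes C.
Proof.
(* The given constant may be negative; its absolute value makes the bound monotone in [A] and
   [B]. *)
have [_ _ [C0 CP]] := Om; pose C := `|C0|; exists C; first exact: normr_ge0.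
move=> a f A B aA Ff fB.
have [cf B0 _] := fB; have A0 := bnd_ge0 aA.
have la := bnd_lin aA; have [A' /bnd_lin lf] := finite_rank_bnd Ff.
have ba : bounded_operator a by apply/bounded_operatorP; exists A.
have CAB : 0 <= C * A * B by rewrite !mulr_ge0// normr_ge0.
have cO := Omega_compact Ff.
have [c1 c2] := CP a f ba Ff.
have oa := opnorm_le aA; have oa0 := opnorm_ge0 la.
have sf := schatten_le_schatten_norm ip_norm p0 fB; have sf0 := schatten_norm_ge0 ip p lf.
have fin : (C0%:E * opnorm a * schatten_norm ip p f <= (C * A * B)%:E)%E.
  rewrite -muleA !EFinM -muleA; apply: (@le_trans _ _ (C%:E * (opnorm a * schatten_norm ip p f))%E).
    by rewrite lee_wpmul2r ?mule_ge0// lee_fin ler_norm.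
  by rewrite lee_wpmul2l ?lee_fin ?normr_ge0//; exact: lee_pmul.
split; apply: (schatten_norm_schatten_le ip_norm) => //.
- apply: compact_operatorB; last exact: (compact_operator_compl aA).
  apply: Omega_compact; exact: (finite_rank_compl aA Ff).
- exact: le_trans fin.
- apply: compact_operatorB; last exact: (compact_operator_compr aA).
  by apply: Omega_compact; exact: (finite_rank_compr aA Ff).
- by apply: le_trans c2 _; rewrite muleAC.
Qed.

Context (C : R) (C0 : 0 <= C) (OC : centralizes C).

(** Telescope through [Omega (a \o f) \o b], with one centralizer estimate on each side. *)
Lemma Omega_comp a b f A B D : bounded_by a A -> bounded_by b B -> finite_rank f ->
  schatten_le ip p f D ->
  schatten_le ip q (Omega (a \o f \o b) - (a \o Omega f \o b)) (K * (2 * C * A * B * D)).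
Proof.
move=> aA bB Ff fD.
have -> : Omega (a \o f \o b) - (a \o Omega f \o b) =
   (Omega (a \o f \o b) - (Omega (a \o f) \o b)) + ((Omega (a \o f) - (a \o Omega f)) \o b).
  by apply/funext => h; rewrite !fctE /= subrKA.
have -> : 2 * C * A * B * D = C * B * (A * D) + B * (C * A * D) by ring.
apply: (schatten_leD ip_norm) => //.
  by apply: (OC bB _ _).2; [exact: (finite_rank_compl aA Ff)|exact: (schatten_le_compl ip_norm)].
by apply: (schatten_le_compr ip_norm) => //; exact: (OC aA Ff fD).1.
Qed.

Definition rank1 (u v : H) : H -> H := fun h => ip h u *: v.

Lemma rank1_bnd u v : bounded_by (rank1 u v) (nrm u * nrm v).
Proof.
split=> [c h k||h]; last 2 first.
- by rewrite mulr_ge0 ?nrm_ge0.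
- rewrite /rank1 nrmZ mulrAC ler_wpM2r ?nrm_ge0// mulrC.
  exact: cauchy_schwarz.
by rewrite /rank1 ipDl ipZl scalerDl scalerA.
Qed.

Lemma rank1_finite_rank u v : finite_rank (rank1 u v).
Proof.
split; first by apply/bounded_operatorP; exists (nrm u * nrm v); exact: rank1_bnd.
by exists 1%N, (fun=> v) => h; exists (fun=> ip h u); rewrite big_ord1.
Qed.

Lemma rank1_schatten_le (r : \bar R) e : (0 < r)%E -> nrm e = 1 -> schatten_le ip r (rank1 e e) 1.
Proof.
move=> r0 e1; pose x (n : nat) := if n == 0%N then e else 0.
pose s (n : nat) : R := (n == 0%N)%:R.
have -> : rank1 e e = schmidt_sum ip 1 s x x.
  by apply/funext => h; rewrite /schmidt_sum big_ord1 mul1r.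
have ox : orthosys ip x.
  split=> [m n|n]; rewrite /x.
    by case: m n => [|m] [|n]//=; rewrite ?ip0l ?ip0r.
  by case: n => [|n]; [right; exact: (ip1_nrm ip_norm)|left].
apply: (schatten_le_schmidt_sum ip_norm) => //.
- by case=> [|i] [|j].
- by case.
have -> : 1 = 1%:R `^ inv_exp r * 1 :> R by rewrite powR1 mulr1.
apply: lp_le_finite => //; last by case.
by case=> [|i]; rewrite /s/= ?ler01 ?lexx.
Qed.

(** With [u] and [v] in the unit ball, [rank1 u v] is a fixed [rank1 e e] multiplied on both sides
    by operators of norm at most 1, so the single value [Omega (rank1 e e)] controls them all. *)
Lemma rank1_bounded : exists2 M, 0 <= M & forall u v, nrm u <= 1 -> nrm v <= 1 ->
  schatten_le ip q (Omega (rank1 u v)) M.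
Proof.
(* Without a unit vector the space is trivial and every value of [Omega] is 0. *)
have [[e e1]|noe] := pselect (exists e : H, nrm e = 1); last first.
  exists 0 => // u v _ _; rewrite (_ : Omega _ = 0); first exact: (schatten_le0 ip_norm).
  apply/funext => h; apply: contrapT => h0; apply: noe.
  have n0 : nrm (Omega (rank1 u v) h) != 0 by apply/eqP => /nrm0_eq0.
  exists ((nrm (Omega (rank1 u v) h))^-1%:C *: Omega (rank1 u v) h).
  by rewrite nrmZ cabsR ger0_norm ?invr_ge0 ?nrm_ge0// mulVf.
have FE := rank1_finite_rank e e; have sE := rank1_schatten_le p0 e1.
have [D OD] := Omega_schatten FE; have D0 := schatten_le_ge0 OD.
have K1 := quasi_const_ge1 q0.
have M0 : 0 <= K * (K * (2 * C) + D).
  by rewrite mulr_ge0 ?addr_ge0 ?mulr_ge0//; lra.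
exists (K * (K * (2 * C) + D)) => // u v u1 v1.
have bu : bounded_by (rank1 u e) 1.
  by apply: bndW (rank1_bnd u e); rewrite e1 mulr1.
have bv : bounded_by (rank1 e v) 1.
  by apply: bndW (rank1_bnd e v); rewrite e1 mul1r.
have uvE : rank1 u v = rank1 e v \o rank1 e e \o rank1 u e.
  by apply/funext => h; rewrite /rank1 /= !ipZl (ip1_nrm ip_norm e1) !mulr1.
have := Omega_comp bv bu FE sE; rewrite -uvE !mulr1 => d1.
have := schatten_le_comp ip_norm q0 OD bv bu; rewrite !mul1r => d2.
by have := schatten_leD ip_norm q0 d1 d2; rewrite subrK.
Qed.

End Centralizers.

(** * The case p < q *)

Section SmallToLarge.
Context {R : realType} {H : completeNormedModType R[i]}.
Context (ip : {dot H for Num.conj}) (ip_norm : forall x : H, `|x| ^+ 2 = ip x x).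
Context (p q : \bar R) (p0 : (0 < p)%E) (q0 : (0 < q)%E).
Context (Omega : (H -> H) -> (H -> H)).
Implicit Types (a b f g : H -> H) (s t : nat -> R) (x y z : nat -> H).
Local Notation K := (quasi_const q).

Lemma inv_exp_lt : (p < q)%E -> inv_exp q < inv_exp p.
Proof.
case: p p0 => [r| |]; case: q q0 => [r'| |]//=; rewrite ?lte_fin => a b ab.
- by rewrite ltf_pV2.
- by rewrite invr_gt0.
Qed.

Lemma exists_powR_ge (A d : R) : 0 < d -> exists2 k : nat, (0 < k)%N & A <= k%:R `^ d.
Proof.
move=> d0; have [A0|A0] := ltP A 0.
  by exists 1%N => //; apply: le_trans (powR_ge0 _ _); exact: ltW.
pose k := (Num.truncn (A `^ d^-1)).+1; exists k => //.
rewrite -[leLHS](powR_invK d0)//; apply: powR_le => //; first exact: powR_ge0.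
exact/ltW/truncnS_gt.
Qed.

Context (Om : bicentralizer ip p q Omega) (C : R) (C0 : 0 <= C) (OC : centralizes ip p q Omega C).

(** Induction on the number of terms, with a constant [M = 2 K rho] that reproduces itself: since
    [K k^(1/q - 1/p) <= 1/2], the orthogonal pieces contribute at most [K rho B], and so do the
    errors, whose total before the last sum is [rho B]. *)
Lemma schmidt_sum_bounded : (p < q)%E -> exists2 M, 0 <= M &
  forall N s x y B, orthosys ip x -> orthosys ip y ->
    (forall i, 0 <= s i) -> (forall i j, (i <= j)%N -> s j <= s i) ->
    (forall i, (N <= i)%N -> s i = 0) ->
    (forall n, s n != 0 -> ip (x n) (x n) = 1 /\ ip (y n) (y n) = 1) ->
    0 <= B -> lp_le p s B -> schatten_le ip q (Omega (schmidt_sum ip N s x y)) (M * B).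
Proof.
move=> pq; have K1 := quasi_const_ge1 q0.
have [M1 M10 M1P] := rank1_bounded ip_norm p0 q0 Om C0 OC.
have d0 : 0 < inv_exp p - inv_exp q by rewrite subr_gt0 inv_exp_lt.
have [k k0 kP] := exists_powR_ge (2 * K) d0.
have kR : 0 < k%:R :> R by rewrite ltr0n.
have kp0 : 0 < k%:R `^ inv_exp p :> R by exact: powR_gt0.
have kq0 : 0 < k%:R `^ inv_exp q :> R by exact: powR_gt0.
have half : K * (k%:R `^ inv_exp q * (k%:R `^ inv_exp p)^-1) <= 1 / 2.
  have : k%:R `^ (inv_exp p - inv_exp q) * k%:R `^ inv_exp q = k%:R `^ inv_exp p.
    by rewrite -powRD ?subrK// pnatr_eq0 -lt0n k0 implybT.
  move=> E; rewrite mulrA ler_pdivrMr// -E.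
  move: kP kq0; move: (_ `^ (_ - _)) (_ `^ inv_exp q) => a b ka b0; nra.
pose L := (2 * K) ^+ k; have L0 : 0 <= L by rewrite exprn_ge0//; lra.
(* Three sources of error: [R0], of norm [2 k]; the [k] rank-one pieces; the replacement of
   [P i \o Omega f] by [P i \o Omega (f_ i) \o Q i]. The factor [L] is the cost of summing [k]
   operators. *)
pose rho := K * (2 * k%:R * C + K * (L * (K * (C + M1)) + L * (K * (C + K * (2 * C))))).
have K0 : 0 <= K by lra.
have rho0 : 0 <= rho by rewrite /rho !(mulr_ge0, addr_ge0).
have rhoE : rho = K * (2 * k%:R * C + K * (L * (K * (C + M1)) + L * (K * (C + K * (2 * C))))) by [].
clearbody rho.
exists (2 * K * rho); first by rewrite !mulr_ge0.
elim=> [|N IH] s x y B ox oy s0 sd sN xy1 B0 sB.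
  rewrite (_ : schmidt_sum _ _ _ _ _ = 0); last by apply/funext => h; rewrite /schmidt_sum big_ord0.
  rewrite (Omega0 Om); apply: (schatten_le0 ip_norm) => //.
  by rewrite !mulr_ge0.
set f := schmidt_sum ip N.+1 s x y.
have Ff : finite_rank f.
  by apply: finite_rank_schmidt_sum (s0 0%N) _ => // n _; rewrite ger0_norm// sd.
have fB : schatten_le ip p f B by apply: (schatten_le_schmidt_sum ip_norm).
(* The residue classes start at [k], not at 0: then [j < u i j], so [N] terms suffice for each
   [f_ i] and the induction hypothesis applies. The first [k] indices are treated as rank-one
   operators. *)
pose u (i : 'I_k) j := (k * j.+1 + i)%N.
have u_inj (i i' : 'I_k) j j' : u i j = u i' j' -> i = i' /\ j = j'.
  move=> E; have := congr1 (modn^~ k) E; have := congr1 (divn^~ k) E.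
  rewrite /u ![(k * _)%N]mulnC !divnMDl// !modnMDl !modn_small// !divn_small// !addn0.
  by move=> [->] /val_inj.
have ui_inj i : injective (u i) by move=> j j' /u_inj[].
have u_ge i j : (j < u i j)%N.
  by rewrite /u; apply: leq_trans (leq_addr _ _); rewrite leq_pmull.
pose f_ i := schmidt_sum ip N (s \o u i) (x \o u i) (y \o u i).
pose P i := schmidt_sum ip N one_seq (y \o u i) (y \o u i).
pose Q i := schmidt_sum ip N one_seq (x \o u i) (x \o u i).
have oxu i : orthosys ip (x \o u i) by exact: orthosys_reindex.
have oyu i : orthosys ip (y \o u i) by exact: orthosys_reindex.
have bP i : bounded_by (P i) 1 by exact: projection_bnd.
have bQ i : bounded_by (Q i) 1 by exact: projection_bnd.
have s_u i n : (N <= n)%N -> (s \o u i) n = 0.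
  by move=> Nn; apply: sN; exact: leq_ltn_trans (u_ge i n).
have unit_or_0 z n : orthosys ip z -> ip (z n) (z n) = 1 \/ z n = 0.
  by move=> [_ /(_ n)[]]; [right|left].
have Pf i : P i \o f = f_ i.
  apply: schmidt_sum_comp => // [n _|n _|n _]; last exact: mul1r.
    by have [] := unit_or_0 y (u i n) oy; [constructor 1|constructor 3].
  by move=> ?; exact: sN.
have Pf_ i : P i \o f_ i = f_ i.
  apply: (@schmidt_sum_comp _ _ ip _ _ _ _ _ _ id N) => // [n _|n nN|n _]; last exact: mul1r.
    by have [] := unit_or_0 y (u i n) oy; [constructor 1|constructor 3].
  by rewrite leqNgt nN.
have f_Q i : f_ i \o Q i = f_ i.
  apply: (@schmidt_sum_comp _ _ ip _ _ _ _ _ _ id N) => // [n _|n nN|n _]; last exact: mulr1.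
    have [sn0|/xy1[x1 _]] := eqVneq (s (u i n)) 0; first by constructor 2.
    by constructor 1.
  by rewrite leqNgt nN.
have QQ i : Q i \o Q i = Q i.
  apply: (@schmidt_sum_comp _ _ ip _ _ _ _ _ _ id N) => // [n _|n nN|n _]; last exact: mul1r.
    by have [] := unit_or_0 x (u i n) ox; [constructor 1|constructor 3].
  by rewrite leqNgt nN.
have Ff_ i : finite_rank (f_ i) by rewrite -Pf; exact: (finite_rank_compl (bP i) Ff).
have f_B i : schatten_le ip p (f_ i) B.
  by rewrite -Pf -[B]mul1r; exact: (schatten_le_compl ip_norm).
have Of_ i : schatten_le ip q (Omega (f_ i)) (2 * K * rho * ((k%:R `^ inv_exp p)^-1 * B)).
  apply: IH => //.
  - by move=> j; exact: s0.
  - by move=> j j' jj; apply: sd; rewrite /u leq_add2r leq_mul2l ltnS jj orbT.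
  - by move=> j; exact: s_u.
  - by move=> j; exact: xy1.
  - by rewrite mulr_ge0// invr_ge0 ltW.
  (* Since [j <= u i (j %/ k)], the sequence [s \o u i] with each term repeated [k] times stays
     below [s]; undilating gives the factor [k^(-1/p)]. *)
  apply: (lp_le_undilate (k := k)) => //; first by rewrite mulr_ge0// invr_ge0 ltW.
    by move=> j; exact: s0.
  rewrite mulrA mulfV ?gt_eqF// mul1r; apply: lp_le_mono sB => // j.
  rewrite /= s0 sd// /u; apply: leq_trans (leq_addr _ _).
  by rewrite mulnC ltnW// ltn_ceil.
pose pr n := rank1 ip (y n) (y n).
have bpr n : bounded_by (pr n) 1.
  apply: bndW (rank1_bnd ip_norm _ _).
  rewrite -[leRHS]mulr1; apply: ler_pM; rewrite ?nrm_ge0 ?(orthosys_nrm ip_norm oy)//.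
(* [R0] fixes [f]. Its norm is bounded crudely by [2 k], which suffices because the loss goes into
   [rho]. *)
pose R0 := \sum_(n < k) pr n + \sum_i P i.
have bR0 : bounded_by R0 (2 * k%:R).
  have := bndD (bnd_sum (index_enum 'I_k) (P := xpredT) (fun n _ => bpr n))
    (bnd_sum (index_enum 'I_k) (P := xpredT) (fun i _ => bP i)).
  by rewrite sumr_const card_ord -mulr2n mulr_natl.
have prf n h : pr n (f h) = ((s n)%:C * ip h (x n)) *: y n.
  rewrite /pr /rank1; have [y1|->] := unit_or_0 y n oy; last by rewrite !scaler0.
  by rewrite (ip_schmidt_sumE _ _ oy y1)//; exact: sN.
have R0f : R0 \o f = f.
  apply/funext => h; rewrite /= /R0 !fctE !fct_sumE.
  under eq_bigr do rewrite prf.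
  under [X in _ + X]eq_bigr => i _ do rewrite -[P i (f h)]/((P i \o f) h) Pf.
  pose F n := ((s n)%:C * ip h (x n)) *: y n.
  have F0 n : (N.+1 <= n)%N -> F n = 0 by move=> /sN; rewrite /F => ->; rewrite mul0r scale0r.
  rewrite [RHS](_ : _ = \sum_(n < N.+1) F n)// -(sum_widen_eq (M := k * N.+1)) ?leq_pmull//.
  rewrite sum_ord_mul big_ord_recl/=; congr (_ + _); last first.
    by rewrite exchange_big.
  by apply: eq_bigr => i _; rewrite muln0.
have e1 : schatten_le ip q (Omega f - (R0 \o Omega f)) (2 * k%:R * C * B).
  have := (OC bR0 Ff fB).1; rewrite R0f; congr (schatten_le _ _ _ _); ring.
have sB0 n : s n <= B by apply: le_trans (sd 0%N n _) _ => //; exact: lp_le0 sB.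
have e2 n : schatten_le ip q (pr n \o Omega f) (K * (C + M1) * B).
  have -> : pr n \o Omega f = Omega (pr n \o f) - (Omega (pr n \o f) - (pr n \o Omega f)).
    by rewrite subKr.
  have -> : K * (C + M1) * B = K * (M1 * B + C * B) by ring.
  apply: (schatten_leB ip_norm) => //; last first.
    by have := (OC (bpr n) Ff fB).1; rewrite mulr1.
  have -> : pr n \o f = (s n)%:C *: rank1 ip (x n) (y n).
    by apply/funext => h; rewrite -[LHS]/(pr n (f h)) prf !fctE /rank1 scalerA.
  rewrite (OmegaZ Om); last exact: rank1_finite_rank.
  have := M1P _ _ (orthosys_nrm ip_norm ox n) (orthosys_nrm ip_norm oy n).
  move=> /(schatten_leZ ip_norm (s n)%:C q0); apply: schatten_leW => //.
  by rewrite cabsR ger0_norm// mulrC ler_wpM2l.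
(* [f_ i] equals both [P i \o f] and [P i \o f_ i \o Q i]; each identity is passed through [Omega]
   once. *)
have e3 i : schatten_le ip q ((P i \o Omega f) - (P i \o Omega (f_ i) \o Q i)) (K * (C + K * (2 * C)) * B).
  have -> : (P i \o Omega f) - (P i \o Omega (f_ i) \o Q i) =
    (Omega (f_ i) - (P i \o Omega (f_ i) \o Q i)) - (Omega (P i \o f) - (P i \o Omega f)).
    by rewrite Pf [RHS]addrC opprB subrKA.
  have -> : K * (C + K * (2 * C)) * B = K * (K * (2 * C * B) + C * B) by ring.
  apply: (schatten_leB ip_norm) => //; last first.
    by have := (OC (bP i) Ff fB).1; rewrite mulr1.
  have := Omega_comp ip_norm p0 q0 OC (bP i) (bQ i) (Ff_ i) (f_B i).
  by rewrite Pf_ f_Q !mulr1.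
have block : schatten_le ip q (\sum_i (P i \o Omega (f_ i) \o Q i))
    (k%:R `^ inv_exp q * (2 * K * rho * ((k%:R `^ inv_exp p)^-1 * B))).
  apply: (schatten_le_block ip_norm (Q := Q)) => //.
  - by case: (Of_ (Ordinal k0)).
  - by move=> i; have := schatten_le_comp ip_norm q0 (Of_ i) (bP i) (bQ i); rewrite !mul1r.
  - by move=> i; exact: bnd_lin (bQ i).
  - by move=> i h; rewrite /= -[Q i (Q i h)]/((Q i \o Q i) h) QQ.
  - move=> i j h h' ij; rewrite /= /P /schmidt_sum ip_suml big1// => n _.
    rewrite ip_sumr big1// => m _; rewrite ipZl ipZr (proj1 oy) ?mulr0//.
    by move=> /u_inj[E _]; rewrite E eqxx in ij.
  - move=> h; apply: le_trans (bessel_schmidt ip_norm (k * N.+1) h ox).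
    rewrite (sum_ord_mul _ _ (fun n => cabs (ip h (x n)) ^+ 2)) big_ord_recl/=.
    apply: ler_wpDl; first by apply: sumr_ge0 => i _; exact: sqr_ge0.
    rewrite exchange_big/=; apply: ler_sum => i _.
    rewrite /Q /schmidt_sum (pythagoras_ord ip_norm); last first.
      move=> n m nm; rewrite ipZl ipZr (proj1 ox) ?mulr0//.
      by move=> /u_inj[_ /val_inj].
    apply: ler_sum => n _; rewrite nrmZ mul1r exprMn ler_piMr ?sqr_ge0//.
    by rewrite expr_le1 ?nrm_ge0 ?(orthosys_nrm ip_norm).
have LB0 : 0 <= K * (C + M1) * B by rewrite !mulr_ge0// ?addr_ge0.
have LB1 : 0 <= K * (C + K * (2 * C)) * B.
  by rewrite !(mulr_ge0, addr_ge0).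
have E2 := schatten_le_sum ip_norm q0 LB0 (fun n : 'I_k => e2 n).
have E3 := schatten_le_sum ip_norm q0 LB1 e3.
have := schatten_leD ip_norm q0 block (schatten_leD ip_norm q0 e1 (schatten_leD ip_norm q0 E2 E3)).
rewrite (_ : _ + _ = Omega f); last first.
  have -> : R0 \o Omega f = \sum_(n < k) (pr n \o Omega f) + \sum_i (P i \o Omega f).
    by apply/funext => h; rewrite /= /R0 !fctE !fct_sumE.
  have cancel (V : zmodType) (T O A B' : V) : T + ((O - (A + B')) + (A + (B' - T))) = O.
    by rewrite (addrA A) subrKA addrC subrK.
  by rewrite sumrB cancel.
apply: schatten_leW => //.
rewrite -/L.
have -> : K * (2 * k%:R * C * B + K * (L * (K * (C + M1) * B) + L * (K * (C + K * (2 * C)) * B))) = rho * B.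
  by rewrite rhoE; ring.
rewrite mulrDr.
apply: le_trans (_ : K * rho * B + K * (rho * B) <= _); last by lra.
apply: lerD => //.
have rB : 0 <= 2 * K * rho * B by rewrite !mulr_ge0.
by have := ler_wpM2r rB half; lra.
Qed.

End SmallToLarge.

(** * Operators almost commuting with all projections *)

(** Dependent choice with full history: the condition on a term may involve the whole list of
    earlier terms. *)
Lemma dependent_choice_seq (T : Type) (Q : seq T -> T -> Prop) :
  (forall s, exists t, Q s t) -> exists u : nat -> T, forall n, Q (mkseq u n) (u n).
Proof.
move=> QT; pose next s := projT1 (cid (QT s)).
pose h := fix h n : seq T := if n is m.+1 then rcons (h m) (next (h m)) else [::].
exists (fun n => next (h n)) => n.
have -> : mkseq (fun n => next (h n)) n = h n.
  by elim: n => //= n IH; rewrite mkseqS IH.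
exact: projT2 (cid (QT (h n))).
Qed.

Section Greedy.
Context {R : realType} {H : completeNormedModType R[i]}.
Context (ip : {dot H for Num.conj}) (ip_norm : forall x : H, `|x| ^+ 2 = ip x x).
Implicit Types (a b f g : H -> H) (s t : nat -> R) (x y z : nat -> H).

(** If the projection onto the span of finitely many vectors fixed every vector, [id] would have
    finite rank; so each finite list leaves room for a further unit vector. *)
Lemma orthonormal_sequence : ~ finite_rank (@id H) ->
  exists e : nat -> H, forall i j, ip (e i) (e j) = (i == j)%:R.
Proof.
move=> infH.
have next (s : seq H) : exists v, nrm v = 1 /\ forall u, u \in s -> ip v u = 0.
  have [w [ow [_ ws]]] := gram_schmidt ip_norm (size s) (nth 0 s).
  pose P h := \sum_(l < size s) ip h (w l) *: w l.
  have [h hP] : exists h, h <> P h.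
    apply: contrapT => /forallNP hP; apply: infH; split.
      by apply/bounded_operatorP; exists 1; exact: bnd_id.
    exists (size s), (fun l => w l) => h; exists (fun l => ip h (w l)).
    by have /contrapT := hP h.
  pose r := h - P h; have rw l : (l < size s)%N -> ip r (w l) = 0.
    have [w1 w2] := ow; move=> ls; rewrite ipBl ip_suml (bigD1 (Ordinal ls))//= ipZl.
    rewrite big1 => [|i il]; last first.
      by rewrite ipZl w1 ?mulr0// => ilE; move/eqP: il; apply; exact: val_inj.
    rewrite addr0; have [->|->] := w2 l; first by rewrite !ip0r mulr0 subr0.
    by rewrite mulr1 subrr.
  have r0 : nrm r != 0.
    by apply/eqP => /nrm0_eq0/eqP; rewrite subr_eq0 => /eqP.
  exists ((nrm r)^-1%:C *: r); split.
    by rewrite nrmZ cabsR ger0_norm ?invr_ge0 ?nrm_ge0// mulVf.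
  move=> u us; have iu : (index u s < size s)%N by rewrite index_mem.
  have := ws _ iu; rewrite nth_index// => ->.
  by rewrite ipZl ip_sumr big1 ?mulr0// => l _; rewrite ipZr rw ?mulr0.
have [e eP] := dependent_choice_seq next; exists e.
have lt i j : (i < j)%N -> ip (e j) (e i) = 0.
  move=> ij; have [_] := eP j; apply; apply/mapP; exists i => //.
  by rewrite mem_iota.
move=> i j; case: ltngtP => [ij|ij|->].
- exact/ip_eq0C/lt.
- exact: lt.
- by apply: (ip1_nrm ip_norm); have [] := eP j.
Qed.

(* The near-eigenvalues agree: compare two orthogonal unit vectors with their sum. *)
Lemma near_eigen_scalar f (V : set H) (eta : R) : linear f -> 0 <= eta ->
  (forall c u v, V u -> V v -> V (c *: u + v)) ->
  (forall v, V v -> nrm v = 1 -> nrm (f v - ip (f v) v *: v) <= eta) ->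
  exists l : R[i], forall v, V v -> nrm (f v - l *: v) <= 10 * eta * nrm v.
Proof.
move=> lf eta0 VD Veig.
have [[v0 [Vv0 v01]]|V0] := pselect (exists v0, V v0 /\ nrm v0 = 1); last first.
  exists 0 => v Vv; have [v0|v0] := eqVneq (nrm v) 0.
    by rewrite (nrm0_eq0 v0) (lin0 lf) scaler0 subr0 nrm0 mulr0.
  exfalso; apply: V0; exists ((nrm v)^-1%:C *: v); split; last first.
    by rewrite nrmZ cabsR ger0_norm ?invr_ge0 ?nrm_ge0// mulVf.
  have V00 : V 0 by have := VD (-1) v v Vv Vv; rewrite scaleN1r addNr.
  by have := VD (nrm v)^-1%:C v 0 Vv V00; rewrite addr0.
have V00 : V 0 by have := VD (-1) _ _ Vv0 Vv0; rewrite scaleN1r addNr.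
have VZ c v : V v -> V (c *: v) by move=> Vv; have := VD c _ _ Vv V00; rewrite addr0.
have eig v : V v -> exists l : R[i], nrm (f v - l *: v) <= eta * nrm v.
  move=> Vv; have [z|v0n] := eqVneq (nrm v) 0.
    by exists 0; rewrite (nrm0_eq0 z) (lin0 lf) scaler0 subr0 nrm0 mulr0.
  have vi0 : 0 <= (nrm v)^-1 by rewrite invr_ge0 nrm_ge0.
  have vgt0 : 0 < nrm v by rewrite lt_neqAle eq_sym v0n nrm_ge0.
  have := Veig _ (VZ (nrm v)^-1%:C _ Vv); rewrite nrmZ cabsR (ger0_norm vi0) mulVf//.
  move=> /(_ erefl); set l := ip _ _ => E; exists l; move: E.
  rewrite (linZ lf) scalerA mulrC -scalerA -scalerBr nrmZ cabsR (ger0_norm vi0).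
  by rewrite ler_pdivrMl// mulrC.
pose l := ip (f v0) v0; have lP : nrm (f v0 - l *: v0) <= eta by exact: Veig.
(* [X] has norm at most [4 eta]: the defect of [v0 + w] counts [2 eta], as that vector has norm at
   most 2, and those of [v0] and [w] count [eta] each. Its coordinates put [l] and [lw] within
   [4 eta] of [m]. The defect of [w] then raises 8 to 9, and that of [v0] raises 9 to 10. *)
have close w : V w -> nrm w = 1 -> ip w v0 = 0 -> cabs (ip (f w) w - l) <= 8 * eta.
  move=> Vw w1 wv0; have wP := Veig _ Vw w1; set lw := ip (f w) w in wP *.
  have Vu : V (v0 + w) by have := VD 1 _ _ Vv0 Vw; rewrite scale1r.
  have [m mP] := eig _ Vu.
  have u2 : nrm (v0 + w) <= 2 by apply: le_trans (nrmD _ _) _; rewrite v01 w1; lra.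
  have {}mP : nrm (f (v0 + w) - m *: (v0 + w)) <= 2 * eta.
    by apply: le_trans mP _; rewrite mulrC ler_wpM2r.
  pose X := (l - m) *: v0 + (lw - m) *: w.
  have XE : X = (f (v0 + w) - m *: (v0 + w)) - (f v0 - l *: v0) - (f w - lw *: w).
    rewrite /X (linD lf) scalerDr !scalerBl !opprB.
    rewrite opprD (addrACA (f v0)) -[RHS]addrA (addrACA (f v0 - _)).
    by rewrite (addrC (f v0 - _)) (addrC (f w - _)) !subrKA.
  have X4 : nrm X <= 4 * eta.
    rewrite XE; apply: le_trans (nrmB _ _) _; apply: le_trans (lerD (nrmB _ _) (lexx _)) _; lra.
  have lm : cabs (l - m) <= 4 * eta.
    have := cauchy_schwarz ip_norm X v0; rewrite v01 mulr1 /X ipDl !ipZl wv0.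
    by rewrite (ip1_nrm ip_norm v01) mulr1 mulr0 addr0 => /le_trans; apply.
  have lwm : cabs (lw - m) <= 4 * eta.
    have := cauchy_schwarz ip_norm X w; rewrite w1 mulr1 /X ipDl !ipZl (ip_eq0C wv0).
    by rewrite (ip1_nrm ip_norm w1) mulr1 mulr0 add0r => /le_trans; apply.
  have -> : lw - l = (lw - m) + - (l - m) by rewrite opprB addrA subrK.
  by apply: le_trans (cabsD _ _) _; rewrite cabsN; lra.
exists l => v Vv; pose c := ip v v0; pose r := v - c *: v0.
have Vr : V r by have := VD (- c) _ _ Vv0 Vv; rewrite scaleNr addrC.
have rv0 : ip r v0 = 0 by rewrite /r ipBl ipZl (ip1_nrm ip_norm v01) mulr1 subrr.
have cv : cabs c <= nrm v.
  by have := cauchy_schwarz ip_norm v v0; rewrite v01 mulr1.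
have rv : nrm r <= nrm v.
  have := @pythagoras _ _ _ ip_norm r (c *: v0); rewrite ipZr rv0 mulr0 subrK => /(_ erefl) vE.
  by apply: ler_sqr_nneg; rewrite ?nrm_ge0// vE lerDl sqr_ge0.
have vE : v = c *: v0 + r by rewrite addrC subrK.
clearbody r.
have rP : nrm (f r - l *: r) <= 9 * eta * nrm r.
  have [z|r0] := eqVneq (nrm r) 0.
    by rewrite (nrm0_eq0 z) (lin0 lf) scaler0 subr0 nrm0 mulr0.
  have ri0 : 0 <= (nrm r)^-1 by rewrite invr_ge0 nrm_ge0.
  have rgt0 : 0 < nrm r by rewrite lt_neqAle eq_sym r0 nrm_ge0.
  pose w := (nrm r)^-1%:C *: r; have Vw : V w by exact: VZ.
  have w1 : nrm w = 1 by rewrite nrmZ cabsR (ger0_norm ri0) mulVf.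
  have rE : r = (nrm r)%:C *: w by rewrite scalerA -rmorphM/= mulfV// rmorph1 scale1r.
  have wv0 : ip w v0 = 0 by rewrite ipZl rv0 mulr0.
  clearbody w.
  have cw := close w Vw w1 wv0; have wP := Veig w Vw w1.
  have : nrm (f w - l *: w) <= 9 * eta.
    have -> : f w - l *: w = (f w - ip (f w) w *: w) + (ip (f w) w - l) *: w.
      by rewrite scalerBl addrA subrK.
    by apply: le_trans (nrmD _ _) _; rewrite nrmZ w1 mulr1; lra.
  have -> : f r - l *: r = (nrm r)%:C *: (f w - l *: w).
    by rewrite [RHS]scalerBr -(linZ lf) scalerA [_ * l]mulrC -scalerA -rE.
  move=> wl; rewrite nrmZ cabsR (ger0_norm (nrm_ge0 r)) [leRHS]mulrC.
  by rewrite ler_wpM2l ?nrm_ge0.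
have -> : f v - l *: v = c *: (f v0 - l *: v0) + (f r - l *: r).
  have -> : f v - l *: v = f (c *: v0 + r) - l *: (c *: v0 + r) by rewrite -vE.
  by rewrite (linD lf) (linZ lf) !scalerDr scalerN !scalerA [l * c]mulrC opprD addrACA.
apply: le_trans (nrmD _ _) _; rewrite nrmZ.
have := ler_pM (cabs_ge0 c) (nrm_ge0 _) cv lP.
have := ler_wpM2l (_ : 0 <= 9 * eta) rv; rewrite mulr_ge0// => /(_ isT); lra.
Qed.

End Greedy.

(** * Greedy choice of defect vectors and the nearly scalar conclusion *)

Section NearlyCommuting.
Context {R : realType} {H : completeNormedModType R[i]}.
Context (ip : {dot H for Num.conj}) (ip_norm : forall x : H, `|x| ^+ 2 = ip x x).
Context (A E : H -> H) (alpha : R) (bA : bounded_by A alpha) (bE : bounded_by E 1).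
Context (EA : forall x, E (A x) = A x) (AE : forall x, A (E x) = A x)
  (EE : forall x, E (E x) = E x) (Esym : forall x y, ip (E x) y = ip x (E y)).
Implicit Types (e f : nat -> H).

(** The conditions on [A v] ensure that the next [f r], a combination of [A (e r)] and [e r], is
    orthogonal to all earlier vectors. Four conditions per index account for the codimension [4 * r]
    later. *)
Definition decoupled e f r (v : H) : Prop := E v = v /\ forall l, (l < r)%N ->
  [/\ ip v (e l) = 0, ip v (f l) = 0, ip (A v) (e l) = 0 & ip (A v) (f l) = 0].

(** For a unit vector this is the distance from [A v] to the line of [v]. *)
Definition eigen_defect (v : H) : R := nrm (A v - ip (A v) v *: v).

Lemma eigen_defect_le v : nrm v = 1 -> eigen_defect v <= 2 * alpha.
Proof.
move=> v1; have [_ a0 Aa] := bA; have := Aa v; rewrite v1 mulr1 => Av.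
apply: le_trans (nrmB _ _) _; rewrite nrmZ v1 mulr1.
have := cauchy_schwarz ip_norm (A v) v; rewrite v1 mulr1; lra.
Qed.

Lemma greedy_sequence : exists (e f : nat -> H) (b : nat -> R), forall r,
  [/\ 0 <= b r,
      forall v, decoupled e f r v -> nrm v = 1 -> eigen_defect v <= 2 * b r &
      [/\ b r = 0, e r = 0 & f r = 0] \/
      0 < b r /\ [/\ decoupled e f r (e r), nrm (e r) = 1, nrm (f r) = 1, ip (f r) (e r) = 0 &
        A (e r) = ip (A (e r)) (e r) *: e r + (b r)%:C *: f r]].
Proof.
pose V (s : seq (H * H * R)) (v : H) := E v = v /\ forall t, t \in s ->
  [/\ ip v t.1.1 = 0, ip v t.1.2 = 0, ip (A v) t.1.1 = 0 & ip (A v) t.1.2 = 0].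
pose Q s (t : H * H * R) := [/\ 0 <= t.2,
  forall v, V s v -> nrm v = 1 -> eigen_defect v <= 2 * t.2 &
  [/\ t.2 = 0, t.1.1 = 0 & t.1.2 = 0] \/
  0 < t.2 /\ [/\ V s t.1.1, nrm t.1.1 = 1, nrm t.1.2 = 1, ip t.1.2 t.1.1 = 0 &
    A t.1.1 = ip (A t.1.1) t.1.1 *: t.1.1 + (t.2)%:C *: t.1.2]].
have QT s : exists t, Q s t.
  pose D := [set eigen_defect v | v in [set v | V s v /\ nrm v = 1]].
  have Dub : has_ubound D.
    by exists (2 * alpha) => _ [v [_ v1] <-]; exact: eigen_defect_le.
  have [[v [Vv v1] vpos]|noD] := pselect (exists2 v, V s v /\ nrm v = 1 & 0 < eigen_defect v); last first.
    exists (0, 0, 0); split=> //=; last by left.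
    move=> v Vv v1; rewrite mulr0 leNgt; apply/negP => vpos; apply: noD.
    by exists v.
  have Dv : D (eigen_defect v) by exists v.
  have D0 : D !=set0 by exists (eigen_defect v).
  have sup0 : 0 < sup D by apply: lt_le_trans vpos _; exact: ub_le_sup.
  have [_ [w [Vw w1] <-] wD] := sup_adherent (divr_gt0 sup0 (ltr0Sn _ 1)) (conj D0 Dub).
  have wgt : sup D / 2 < eigen_defect w by lra.
  have w0 : 0 < eigen_defect w by lra.
  set b := eigen_defect w in wgt w0.
  exists (w, b^-1%:C *: (A w - ip (A w) w *: w), b); split=> /=; first exact: ltW.
    move=> u Vu u1; apply: le_trans (_ : sup D <= _); last by lra.
    by apply: ub_le_sup => //; exists u.
  have bi0 : 0 <= b^-1 by rewrite invr_ge0 ltW.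
  right; split=> //; split=> //.
  - by rewrite nrmZ cabsR (ger0_norm bi0) mulVf// gt_eqF.
  - by rewrite ipZl ipBl ipZl (ip1_nrm ip_norm w1) mulr1 subrr mulr0.
  - by rewrite scalerA -rmorphM/= mulfV ?gt_eqF// rmorph1 scale1r subrKC.
have [u uQ] := dependent_choice_seq QT.
exists (fun n => (u n).1.1), (fun n => (u n).1.2), (fun n => (u n).2) => r.
have VE v : V (mkseq u r) v <-> decoupled (fun n => (u n).1.1) (fun n => (u n).1.2) r v.
  split=> -[Ev Vv]; split=> //.
    by move=> l lr; apply: Vv; apply/mapP; exists l => //; rewrite mem_iota.
  by move=> _ /mapP[l + ->]; rewrite mem_iota => /Vv.
have [b0 b1 b2] := uQ r; split=> //; first by move=> v /VE/b1.
by case: b2 => [|[bpos [/VE ? ? ? ? ?]]]; [left|right].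
Qed.

(* The commutator of [A] with the projection onto the [f l] maps [e l] to
   [b l *: f l], so its singular numbers dominate the greedy defects. *)
Lemma commutator_scalar q eps n : (0 < q)%E -> compact_operator A -> compact_operator E ->
  (forall P, bounded_by P 1 -> (forall x, P (E x) = P x) -> (forall x, E (P x) = P x) ->
    schatten_le ip q ((P \o A) - (A \o P)) eps) ->
  codim_le n [set x | E x = 0] ->
  exists l : R[i], schatten_le ip q (A - l *: E) (4%:R `^ inv_exp q * (80 * (2 * eps))).
Proof.
move=> q0 cA cE comm cod; have [e [f [b efb]]] := greedy_sequence.
have lA := bnd_lin bA; have lE := bnd_lin bE.
have b0 r : 0 <= b r by have [] := efb r.
have eP r : e r = 0 \/ decoupled e f r (e r).
  by have [_ _ [[_ -> _]|[_ []]]] := efb r; [left|right].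
have decA r l x : decoupled e f r x -> (l < r)%N -> ip (A x) (e l) = 0 /\ ip (A x) (f l) = 0.
  by move=> [_ H1] lr; have [] := H1 l lr.
have fE r : f r = 0 \/ exists c d : R[i], f r = c *: A (e r) + d *: e r.
  have [_ _ [[_ _ ->]|[bpos [_ _ _ _ Ae]]]] := efb r; [by left|right].
  exists (b r)^-1%:C, (- ((b r)^-1%:C * ip (A (e r)) (e r))).
  rewrite {1}Ae scalerDr !scalerA -rmorphM/= mulVf ?gt_eqF// rmorph1 scale1r.
  by rewrite scaleNr addrAC subrr add0r.
have ee l r : (l < r)%N -> ip (e r) (e l) = 0 /\ ip (e r) (f l) = 0.
  move=> lr; have [->|[_ H1]] := eP r; first by rewrite !ip0l.
  by have [] := H1 l lr.
have ff l r : (l < r)%N -> ip (f r) (e l) = 0 /\ ip (f r) (f l) = 0.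
  move=> lr; have [->|[c [d ->]]] := fE r; first by rewrite !ip0l.
  have [e1 e2] := ee _ _ lr; rewrite !ipDl !ipZl e1 e2 !mulr0 !addr0.
  have [->|dec] := eP r; first by rewrite (lin0 lA) !ip0l !mulr0.
  by have [-> ->] := decA _ _ _ dec lr; rewrite !mulr0.
have unit_e r : e r = 0 \/ ip (e r) (e r) = 1.
  by have [_ _ [[_ -> _]|[_ [_ /(ip1_nrm ip_norm)]]]] := efb r; [left|right].
have unit_f r : f r = 0 \/ ip (f r) (f r) = 1.
  by have [_ _ [[_ _ ->]|[_ [_ _ /(ip1_nrm ip_norm)]]]] := efb r; [left|right].
have oe : orthosys ip e.
  split=> // m r /eqP; rewrite neq_ltn => /orP[|] lt; last by case: (ee _ _ lt).
  by apply: ip_eq0C; case: (ee _ _ lt).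
have of_ : orthosys ip f.
  split=> // m r /eqP; rewrite neq_ltn => /orP[|] lt; last by case: (ff _ _ lt).
  by apply: ip_eq0C; case: (ff _ _ lt).
have ef r l : ip (e r) (f l) = 0.
  case: (ltngtP r l) => [lt|lt|->]; last first.
  - have [_ _ [[_ -> _]|[_ [_ _ _ fe _]]]] := efb l; first by rewrite ip0l.
    exact: ip_eq0C.
  - by case: (ee _ _ lt).
  - by apply: ip_eq0C; case: (ff _ _ lt).
have Ee r : E (e r) = e r by have [->|[]//] := eP r; rewrite (lin0 lE).
have Ef r : E (f r) = f r.
  have [->|[c [d ->]]] := fE r; first by rewrite (lin0 lE).
  by rewrite (linD lE) !(linZ lE) EA Ee.
(* Monotone only up to a factor 2: [e j] was already admissible when [e i] was chosen, but the
   choice was only half optimal. *)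
have bmono i j : (i <= j)%N -> b j <= 2 * b i.
  move=> ij; have [_ _ [[-> _ _]|[bpos [[Eej dj] ej fj _ Ae]]]] := efb j.
    by rewrite mulr_ge0.
  have [_ + _] := efb i; move=> /(_ (e j)).
  rewrite /eigen_defect {1}Ae addrAC subrr add0r nrmZ fj mulr1 cabsR ger0_norm//.
  by apply=> //; split=> // l li; apply: dj; exact: leq_trans ij.
have eps0 : 0 <= eps.
  have P0 : schatten_le ip q (((0 : H -> H) \o A) - (A \o 0)) eps.
    by apply: comm => // [|x]; [exact: bndW ler01 (@bnd0 R H)|rewrite /= (lin0 lE)].
  exact: schatten_le_ge0 P0.
have beps M : lp_le q (fun j => if (j < M)%N then b j else 0) (2 * eps).
  pose P := schmidt_sum ip M one_seq f f.
  have bP : bounded_by P 1 by exact: projection_bnd.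
  have EP x : E (P x) = P x.
    rewrite /P /schmidt_sum (lin_sum _ _ _ lE); apply: eq_bigr => l _.
    by rewrite (linZ lE) Ef.
  have PE x : P (E x) = P x.
    by rewrite /P /schmidt_sum; apply: eq_bigr => l _; rewrite Esym Ef.
  have [cX _ X_eps] := comm P bP PE EP; set X := (P \o A) - (A \o P) in cX X_eps.
  have Xe j : (j < M)%N -> X (e j) = (b j)%:C *: f j.
    move=> jM; have Pe : P (e j) = 0.
      by rewrite /P /schmidt_sum big1// => l _; rewrite ef mulr0 scale0r.
    have -> : X (e j) = P (A (e j)) - A (P (e j)) by [].
    have [_ _ [[-> -> _]|[bpos [_ _ fj _ Ae]]]] := efb j.
      by rewrite (lin0 lA) (lin0 (bnd_lin bP)) (lin0 lA) subrr scale0r.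
    rewrite Pe (lin0 lA) subr0 Ae (linD (bnd_lin bP)) !(linZ (bnd_lin bP)) Pe scaler0 add0r.
    congr (_ *: _); rewrite /P /schmidt_sum (bigD1 (Ordinal jM))//= big1.
      by rewrite (ip1_nrm ip_norm fj) mul1r scale1r addr0.
    move=> i /negP ij; rewrite (proj1 of_) ?mulr0 ?scale0r// => jiE.
    by apply: ij; apply/eqP/val_inj.
  have lX : linear X by have [B /bnd_lin] := compact_operator_bnd cX.
  (* All [b l] with [l <= j] are at least [b j / 2], so the first [j + 1] vectors force the j-th
     singular number of [X] up to [b j / 2]; this is the 2 in [2 * eps]. *)
  have bX j : (j < M)%N -> b j <= 2 * singular_numbers ip X j.
    move=> jM; have [bj0|bj0] := eqVneq (b j) 0; first by rewrite bj0 mulr_ge0// sn_ge0.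
    have bjpos : 0 < b j by rewrite lt_neqAle eq_sym bj0 b0.
    have bl (l : 'I_j.+1) : b j / 2 <= b l.
      by have := bmono l j (ltn_ord l : (l <= j)%N); lra.
    have ul (l : 'I_j.+1) : ip (e l) (e l) = 1 /\ ip (f l) (f l) = 1.
      have [_ _ [[bl0 _ _]|[_ [_ el fl _ _]]]] := efb l; last by rewrite !(ip1_nrm ip_norm).
      by exfalso; have := bl l; rewrite bl0; lra.
    have : b j / 2 <= singular_numbers ip X j; last by lra.
    apply: (@gelfand_lower _ _ _ ip_norm _ (fun l : 'I_j.+1 => e l) (fun l : 'I_j.+1 => f l)
      (fun l : 'I_j.+1 => b l) X j) (sn_gelfand ip_norm j cX) => //.
    - move=> i l; have [->|il] := eqVneq i l; first by have [] := ul l.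
      by rewrite (proj1 oe)// => /val_inj/eqP; apply/negP.
    - by move=> i l il; rewrite (proj1 of_)// => /val_inj/eqP; apply/negP.
    - by move=> i; have [] := ul i.
    - by move=> i; apply: Xe; exact: leq_trans (ltn_ord i) jM.
    - by lra.
    - by rewrite card_ord.
  apply: lp_le_mono (lp_leZ (c := 2) _ eps0 _ X_eps) => //.
  - by rewrite mulr_ge0.
  - move=> j; case: ifP => jM; first by rewrite b0 bX.
    by rewrite lexx mulr_ge0// sn_ge0.
  - by move=> j; exact: sn_ge0.
have near r : exists l : R[i], forall v, decoupled e f r v -> nrm (A v - l *: v) <= 20 * b r * nrm v.
  have VD c u v : decoupled e f r u -> decoupled e f r v -> decoupled e f r (c *: u + v).
    move=> [Eu du] [Ev dv]; split; first by rewrite (linD lE) (linZ lE) Eu Ev.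
    move=> l lr; have [u1 u2 u3 u4] := du l lr; have [v1 v2 v3 v4] := dv l lr.
    by rewrite (linD lA) (linZ lA) !ipDl !ipZl u1 u2 u3 u4 v1 v2 v3 v4 !mulr0 !addr0.
  have [_ defect _] := efb r.
  have [l lP] := near_eigen_scalar ip_norm lA (mulr_ge0 (ler0n _ 2) (b0 r)) VD defect.
  by exists l => v /lP; rewrite mulrA -natrM.
(* One scalar for all levels up to [m]. The scalars of level [r] and of the deepest level are
   compared on a nonzero vector of the deepest: they differ by at most
   [20 b_r + 20 b_(m+1) <= 60 b_r], and [80 = 20 + 60]. If the deepest level contains only 0, the
   previous scalar is kept. *)
have unif m : exists l : R[i], forall r, (r <= m)%N -> forall v, decoupled e f r v ->
    nrm (A v - l *: v) <= 80 * b r * nrm v.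
  elim: m => [|m [l lP]].
    have [l lP] := near 0%N; exists l => r; rewrite leqn0 => /eqP-> v /lP/le_trans; apply.
    by rewrite ler_wpM2r ?nrm_ge0//; have := b0 0%N; lra.
  have [[v0 [dv0 v00]]|nov] := pselect (exists v, decoupled e f m.+1 v /\ nrm v != 0); last first.
    exists l => r; rewrite leq_eqVlt ltnS => /predU1P[->|/lP//] v dv.
    have [z|z] := eqVneq (nrm v) 0; last by exfalso; apply: nov; exists v.
    by rewrite (nrm0_eq0 z) (lin0 lA) scaler0 subr0 nrm0 mulr0.
  have vpos : 0 < nrm v0 by rewrite lt_neqAle eq_sym v00 nrm_ge0.
  have [k kP] := near m.+1; exists k => r rm v dv.
  have [h hP] := near r.
  have dv0r : decoupled e f r v0.
    by case: dv0 => [E0 d0]; split=> // i ir; apply: d0; exact: leq_trans rm.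
  have hk : cabs (h - k) <= 60 * b r.
    rewrite -(ler_pM2r vpos) -nrmZ.
    have -> : (h - k) *: v0 = (A v0 - k *: v0) - (A v0 - h *: v0).
      by rewrite scalerBl opprB [RHS]addrC subrKA.
    apply: le_trans (nrmB _ _) _; have := kP _ dv0; have := hP _ dv0r.
    by have := ler_wpM2r (ltW vpos) (bmono r m.+1 rm); lra.
  have -> : A v - k *: v = (A v - h *: v) + (h - k) *: v by rewrite scalerBl addrA subrK.
  apply: le_trans (nrmD _ _) _; rewrite nrmZ; have := hP _ dv.
  by have := ler_wpM2r (nrm_ge0 v) hk; lra.
have [l lP] := unif n; exists l.
have cAE : compact_operator (A - l *: E).
  by apply: compact_operatorB => //; exact: compact_operatorZ.
have sE j : (n <= j)%N -> singular_numbers ip (A - l *: E) j = 0.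
  move=> nj; apply/le_anti; rewrite sn_ge0// andbT; apply: sn_le => //.
  exists [set x | E x = 0]; first by apply: codim_leW cod.
  by move=> x /= Ex; rewrite !fctE Ex -AE Ex (lin0 lA) scaler0 subr0 nrm0 mul0r.
(* The value of [A - l *: E] at [x] depends only on [E x], and [E x] is decoupled at level [r] as
   soon as four families of [r] functionals vanish at [x]. *)
have s4 r : (r <= n)%N -> singular_numbers ip (A - l *: E) (4 * r) <= 80 * b r.
  move=> rn; apply: sn_le => //; first by rewrite mulr_ge0.
  pose ker (g : nat -> H -> R[i]) := [set x | forall i, (i < r)%N -> g i x = 0].
  pose g1 i x := ip (E x) (e i); pose g2 i x := ip (E x) (f i).
  pose g3 i x := ip (A x) (e i); pose g4 i x := ip (A x) (f i).
  have lin (T : H -> H) (lT : linear T) (w : nat -> H) i : scalar (fun x => ip (T x) (w i)).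
    by move=> c x y; rewrite lT ipDl ipZl.
  exists ((ker g1 `&` ker g2) `&` (ker g3 `&` ker g4)).
    rewrite (_ : 4 * r = (r + r) + (r + r))%N; last by lia.
    by do 2! apply: codim_leI; apply: codim_le_ker; exact: lin.
  move=> x [[/= x1 x2] [x3 x4]].
  have dEx : decoupled e f r (E x).
    split; first exact: EE.
    by move=> i ir; rewrite AE; split; [exact: x1|exact: x2|exact: x3|exact: x4].
  have := lP r rn _ dEx; rewrite AE => /le_trans; apply.
  rewrite ler_wpM2l ?mulr_ge0//; have [_ _ /(_ x)] := bE.
  by rewrite mul1r.
split=> //; first by rewrite !mulr_ge0 ?powR_ge0.
have B0 : 0 <= 2 * eps by rewrite mulr_ge0.
(* From index [n] on the singular numbers vanish, so [b] may be cut off after [n]; below that, index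
   [j] is compared with level [j %/ 4], which repeats each [b r] four times. *)
have c0 j : 0 <= (if (j < n.+1)%N then b j else 0) by case: ifP.
have := lp_le_dilate (k := 4) q0 isT (mulr_ge0 (ler0n _ 80) B0) (fun j => mulr_ge0 (ler0n _ 80) (c0 j))
  (lp_leZ (ler0n _ 80) B0 c0 (beps n.+1)).
apply: lp_le_mono => //; first by rewrite !mulr_ge0 ?powR_ge0.
move=> j; rewrite sn_ge0//=; have [jn|nj] := ltnP j n; last by rewrite sE// mulr_ge0.
have j4 : (j %/ 4 < n.+1)%N by rewrite ltnS (leq_trans (leq_div _ _)) // ltnW.
rewrite j4; apply: le_trans (s4 _ j4); apply: sn_noninc => //.
by rewrite mulnC leq_trunc_div.
Qed.

End NearlyCommuting.

(** * The case q < p *)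

Section LargeToSmall.
Context {R : realType} {H : completeNormedModType R[i]}.
Context (ip : {dot H for Num.conj}) (ip_norm : forall x : H, `|x| ^+ 2 = ip x x).
Context (p q : \bar R) (p0 : (0 < p)%E) (q0 : (0 < q)%E).
Context (Omega : (H -> H) -> (H -> H)) (Om : bicentralizer ip p q Omega).
Context (C : R) (C0 : 0 <= C) (OC : centralizes ip p q Omega C).
Context (e : nat -> H) (e_on : forall i j, ip (e i) (e j) = (i == j)%:R).
Implicit Types (a b f g P : H -> H) (s t : nat -> R).
Local Notation K := (quasi_const q).
Local Notation sn := (singular_numbers ip).
Local Notation diag N s := (schmidt_sum ip N s e e).
Local Notation E N := (schmidt_sum ip N one_seq e e).

Let oe : orthosys ip e.
Proof.
split=> [m n /eqP/negPf mn|n]; first by rewrite e_on mn.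
by right; rewrite e_on eqxx.
Qed.

Let e1 n : ip (e n) (e n) = 1. Proof. by rewrite e_on eqxx. Qed.

Let K1 : 1 <= K. Proof. exact: quasi_const_ge1. Qed.
Let K0 : 0 <= K. Proof. by rewrite (le_trans ler01). Qed.

Lemma schmidt_sum_adj N s (x y : nat -> H) (h z : H) :
  ip (schmidt_sum ip N s x y h) z = ip h (schmidt_sum ip N s y x z).
Proof.
rewrite ip_suml ip_sumr; apply: eq_bigr => n _; rewrite ipZl ipZr rmorphM/= conjC_real.
by rewrite -ipC; ring.
Qed.

Lemma schatten_le_proj N : schatten_le ip p (E N) (N%:R `^ inv_exp p).
Proof.
pose s (j : nat) : R := (j < N)%N%:R.
have -> : E N = diag N s.
  by apply/funext => h; apply: eq_bigr => n _; rewrite /s ltn_ord.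
apply: (schatten_le_schmidt_sum ip_norm) => //.
- by move=> i j ij; rewrite /s ler_nat; case: ltnP => // jN; rewrite (leq_ltn_trans ij jN).
- by move=> i Ni; rewrite /s ltnNge Ni.
- rewrite -[N%:R `^ _]mulr1; apply: lp_le_finite => // j jN; first by rewrite /s jN ler01 lexx.
  by rewrite /s ltnNge jN.
Qed.

Lemma proj_finite_rank N : finite_rank (E N).
Proof. by apply: finite_rank_schmidt_sum ler01 _ => // n _; rewrite normr1. Qed.

Lemma proj_idem N : E N \o E N = E N.
Proof.
apply: (@schmidt_sum_comp _ _ ip _ _ _ _ _ _ id N) => // [n _|n nN|n _]; last exact: mul1r.
- by constructor 1; exact: e1.
- by rewrite leqNgt nN.
Qed.

Definition decreasing_support N s : Prop :=
  [/\ forall i, 0 <= s i, forall i j, (i <= j)%N -> s j <= s i &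
      forall i, (N <= i)%N -> s i = 0].

Lemma decreasing_support_dilate N s k : (0 < k)%N -> decreasing_support N s ->
  decreasing_support (k * N) (fun j => s (j %/ k)%N).
Proof.
move=> k0 [s0 sd sN]; split=> // [i j ij|i Ni]; first by apply: sd; exact: leq_div2r.
by apply: sN; rewrite leq_divRL// mulnC.
Qed.

Lemma diag_finite_rank N s : decreasing_support N s -> finite_rank (diag N s).
Proof.
move=> [s0 sd _]; apply: finite_rank_schmidt_sum (s0 0%N) _ => // n _.
by rewrite ger0_norm// sd.
Qed.

Lemma schatten_le_diag r N s B : (0 < r)%E -> decreasing_support N s -> 0 <= B ->
  lp_le r s B -> schatten_le ip r (diag N s) B.
Proof. by move=> r0 [s0 sd sN] B0 sB; exact: (schatten_le_schmidt_sum ip_norm). Qed.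

(** * Orthogonal copies of a diagonal operator *)

Section Dilation.
Context (k N : nat) (k0 : (0 < k)%N).

(** The copies are interleaved along residue classes mod [k]: the diagonal operator with weights
    [s (j %/ k)] is then the sum of [k] copies of [diag N s], and its weights are still
    decreasing. *)
Definition copy (i : 'I_k) (n : nat) : nat := (k * n + i)%N.
Definition embed i : H -> H := schmidt_sum ip N one_seq e (e \o copy i).
Definition coembed i : H -> H := schmidt_sum ip N one_seq (e \o copy i) e.
Definition copy_proj i : H -> H := schmidt_sum ip N one_seq (e \o copy i) (e \o copy i).

Lemma copy_inj i j m n : copy i m = copy j n -> i = j /\ m = n.
Proof.
move=> E; have := congr1 (modn^~ k) E; have := congr1 (divn^~ k) E.
rewrite /copy ![(k * _)%N]mulnC !divnMDl// !modnMDl !modn_small// !divn_small// !addn0.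
by move=> -> /val_inj.
Qed.

Lemma copy_div i n : (copy i n %/ k)%N = n.
Proof. by rewrite /copy mulnC divnMDl// divn_small// addn0. Qed.

Let oeu i : orthosys ip (e \o copy i).
Proof. by apply: orthosys_reindex => // m n /copy_inj[]. Qed.

Lemma embed_bnd i : bounded_by (embed i) 1.
Proof. by apply: schmidt_sum_bnd => // n _; rewrite normr1. Qed.

Lemma coembed_bnd i : bounded_by (coembed i) 1.
Proof. by apply: schmidt_sum_bnd => // n _; rewrite normr1. Qed.

Lemma copy_proj_bnd i : bounded_by (copy_proj i) 1.
Proof. exact: projection_bnd. Qed.

Lemma embed_proj i : embed i \o E N = embed i.
Proof.
apply: (@schmidt_sum_comp _ _ ip _ _ _ _ _ _ id N) => // [n _|n nN|n _]; last exact: mul1r.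
- by constructor 1; exact: e1.
- by rewrite leqNgt nN.
Qed.

Lemma coembed_embed i j : coembed i \o embed j = if i == j then E N else 0.
Proof.
have [<-|ij] := eqVneq i j.
  apply: (@schmidt_sum_comp _ _ ip _ _ _ _ _ _ id N) => // [n _|n nN|n _]; last exact: mul1r.
  - by constructor 1; exact: e1.
  - by rewrite leqNgt nN.
apply/funext => h; rewrite /= /coembed /schmidt_sum big1// => n _.
rewrite ip_suml big1 ?mulr0 ?scale0r// => m _; rewrite ipZl /= e_on.
have [/copy_inj[ji _]|_] := eqVneq (copy j m) (copy i n); last by rewrite mulr0.
by rewrite ji eqxx in ij.
Qed.

Lemma embed_diag s i :
  embed i \o diag N s \o coembed i = schmidt_sum ip N s (e \o copy i) (e \o copy i).
Proof.
have -> : embed i \o diag N s = schmidt_sum ip N s e (e \o copy i).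
  apply: (@schmidt_sum_comp _ _ ip _ _ _ _ _ _ id N) => // [n _|n nN|n _]; last exact: mul1r.
  - by constructor 1; exact: e1.
  - by rewrite leqNgt nN.
apply: (@schmidt_sum_comp _ _ ip _ _ _ _ _ _ id N) => // [n _|n nN|n _]; last exact: mulr1.
- by constructor 1; exact: e1.
- by rewrite leqNgt nN.
Qed.

Lemma copy_proj_diag s i : decreasing_support N s ->
  copy_proj i \o diag (k * N) (fun j => s (j %/ k)%N) = embed i \o diag N s \o coembed i.
Proof.
move=> sN; rewrite embed_diag.
apply: schmidt_sum_comp => // [n _|n nN Nu|n _].
- by constructor 1; exact: e1.
- by have [_ _] := decreasing_support_dilate k0 sN; apply.
- by rewrite copy_div; exact: mul1r.
Qed.

Lemma sum_copy_proj_diag s : decreasing_support N s ->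
  (\sum_i copy_proj i) \o diag (k * N) (fun j => s (j %/ k)%N) =
  diag (k * N) (fun j => s (j %/ k)%N).
Proof.
move=> sN; apply/funext => h; rewrite /= fct_sumE.
rewrite (eq_bigr (fun i => schmidt_sum ip N s (e \o copy i) (e \o copy i) h)); last first.
  by move=> i _; rewrite -embed_diag -copy_proj_diag.
rewrite [RHS]/schmidt_sum (sum_ord_mul _ _ (fun j => ((s (j %/ k)%N)%:C * ip h (e j)) *: e j)).
rewrite exchange_big/=; apply: eq_bigr => n _; apply: eq_bigr => i _.
by rewrite -/(copy i n) copy_div.
Qed.

Lemma ip_embed i j (h h' : H) : ip (embed i h) (embed j h') = if i == j then ip h (E N h') else 0.
Proof.
rewrite schmidt_sum_adj -[X in ip h X]/((coembed i \o embed j) h') coembed_embed.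
by case: eqP => // _; rewrite ip0r.
Qed.

(* The operator [sum_i embed i \o T \o coembed i] consists of [k] orthogonal
   copies of the corner [E N \o T \o E N]. *)
Lemma sn_copies T j : compact_operator T ->
  sn (E N \o T \o E N) (j %/ k)%N <= sn (\sum_i (embed i \o T \o coembed i)) j.
Proof.
move=> cT; have bE : bounded_by (E N) 1 by exact: projection_bnd.
set T' := E N \o T \o E N; set S := \sum_i _; set l := (j %/ k)%N.
have cT' : compact_operator T'.
  by apply: (compact_operator_compr bE); exact: (compact_operator_compl bE).
have cS : compact_operator S.
  apply: compact_operator_sum => i _.
  by apply: (compact_operator_compr (coembed_bnd i)); exact: (compact_operator_compl (embed_bnd i)).
have [A /bnd_lin lT] := compact_operator_bnd cT.
have [A' /bnd_lin lS] := compact_operator_bnd cS.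
have [x [y [ox oy xy1 fx _]]] := schmidt_vectors ip_norm cT'.
have [->|sl0] := eqVneq (sn T' l) 0; first exact: sn_ge0.
have slpos : 0 < sn T' l by rewrite lt_neqAle eq_sym sl0 sn_ge0.
have sm (m : 'I_l.+1) : sn T' l <= sn T' m by apply: sn_noninc => //; rewrite -ltnS.
have sm0 (m : 'I_l.+1) : sn T' m != 0 by rewrite gt_eqF// (lt_le_trans slpos).
have EE (h : H) : E N (E N h) = E N h by rewrite -[LHS]/((E N \o E N) h) proj_idem.
have Ey (m : 'I_l.+1) : E N (y m) = y m.
  have [fxm _] := fx m; have : E N (T' (x m)) = T' (x m) by rewrite /T' /= EE.
  rewrite fxm (linZ (bnd_lin bE)) => /(congr1 (fun h => (sn T' m)^-1%:C *: h)).
  by rewrite !scalerA -rmorphM/= mulVf// rmorph1 !scale1r.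
have Ex (m : 'I_l.+1) : E N (x m) = x m.
  have [_ /(_ (x m - E N (x m)))] := fx m.
  have -> : T' (x m - E N (x m)) = 0.
    by rewrite /T' /= (linB (bnd_lin bE)) EE subrr (lin0 lT) (lin0 (bnd_lin bE)).
  rewrite ip0l => /esym/eqP; rewrite mulf_eq0 => /orP[/eqP s0|/eqP h0].
    by have := sm0 m; rewrite -(inj_eq (@complexI R)) s0 eqxx.
  apply/esym/eqP; rewrite -subr_eq0; apply/eqP/nrm0_eq0.
  have : ip (x m - E N (x m)) (x m - E N (x m)) = 0.
    rewrite -{2}scaleN1r ipDr ipZr h0 -schmidt_sum_adj (linB (bnd_lin bE)) EE subrr.
    by rewrite ip0l mulr0 addr0.
  by rewrite (ip_sqr ip_norm) => /(@complexI R)/eqP; rewrite sqrf_eq0 => /eqP.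
have SV i (h : H) : S (embed i h) = embed i (T (E N h)).
  rewrite /S fct_sumE (bigD1 i)//= -[coembed i (embed i h)]/((coembed i \o embed i) h).
  rewrite coembed_embed eqxx big1 ?addr0// => i' ii'.
  rewrite -[coembed i' (embed i h)]/((coembed i' \o embed i) h) coembed_embed (negPf ii').
  by rewrite (lin0 lT) (lin0 (bnd_lin (embed_bnd i'))).
(* The [k * (l + 1)] vectors [embed i (x m)] are orthonormal and are mapped to orthogonal vectors of
   length at least [sn T' l]; they outnumber [j] because [l = j %/ k]. *)
apply: (@gelfand_lower _ _ _ ip_norm _ (fun t : 'I_k * 'I_l.+1 => embed t.1 (x t.2))
  (fun t : 'I_k * 'I_l.+1 => embed t.1 (y t.2)) (fun t : 'I_k * 'I_l.+1 => sn T' t.2) S j) => //.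
- move=> [i m] [i' m']; rewrite ip_embed /= Ex xpair_eqE; have [_|//] := eqVneq i i'.
  have [->|mm] := eqVneq m m'; first by have [] := xy1 _ (sm0 m').
  by rewrite (proj1 ox)// => /val_inj/eqP; apply/negP.
- move=> [i m] [i' m']; rewrite ip_embed /= Ey xpair_eqE negb_and.
  have [_ /= mm|//] := eqVneq i i'.
  by rewrite (proj1 oy)// => /val_inj/eqP; apply/negP.
- by move=> [i m]; rewrite ip_embed /= eqxx Ey; have [] := xy1 _ (sm0 m).
- move=> [i m]; rewrite SV /= -(linZ (bnd_lin (embed_bnd i))) -(proj1 (fx m)).
  by rewrite -[RHS]/((embed i \o E N) (T (E N (x m)))) embed_proj.
- exact: ltW.
- by rewrite card_prod !card_ord mulnC ltn_ceil.
- exact: sn_gelfand.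
Qed.

End Dilation.

(** For a contraction [P] with [P \o E N = E N \o P = P], the left and the right estimate both
    approximate [Omega P]. Subtracting them shows that [Omega (E N)] commutes with [P] up to an
    error of order [N^(1/p)], and [commutator_scalar] applies to its corner. *)
Lemma proj_near_scalar : exists2 M, 0 <= M & forall N, exists c : R[i],
  schatten_le ip q (Omega (E N) - c *: E N) (M * N%:R `^ inv_exp p).
Proof.
pose M := K * (K * (2 * C) + 4%:R `^ inv_exp q * (80 * (2 * (K * (2 * C))))).
have M0 : 0 <= M by rewrite /M !(mulr_ge0, addr_ge0)// ?powR_ge0.
exists M => // N; set nu := N%:R `^ inv_exp p.
have nu0 : 0 <= nu by exact: powR_ge0.
have bE : bounded_by (E N) 1 by exact: projection_bnd.
have FE := proj_finite_rank N; have sE := schatten_le_proj N.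
have cE := finite_rank_compact ip_norm FE; have cO := Omega_compact ip_norm q0 Om FE.
pose A := E N \o Omega (E N) \o E N.
have cA : compact_operator A.
  by apply: (compact_operator_compr bE); exact: (compact_operator_compl bE).
have [alpha bA] := compact_operator_bnd cA.
have EE (x : H) : E N (E N x) = E N x by rewrite -[LHS]/((E N \o E N) x) proj_idem.
have EA (x : H) : E N (A x) = A x by rewrite /A /= EE.
have AE (x : H) : A (E N x) = A x by rewrite /A /= EE.
have comm P : bounded_by P 1 -> (forall x, P (E N x) = P x) -> (forall x, E N (P x) = P x) ->
    schatten_le ip q ((P \o A) - (A \o P)) (K * (2 * C * nu)).
  move=> bP PE EP.
  have -> : (P \o A) - (A \o P) = E N \o
     ((Omega (E N \o P) - (Omega (E N) \o P)) - (Omega (P \o E N) - (P \o Omega (E N)))) \o E N.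
    have -> : E N \o P = P by apply/funext => x; exact: EP.
    have -> : P \o E N = P by apply/funext => x; exact: PE.
    rewrite opprB [X in _ \o X \o _]addrC subrKA.
    apply/funext => x; rewrite /A /= !fctE /= (linB (bnd_lin bE)).
    by rewrite PE EP PE EP.
  have d1 := (OC bP FE sE).1; have d2 := (OC bP FE sE).2.
  have := schatten_le_comp ip_norm q0 (schatten_leB ip_norm q0 d2 d1) bE bE.
  by rewrite !mul1r (_ : C * 1 * nu + C * 1 * nu = 2 * C * nu)//; ring.
have cod : codim_le N [set x | E N x = 0].
  apply: codim_leW (codim_le_ker N (fun i => ip_scalar ip (e i))) => //.
  move=> h /= x0; rewrite /schmidt_sum big1// => n _.
  by rewrite x0// mulr0 scale0r.
have [c cP] := commutator_scalar ip_norm bA bE EA AE EE (@schmidt_sum_adj N one_seq e e) q0 cA cE comm cod.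
exists c; have d := Omega_comp ip_norm p0 q0 OC bE bE FE sE.
rewrite !proj_idem !mulr1 -/A in d.
have := schatten_leD ip_norm q0 d cP; rewrite subrKA; apply: schatten_leW => //.
by rewrite /M -/nu le_eqVlt; apply/orP; left; apply/eqP; ring.
Qed.

(** [D] depends on [k] alone and the scalar [c] is the same on both sides, which permits iteration.
    One [K] is paid for passing from the dilated operator to the sum of copies, the other for
    returning from the corner to [Omega (diag N s)]; [sn_copies] yields the gain [k^(-1/q)]. *)
Lemma dilation_step k : (0 < k)%N -> exists2 D, 0 <= D & forall N s B X c,
  decreasing_support N s -> 0 <= B -> lp_le p s B ->
  schatten_le ip q (Omega (diag (k * N) (fun j => s (j %/ k)%N)) -
    c *: diag (k * N) (fun j => s (j %/ k)%N)) X ->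
  schatten_le ip q (Omega (diag N s) - c *: diag N s)
    (K * K * (k%:R `^ inv_exp q)^-1 * X + D * B).
Proof.
move=> k0; pose iq := (k%:R `^ inv_exp q)^-1 : R; pose kp := k%:R `^ inv_exp p : R.
have kR : 0 < k%:R :> R by rewrite ltr0n.
have kq0 : 0 < k%:R `^ inv_exp q :> R by exact: powR_gt0.
have iq0 : 0 <= iq by rewrite invr_ge0 ltW.
have kp0 : 0 <= kp by exact: powR_ge0.
pose L := (2 * K) ^+ k; have L0 : 0 <= L by rewrite exprn_ge0// mulr_ge0.
pose Z := K * (C * k%:R * kp + L * (K * (C * kp + K * (2 * C)))).
have Z0 : 0 <= Z by rewrite /Z !(mulr_ge0, addr_ge0).
pose D := K * (iq * (K * Z) + K * (2 * C)).
have D0 : 0 <= D by rewrite /D !(mulr_ge0, addr_ge0).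
exists D => // N s B X c sN B0 sB gX; set g := diag (k * N) _ in gX.
set f := diag N s; have X0 := schatten_le_ge0 gX.
have Ff : finite_rank f by exact: diag_finite_rank.
have fB : schatten_le ip p f B by exact: schatten_le_diag.
have sN' := decreasing_support_dilate k0 sN; have [s0 _ _] := sN.
have Fg : finite_rank g by exact: diag_finite_rank.
have gB : schatten_le ip p g (kp * B).
  by apply: schatten_le_diag => //; [rewrite mulr_ge0|exact: lp_le_dilate].
pose R0 := \sum_(i < k) copy_proj N i.
have bR0 : bounded_by R0 k%:R.
  have := bnd_sum (index_enum 'I_k) (P := xpredT) (fun i _ => copy_proj_bnd N k0 i).
  by rewrite sumr_const card_ord.
pose T := Omega f - c *: f; pose S := \sum_(i < k) (embed N i \o T \o coembed N i).
have cT : compact_operator T.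
  apply: compact_operatorB; first exact: (Omega_compact ip_norm q0 Om).
  by apply: compact_operatorZ; exact: (finite_rank_compact ip_norm).
have bE : bounded_by (E N) 1 by exact: projection_bnd.
have d1 : schatten_le ip q (Omega g - (R0 \o Omega g)) (C * k%:R * kp * B).
  by have := (OC bR0 Fg gB).1; rewrite /R0 sum_copy_proj_diag// mulrA.
have d2 (i : 'I_k) : schatten_le ip q
    ((copy_proj N i \o Omega g) - (embed N i \o Omega f \o coembed N i)) (K * (C * kp + K * (2 * C)) * B).
  have a1 := (OC (copy_proj_bnd N k0 i) Fg gB).1.
  have a2 := Omega_comp ip_norm p0 q0 OC (embed_bnd N k0 i) (coembed_bnd N k0 i) Ff fB.
  have := schatten_leB ip_norm q0 a2 a1; rewrite copy_proj_diag//.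
  rewrite [X in schatten_le _ _ X _](_ : _ = (copy_proj N i \o Omega g) - (embed N i \o Omega f \o coembed N i)).
    by apply: schatten_leW => //; rewrite le_eqVlt; apply/orP; left; apply/eqP; ring.
  by rewrite opprB addrC subrKA.
have SE : S = (Omega g - c *: g) -
    ((Omega g - (R0 \o Omega g)) +
     \sum_(i < k) ((copy_proj N i \o Omega g) - (embed N i \o Omega f \o coembed N i))).
  have -> : R0 \o Omega g = \sum_(i < k) (copy_proj N i \o Omega g).
    by apply/funext => h; rewrite /= /R0 !fct_sumE.
  have -> : S = \sum_(i < k) (embed N i \o Omega f \o coembed N i) - c *: g.
    have gE : (\sum_(i < k) copy_proj N i) \o g = g by exact: sum_copy_proj_diag.
    rewrite /S -[in RHS]gE.
    apply/funext => h; rewrite !fctE !fct_sumE scaler_sumr -sumrB.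
    apply: eq_bigr => i _.
    rewrite -[copy_proj N i (g h)]/((copy_proj N i \o g) h) copy_proj_diag//= -/f.
    by rewrite /T !fctE (linB (bnd_lin (embed_bnd N k0 i))) (linZ (bnd_lin (embed_bnd N k0 i))).
  have cancel (V : zmodType) (a b d w : V) : d - w = (a - w) - ((a - b) + (b - d)).
    by rewrite subrKA opprB [RHS]addrC subrKA.
  by rewrite sumrB; exact: cancel.
have S_le : schatten_le ip q S (K * (X + Z * B)).
  have LB : 0 <= K * (C * kp + K * (2 * C)) * B by rewrite !(mulr_ge0, addr_ge0).
  rewrite SE; have := schatten_leD ip_norm q0 d1 (schatten_le_sum ip_norm q0 LB d2).
  move=> /(schatten_leB ip_norm q0 gX); apply: schatten_leW => //.
  by rewrite /Z -/L le_eqVlt; apply/orP; left; apply/eqP; ring.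
have [cS _ S_lp] := S_le.
pose T' := E N \o T \o E N.
have T'_le : schatten_le ip q T' (iq * (K * (X + Z * B))).
  have W0 : 0 <= K * (X + Z * B) by exact: schatten_le_ge0 S_le.
  have cT' : compact_operator T'.
    by apply: (compact_operator_compr bE); exact: (compact_operator_compl bE).
  split=> //; first by rewrite mulr_ge0.
  apply: (lp_le_undilate (k := k)) => //; first by rewrite mulr_ge0.
    by move=> j; exact: sn_ge0.
  rewrite mulrA mulfV ?gt_eqF// mul1r; apply: lp_le_mono S_lp => // j.
  by rewrite sn_ge0//= sn_copies.
have EfE : E N \o f \o E N = f.
  have -> : E N \o f = f.
    apply: (@schmidt_sum_comp _ _ ip _ _ _ _ _ _ id N) => // [n _|n nN|n _]; last exact: mul1r.
    - by constructor 1; exact: e1.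
    - by rewrite leqNgt nN.
  apply: (@schmidt_sum_comp _ _ ip _ _ _ _ _ _ id N) => // [n _|n nN|n _]; last exact: mulr1.
  - by constructor 1; exact: e1.
  - by rewrite leqNgt nN.
have TE : T = (Omega f - (E N \o Omega f \o E N)) + T'.
  have -> : T' = (E N \o Omega f \o E N) - c *: f.
    rewrite -[X in _ = _ - c *: X]EfE; apply/funext => h; rewrite /T' /T !fctE /=.
    by rewrite (linB (bnd_lin bE)) (linZ (bnd_lin bE)).
  by rewrite /T addrA subrK.
rewrite -/T TE; have := Omega_comp ip_norm p0 q0 OC bE bE Ff fB; rewrite EfE !mulr1 => d3.
have := schatten_leD ip_norm q0 d3 T'_le; apply: schatten_leW => //.
by rewrite /D -/iq le_eqVlt; apply/orP; left; apply/eqP; ring.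
Qed.

(** One dilation turns [B] into [k^(1/p) B], and [K^2 k^(1/p - 1/q) <= 1/2], so the error [2 D B]
    reproduces itself as [D B + D B] while the remainder is halved. The scalar depends on the number
    of iterations, hence on [N], but not on [s]. *)
Lemma diag_near_scalar : (q < p)%E -> exists2 M, 0 <= M & forall N, exists c : R[i],
  forall s B, decreasing_support N s -> 0 <= B -> lp_le p s B ->
    schatten_le ip q (Omega (diag N s) - c *: diag N s) (M * B).
Proof.
move=> qp; have d0 : 0 < inv_exp q - inv_exp p by rewrite subr_gt0 inv_exp_lt.
have [k k0 kP] := exists_powR_ge (2 * (K * K)) d0.
have kR : 0 < k%:R :> R by rewrite ltr0n.
pose kp : R := k%:R `^ inv_exp p; pose kq : R := k%:R `^ inv_exp q.
have kp0 : 0 < kp by exact: powR_gt0.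
have kp1 : 1 <= kp.
  have : (k%:R : R) `^ 0 <= k%:R `^ inv_exp p by rewrite ler_powR ?inv_exp_ge0// ler1n.
  by rewrite powRr0.
have kq0 : 0 < kq by exact: powR_gt0.
have half : K * K * kq^-1 * kp <= 1 / 2.
  have : k%:R `^ (inv_exp q - inv_exp p) * kp = kq :> R.
    by rewrite -powRD ?subrK// pnatr_eq0 -lt0n k0 implybT.
  move=> pw; have := ler_wpM2r (ltW kp0) kP; rewrite pw => kk.
  by rewrite mulrAC ler_pdivrMr//; lra.
have [D D0 DP] := dilation_step k0; have [M1 M10 M1P] := proj_near_scalar.
pose M2 := K * (C + M1); have M20 : 0 <= M2 by rewrite /M2 mulr_ge0 ?addr_ge0.
pose cc N : R[i] := projT1 (cid (M1P N)).
have ccP N : schatten_le ip q (Omega (E N) - cc N *: E N) (M1 * N%:R `^ inv_exp p).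
  by rewrite /cc; case: cid.
(* [B] controls the l_p norm of [s], which dilation multiplies by [kp], whereas
   the supremum [A] of [s] is unchanged: this is what makes the error decay. *)
have iter J : forall N s B A, decreasing_support N s -> 0 <= B -> 0 <= A -> lp_le p s B ->
    (forall n, s n <= A) ->
    schatten_le ip q (Omega (diag N s) - cc (N * k ^ J)%N *: diag N s)
      (2 * D * B + 2 ^- J * M2 * A * N%:R `^ inv_exp p).
  elim: J => [|J IH] N s B A sN B0 A0 sB sA.
    rewrite expn0 muln1 expr0 invr1 mul1r.
    have [s0 _ _] := sN; have bs : bounded_by (diag N s) A.
      by apply: schmidt_sum_bnd => // n _; rewrite ger0_norm.
    have sE : diag N s \o E N = diag N s.
      apply: (@schmidt_sum_comp _ _ ip _ _ _ _ _ _ id N) => // [n _|n nN|n _]; last exact: mulr1.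
      - by constructor 1; exact: e1.
      - by rewrite leqNgt nN.
    have b1 := (OC bs (proj_finite_rank N) (schatten_le_proj N)).1; rewrite sE in b1.
    have b2 := schatten_le_compl ip_norm q0 (ccP N) bs.
    have := schatten_leD ip_norm q0 b1 b2.
    rewrite [X in schatten_le _ _ X _](_ : _ = Omega (diag N s) - cc N *: diag N s); last first.
      rewrite -[X in _ = _ - _ *: X]sE; apply/funext => h; rewrite !fctE /= (linB (bnd_lin bs)).
      by rewrite (linZ (bnd_lin bs)) addrA subrK.
    apply: schatten_leW => //; rewrite /M2.
    have : 0 <= 2 * D * B by rewrite !mulr_ge0.
    by lra.
  have sN' := decreasing_support_dilate k0 sN; have [s0 _ _] := sN.
  have kB0 : 0 <= kp * B by rewrite mulr_ge0// ltW.
  have := IH _ _ (kp * B) A sN' kB0 A0 (lp_le_dilate p0 k0 B0 s0 sB) (fun n => sA _).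
  rewrite (_ : (k * N * k ^ J = N * k ^ J.+1)%N); last by rewrite expnS mulnCA mulnA.
  move=> /(DP _ _ _ _ _ sN B0 sB); apply: schatten_leW => //.
  rewrite natrM powRM ?ler0n// -/kp -/kq exprS invfM.
  pose V := 2 ^- J * M2 * A * N%:R `^ inv_exp p; have V0 : 0 <= V.
    have J0 : 0 <= 2 ^- J :> R by rewrite invr_ge0 exprn_ge0.
    exact: (mulr_ge0 (mulr_ge0 (mulr_ge0 J0 M20) A0) (powR_ge0 _ _)).
  have -> : 2 * D * (kp * B) + 2 ^- J * M2 * A * (kp * N%:R `^ inv_exp p) =
    kp * (2 * D * B + V) by rewrite /V; ring.
  have -> : 2^-1 * 2 ^- J * M2 * A * N%:R `^ inv_exp p = 2^-1 * V by rewrite /V; ring.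
  have W0 : 0 <= 2 * D * B + V by rewrite addr_ge0// !mulr_ge0.
  have := ler_wpM2r W0 half; rewrite -[_ * kp * _]mulrA; lra.
exists (2 * D + M2); first by rewrite addr_ge0// mulr_ge0.
(* Enough iterations to absorb [N^(1/p)]; as [s n <= B], the remainder then costs at most
   [M2 * B]. *)
move=> N; have [J NJ] : exists J, N%:R `^ inv_exp p <= 2 ^+ J :> R.
  exists (Num.truncn (N%:R `^ inv_exp p : R)).+1.
  apply: le_trans (ltW (truncnS_gt _)) _.
  by rewrite -natrX ler_nat ltnW// ltn_expl.
exists (cc (N * k ^ J)%N) => s B sN B0 sB; have [s0 sd _] := sN.
have sB' n : s n <= B by apply: le_trans (sd 0%N n _) _ => //; exact: lp_le0 sB.
apply: schatten_leW (iter J N s B B sN B0 B0 sB sB') => //.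
have t1 : 2 ^- J * N%:R `^ inv_exp p <= 1 :> R.
  by rewrite mulrC ler_pdivrMr ?exprn_gt0// mul1r.
have := ler_wpM2l (mulr_ge0 M20 B0) t1; lra.
Qed.

(** The scalars are bounded by testing on the rank-one [E 1], so they have a cluster point. For
    given [N], the scalar of some larger index is within [1 / (N^(1/q) + 1)] of it. As [diag N s]
    has q-norm at most [N^(1/q) B], exchanging the two scalars costs at most [B]. *)
Lemma diag_scalar : (q < p)%E -> exists (c : R[i]) (M : R), 0 <= M /\
  forall N s B, decreasing_support N s -> 0 <= B -> lp_le p s B ->
    schatten_le ip q (Omega (diag N s) - c *: diag N s) (M * B).
Proof.
move=> qp; have [M M0 MP] := diag_near_scalar qp.
pose c N : R[i] := projT1 (cid (MP N)).
have cP N s B : decreasing_support N s -> 0 <= B -> lp_le p s B ->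
    schatten_le ip q (Omega (diag N s) - c N *: diag N s) (M * B).
  by rewrite /c; case: cid => /= c' H1; exact: H1.
pose d (n : nat) : R := (n == 0%N)%:R.
have dN N : decreasing_support N.+1 d.
  split=> [i|[|i] [|j]|[|i]]; rewrite /d ?ler0n//=.
have dE N : diag N.+1 d = E 1.
  apply/funext => h; rewrite (@schmidt_sum_widen _ _ ip 1)//; last by case.
  by rewrite /schmidt_sum !big_ord1.
have d1 : lp_le p d 1.
  suff : lp_le p d (1%:R `^ inv_exp p * 1) by rewrite powR1 mulr1.
  apply: lp_le_finite => //; last by case.
  by case=> [|n]//; rewrite /d ler01 lexx.
have [B1 OP] := Omega_schatten ip_norm q0 Om (proj_finite_rank 1).
(* The index is [N.+1] because with no vectors at all the scalar would be arbitrary. *)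
have cB N : cabs (c N.+1) <= K * (B1 + M).
  have := cP _ _ 1 (dN N) ler01 d1; rewrite dE mulr1 => /(schatten_leB ip_norm q0 OP).
  rewrite subKr => /(schatten_le_bnd ip_norm q0) -[_ _ /(_ (e 0%N))].
  have -> : (c N.+1 *: E 1) (e 0%N) = c N.+1 *: e 0%N.
    by rewrite fctE /schmidt_sum big_ord1 e1 mulr1 scale1r.
  by rewrite nrmZ (nrm1_ip ip_norm (e1 0)) !mulr1.
(* Compactness is applied to the vectors [c N.+1 *: e 0]; the scalar is read off their cluster point
   [z] as [ip z (e 0)]. *)
have [K' cK' K'P] := compact_disc (e 0%N) (K * (B1 + M)).
have [|z [_ zcl]] := cK' ((fun N => c N.+1 *: e 0%N) @ \oo) _.
  by exists 0%N => // n _; exact: K'P.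
exists (ip z (e 0%N)), (K * (M + 1)); split; first by rewrite mulr_ge0// addr_ge0.
move=> N s B sN B0 sB; pose nq := N%:R `^ inv_exp q : R.
have nq0 : 0 <= nq by exact: powR_ge0.
have nq1 : 0 < nq + 1 by lra.
have zball : nbhs z [set v | nrm (z - v) < (nq + 1)^-1].
  by apply/nbhs_nrmP; exists (nq + 1)^-1 => //; rewrite invr_gt0.
have [|_ [[n /= Nn <-] zn]] :=
    zcl ((fun N => c N.+1 *: e 0%N) @` [set n | (N <= n)%N]) _ _ zball.
  by exists N => // n Nn; exists n.
have cz : cabs (c n.+1 - ip z (e 0%N)) <= (nq + 1)^-1.
  have := cauchy_schwarz ip_norm (z - c n.+1 *: e 0%N) (e 0%N).
  rewrite (nrm1_ip ip_norm (e1 0)) mulr1 ipBl ipZl e1 mulr1 -cabsN opprB.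
  by move=> /le_trans; apply; exact: ltW.
have [s0 sd sN0] := sN.
have sN' : decreasing_support n.+1 s.
  by split=> // i ni; apply: sN0; apply: leq_trans ni; exact: leqW.
have fE : diag n.+1 s = diag N s.
  by apply/funext => h; apply: schmidt_sum_widen => //; exact: leqW.
have := cP _ _ _ sN' B0 sB; rewrite fE => a1.
have a2 : schatten_le ip q (diag N s) (nq * B).
  apply: schatten_le_diag => //; first by rewrite mulr_ge0.
  apply: lp_le_finite => // j _; rewrite s0 /=.
  by apply: le_trans (sd 0%N j _) _ => //; exact: lp_le0 sB.
have := schatten_leD ip_norm q0 a1 (schatten_leZ ip_norm (c n.+1 - ip z (e 0%N)) q0 a2).
rewrite scalerBl addrA subrK; apply: schatten_leW => //.
rewrite -mulrA ler_wpM2l// mulrDl lerD2l mul1r mulrA ler_piMl//.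
apply: le_trans (ler_wpM2r nq0 cz) _; rewrite mulrC ler_pdivrMr// mul1r; lra.
Qed.

(** The partial isometries [X] and [Y] carry the diagonal operator of the singular numbers to [f].
    [Omega_comp] bounds the error of moving them through [Omega], and the scalar term is carried
    over exactly. *)
Lemma finite_rank_scalar : (q < p)%E -> exists (c : R[i]) (M : R), 0 <= M /\
  forall f B, finite_rank f -> schatten_le ip p f B ->
    schatten_le ip q (Omega f - c *: f) (M * B).
Proof.
move=> qp; have [c [M [M0 MP]]] := diag_scalar qp.
exists c, (K * (K * (2 * C) + M)); split.
  by rewrite mulr_ge0// addr_ge0// !mulr_ge0.
move=> f B Ff [cf B0 fB].
have [N [x [y [ox oy xy1 sN fE]]]] := finite_rank_schmidt ip_norm Ff.
have s0 i : 0 <= sn f i by exact: sn_ge0.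
have sNf : decreasing_support N (sn f).
  by split=> // i j; exact: sn_noninc.
pose Y := schmidt_sum ip N one_seq e y; pose X := schmidt_sum ip N one_seq x e.
have bY : bounded_by Y 1 by apply: schmidt_sum_bnd => // n _; rewrite normr1.
have bX : bounded_by X 1 by apply: schmidt_sum_bnd => // n _; rewrite normr1.
have YDX : Y \o diag N (sn f) \o X = f.
  have -> : Y \o diag N (sn f) = schmidt_sum ip N (sn f) e y.
    apply: (@schmidt_sum_comp _ _ ip _ _ _ _ _ _ id N) => // [n _|n nN|n _]; last exact: mul1r.
    - by constructor 1; exact: e1.
    - by rewrite leqNgt nN.
  rewrite [RHS]fE.
  apply: (@schmidt_sum_comp _ _ ip _ _ _ _ _ _ id N) => // [n _|n nN|n _]; last exact: mulr1.
  - by constructor 1; exact: e1.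
  - by rewrite leqNgt nN.
have FD := diag_finite_rank sNf.
have a1 := Omega_comp ip_norm p0 q0 OC bY bX FD (schatten_le_diag p0 sNf B0 fB).
have a2 := schatten_le_comp ip_norm q0 (MP _ _ _ sNf B0 fB) bY bX.
rewrite YDX in a1; have := schatten_leD ip_norm q0 a1 a2; rewrite !mul1r !mulr1.
rewrite [X in schatten_le _ _ X _](_ : _ = Omega f - c *: f).
  by apply: schatten_leW => //; rewrite le_eqVlt; apply/orP; left; apply/eqP; ring.
rewrite -[X in _ = _ - _ *: X]YDX; apply/funext => h; rewrite !fctE /=.
by rewrite (linB (bnd_lin bY)) (linZ (bnd_lin bY)) addrA subrK.
Qed.

End LargeToSmall.

(** * Finite-dimensional spaces and the two cases together *)

Section Main.
Context {R : realType} {H : completeNormedModType R[i]}.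
Context (ip : {dot H for Num.conj}) (ip_norm : forall x : H, `|x| ^+ 2 = ip x x).
Context (p q : \bar R) (p0 : (0 < p)%E) (q0 : (0 < q)%E).
Context (Omega : (H -> H) -> (H -> H)) (Om : bicentralizer ip p q Omega).

Lemma schatten_norm_le_of f g (M : R) : finite_rank f -> 0 <= M ->
  (forall B, schatten_le ip p f B -> schatten_le ip q g (M * B)) ->
  (schatten_norm ip q g <= M%:E * schatten_norm ip p f)%E.
Proof.
move=> Ff M0 fg.
have [B -> fB] := schatten_schatten_le ip_norm p0 (finite_rank_schatten ip_norm p0 Ff).
by rewrite -EFinM; apply: (schatten_le_schatten_norm ip_norm q0); exact: fg.
Qed.

(** Write [f = f \o id]: the left centralizer estimate with multiplier [f] compares [Omega f] with
    [f \o Omega id], and the operator norm of [f] is at most its p-norm. *)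
Lemma finite_dim_bounded : finite_rank (@id H) -> exists M : R, 0 <= M /\
  forall f B, finite_rank f -> schatten_le ip p f B -> schatten_le ip q (Omega f) (M * B).
Proof.
move=> Fid; have [C C0 OC] := bicentralizer_centralizes ip_norm p0 q0 Om.
have [D _ idD] := schatten_schatten_le ip_norm p0 (finite_rank_schatten ip_norm p0 Fid).
have [A OA] := Omega_schatten ip_norm q0 Om Fid.
have D0 := schatten_le_ge0 idD; have A0 := schatten_le_ge0 OA.
have K0 : 0 <= quasi_const q by rewrite (le_trans ler01)// quasi_const_ge1.
exists (quasi_const q * (C * D + A)); split; first by rewrite mulr_ge0// addr_ge0// mulr_ge0.
move=> f B Ff fB; have bf := schatten_le_bnd ip_norm p0 fB.
have a1 := (OC _ _ _ _ bf Fid idD).1; have a2 := schatten_le_compl ip_norm q0 OA bf.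
have := schatten_leD ip_norm q0 a1 a2; rewrite subrK; apply: schatten_leW => //.
by rewrite le_eqVlt; apply/orP; left; apply/eqP; ring.
Qed.

Lemma small_to_large_bounded : (p < q)%E -> exists M : R, 0 <= M /\
  forall f B, finite_rank f -> schatten_le ip p f B -> schatten_le ip q (Omega f) (M * B).
Proof.
move=> pq; have [C C0 OC] := bicentralizer_centralizes ip_norm p0 q0 Om.
have [M M0 MP] := schmidt_sum_bounded ip_norm p0 q0 Om C0 OC pq.
exists M; split=> // f B Ff [cf B0 fB].
have [N [x [y [ox oy xy1 sN ->]]]] := finite_rank_schmidt ip_norm Ff.
apply: MP => //; first by move=> i; exact: sn_ge0.
by move=> i j; exact: sn_noninc.
Qed.

Lemma large_to_small_scalar : (q < p)%E -> exists (c : R[i]) (M : R), 0 <= M /\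
  forall f B, finite_rank f -> schatten_le ip p f B ->
    schatten_le ip q (Omega f - c *: f) (M * B).
Proof.
move=> qp; have [C C0 OC] := bicentralizer_centralizes ip_norm p0 q0 Om.
have [Fid|infH] := pselect (finite_rank (@id H)).
  have [M [M0 MP]] := finite_dim_bounded Fid.
  by exists 0, M; split=> // f B Ff /(MP _ _ Ff); rewrite scale0r subr0.
have [e e_on] := orthonormal_sequence ip_norm infH.
exact: (finite_rank_scalar ip_norm p0 q0 Om C0 OC e_on).
Qed.

End Main.

Theorem theorem4 (R : realType) (H : completeNormedModType R[i])
    (ip : {dot H for Num.conj})
    (ip_norm : forall x : H, `|x| ^+ 2 = ip x x)
    (sepH : separable H)
    (p q : \bar R) (p_gt0 : (0 < p)%E) (q_gt0 : (0 < q)%E) (pq : p <> q)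
    (Omega : (H -> H) -> (H -> H)) (Om : bicentralizer ip p q Omega) :
  (exists (c : R[i]) (M : R), 0 <= M /\ forall f, finite_rank f ->
     (schatten_norm ip q (Omega f - c *: f)%R <= M%:E * schatten_norm ip p f)%E)
  /\ ((p < q)%E -> bounded_on_finite_rank ip p q Omega).
Proof.
have small : (p < q)%E -> exists M : R, 0 <= M /\ forall f, finite_rank f ->
    (schatten_norm ip q (Omega f) <= M%:E * schatten_norm ip p f)%E.
  move=> /(small_to_large_bounded ip_norm p_gt0 q_gt0 Om)[M [M0 MP]].
  exists M; split=> // f Ff; apply: (schatten_norm_le_of ip_norm) => // B; exact: MP.
split; last by move=> /small[M [_ MP]]; exists M.
case: (ltgtP p q) => [/small[M [M0 MP]]|qp|//].
  by exists 0, M; split=> // f Ff; rewrite scale0r subr0; exact: MP.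
have [c [M [M0 MP]]] := large_to_small_scalar ip_norm p_gt0 q_gt0 Om qp.
exists c, M; split=> // f Ff; apply: (schatten_norm_le_of ip_norm) => // B; exact: MP.
Qed.
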